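(* Let $G$ be a finite group and let $\underline{S}^{-1}\underline{A}$ be obtained from the Burnside Tambara functor $\underline{A}$ by inverting the class $[G/e]\in\underline{A}(G/G)$. (a) There is an isomorphism of Tambara functors $\underline{S}^{-1}\underline{A}\cong\underline{\mathbb{Z}}[\tfrac{1}{|G|}]$. (b) Any $\underline{S}^{-1}\underline{A}$-module $\underline{M}$ is isomorphic to the fixed point functor on $\underline{M}(G/e)$, i.e. $\underline{M}\cong\mathrm{FP}(\underline{M}(G/e))$. (c) There is an equivalence of categories between $\underline{S}^{-1}\underline{A}$-modules and $\mathbb{Z}[\tfrac{1}{|G|}][G]$-modules.
   Context: $\mathrm{Set}^G$ is the category of finite $G$-sets. The Burnside category $\mathcal{A}^G$ has finite $G$-sets as objects and $\mathcal{A}^G(X,Y)$ is the group completion (under disjoint union) of isomorphism classes of spans $X\leftarrow S\to Y$, composed by pullback. A Mackey functor is an additive functor $\mathcal{A}^G\to\mathrm{Ab}$; a map $f\colon X\to Y$ of finite $G$-sets gives a restriction $\underline{M}(Y)\to\underline{M}(X)$ and a transfer $\underline{M}(X)\to\underline{M}(Y)$. A ($G$-)Tambara functor is a product-preserving functor $\underline{R}\colon\mathcal{P}^G\to\mathrm{Set}$ with all $\underline{R}(X)$ abelian groups, where $\mathcal{P}^G$ is Tambara's category of polynomials: objects are finite $G$-sets and morphisms $X\to Y$ are isomorphism classes of diagrams $X\leftarrow A\to B\to Y$ of finite $G$-sets (encoding restriction, then norm, then transfer). Each $\underline{R}(X)$ is then a commutative ring and there are restriction, transfer and norm maps along every map of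 finite $G$-sets. The Burnside Tambara functor $\underline{A}$ has $\underline{A}(X)$ the additive group completion of the semiring of isomorphism classes of finite $G$-sets over $X$; so $\underline{A}(G/H)$ is the Burnside ring of $H$, with restriction given by restriction of the action, transfer by induction and norm by coinduction. Localization: $\underline{A}\to\underline{S}^{-1}\underline{A}$ is the initial map of Tambara functors out of $\underline{A}$ sending $[G/e]$ to a unit. Fixed points: for a $G$-module $V$, $\mathrm{FP}(V)$ is the Mackey functor with $\mathrm{FP}(V)(G/H)=V^H$, restrictions the inclusions of fixed points, and transfers $V^K\to V^H$, $v\mapsto\sum_{hK\in H/K}hv$. If $V$ is a commutative ring with $G$ acting by ring automorphisms, $\mathrm{FP}(V)$ is a Tambara functor with norms $v\mapsto\prod_{hK\in H/K}hv$. $\underline{\mathbb{Z}}[\tfrac{1}{|G|}]$ denotes $\mathrm{FP}(\mathbb{Z}[\tfrac{1}{|G|}])$ with trivial $G$-action. For a Mackey functor $\underline{M}$, $\underline{M}(G/e)$ is a $G$-module via the automorphisms of $G/e$ (Weyl action). Modules: the box product $\boxtimes$ of Mackey functors is the Day convolution built from the Cartesian product of finite $G$-sets and $\otimes_{\mathbb{Z}}$. The underlying Mackey functor of a Tambara functor $\underline{R}$ is a commutative monoid for $\boxtimes$, and an $\underline{R}$-module is a Mackey functor $\underline{M}$ with a unital associative action $\underline{R}\boxtimes\underline{M}\to\underline{M}$. *)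

(* Defs.v *)
From HB Require Import structures.
From mathcomp Require Import all_boot all_order all_algebra all_fingroup.
From mathcomp Require Import boolp.

Set Implicit Arguments.
Unset Strict Implicit.
Unset Printing Implicit Defensive.

Import GRing.Theory.

Local Open Scope ring_scope.

Lemma inj_surj_bij (T U : Type) (f : T -> U) :
  injective f -> (forall u, exists t, f t = u) -> bijective f.
Proof.
move=> fi fs; exists (fun u => sval (cid (fs u))) => [t|u].
  by apply: fi; case: cid.
by case: cid.
Qed.

Lemma big_sig (R : Type) (idx : R) (op : Monoid.com_law idx) (T : finType)
    (P Q : pred T) (F : T -> R) :
  \big[op/idx]_(z : {x : T | P x} | Q (val z)) F (val z) =
  \big[op/idx]_(x | P x && Q x) F x.
Proof.
rewrite [RHS](reindex_omap (val : {x : T | P x} -> T) insub); last first.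
  by move=> i /andP[iA Pi]; rewrite insubT.
by apply: eq_bigl=> -[i iA] /=; rewrite iA insubT /= eqxx andbT.
Qed.

Record gset (G : finGroupType) := GSet {
  gcar :> finType;
  gact : G -> gcar -> gcar;
  gact1 : forall x, gact 1%g x = x;
  gactM : forall g h x, gact (g * h)%g x = gact g (gact h x) }.

Record ghom (G : finGroupType) (X Y : gset G) := GHom {
  gfun :> X -> Y;
  gfunE : forall g x, gfun (gact g x) = gact g (gfun x) }.

Section GSets.
Variable G : finGroupType.
Implicit Types X Y Z : gset G.

Lemma gactK X g : cancel (gact g) (@gact G X g^-1%g).
Proof. by move=> x; rewrite -gactM mulVg gact1. Qed.

Lemma gactVK X g : cancel (gact g^-1%g) (@gact G X g).
Proof. by move=> x; rewrite -gactM mulgV gact1. Qed.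

Lemma gact_inj X g : injective (@gact G X g).
Proof. exact: can_inj (@gactK X g). Qed.

Lemma gact_bij X g : bijective (@gact G X g).
Proof. by exists (gact g^-1%g); [exact: gactK | exact: gactVK]. Qed.

Definition gid X : ghom X X := @GHom G X X id (fun _ _ => erefl).

Lemma gcomp_subproof X Y Z (f : ghom Y Z) (h : ghom X Y) g x :
  f (h (gact g x)) = gact g (f (h x)).
Proof. by rewrite !gfunE. Qed.
Definition gcomp X Y Z (f : ghom Y Z) (h : ghom X Y) : ghom X Z :=
  GHom (gcomp_subproof f h).

Definition gpoint : gset G :=
  @GSet G unit (fun _ x => x) (fun _ => erefl) (fun _ _ _ => erefl).

Definition gempty : gset G :=
  @GSet G void (fun _ x => x) (fun _ => erefl) (fun _ _ _ => erefl).

Definition gto_point X : ghom X gpoint := @GHom G X gpoint (fun _ => tt) (fun _ _ => erefl).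

Lemma gof_empty_subproof X g (x : gempty) :
  of_void X (gact g x) = gact g (of_void X x).
Proof. by case: x. Qed.
Definition gof_empty X : ghom gempty X := GHom (@gof_empty_subproof X).

Definition gsum X Y : gset G.
Proof.
refine (@GSet G (X + Y)%type (fun g z => match z with inl x => inl (gact g x) | inr y => inr (gact g y) end) _ _).
- by case=> x; rewrite gact1.
- by move=> g h [x|x]; rewrite gactM.
Defined.

Definition ginl X Y : ghom X (gsum X Y) := @GHom G X (gsum X Y) inl (fun _ _ => erefl).
Definition ginr X Y : ghom Y (gsum X Y) := @GHom G Y (gsum X Y) inr (fun _ _ => erefl).

Definition gcopair X Y Z (f : ghom X Z) (h : ghom Y Z) : ghom (gsum X Y) Z.
Proof.
refine (@GHom G (gsum X Y) Z (fun u => match u with inl x => f x | inr y => h y end) _).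
by move=> g [x|y] /=; rewrite gfunE.
Defined.

Definition gfold X : ghom (gsum X X) X := gcopair (gid X) (gid X).

Definition gprod X Y : gset G.
Proof.
refine (@GSet G (X * Y)%type (fun g z => (gact g z.1, gact g z.2)) _ _).
- by case=> x y; rewrite /= !gact1.
- by move=> g h [x y]; rewrite /= !gactM.
Defined.

Definition gfst X Y : ghom (gprod X Y) X := @GHom G (gprod X Y) X fst (fun _ _ => erefl).
Definition gsnd X Y : ghom (gprod X Y) Y := @GHom G (gprod X Y) Y snd (fun _ _ => erefl).

Definition gprodmap X X' Y Y' (f : ghom X X') (h : ghom Y Y') :
  ghom (gprod X Y) (gprod X' Y').
Proof.
refine (@GHom G (gprod X Y) (gprod X' Y') (fun z => (f z.1, h z.2)) _).
by move=> g [x y] /=; rewrite !gfunE.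
Defined.

Definition gassoc X Y Z : ghom (gprod (gprod X Y) Z) (gprod X (gprod Y Z)) :=
  @GHom G (gprod (gprod X Y) Z) (gprod X (gprod Y Z))
    (fun z => (z.1.1, (z.1.2, z.2))) (fun _ _ => erefl).

Definition gsub X (P : pred X) (HP : forall g x, P x -> P (gact g x)) : gset G.
Proof.
refine (@GSet G {x : X | P x} (fun g z => exist _ (gact g (val z)) (HP g _ (valP z))) _ _).
- by move=> x; apply: val_inj; rewrite /= gact1.
- by move=> g h x; apply: val_inj; rewrite /= gactM.
Defined.

Definition gval X (P : pred X) (HP : forall g x, P x -> P (gact g x)) :
  ghom (gsub HP) X := @GHom G (gsub HP) X val (fun _ _ => erefl).

Lemma gpull_subproof X Y Z (f : ghom X Z) (h : ghom Y Z) g (z : gprod X Y) :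
  f z.1 == h z.2 -> f (gact g z).1 == h (gact g z).2.
Proof. by move=> /eqP e; rewrite /= !gfunE e. Qed.
Definition gpull X Y Z (f : ghom X Z) (h : ghom Y Z) : gset G := gsub (@gpull_subproof X Y Z f h).

Definition gpull1 X Y Z (f : ghom X Z) (h : ghom Y Z) : ghom (gpull f h) X :=
  gcomp (gfst X Y) (gval (@gpull_subproof X Y Z f h)).
Definition gpull2 X Y Z (f : ghom X Z) (h : ghom Y Z) : ghom (gpull f h) Y :=
  gcomp (gsnd X Y) (gval (@gpull_subproof X Y Z f h)).

(* Partial functions, with the conjugation action *)
Definition gpfun X Y : gset G.
Proof.
refine (@GSet G {ffun X -> option Y}
  (fun g s => [ffun x => omap (gact g) (s (gact g^-1%g x))]) _ _).
- move=> s; apply/ffunP => x; rewrite ffunE invg1 gact1.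
  by case: (s x) => //= y; rewrite gact1.
- move=> g h s; apply/ffunP => x; rewrite !ffunE invMg gactM.
  by case: (s _) => //= y; rewrite gactM.
Defined.

(* G/e: G acting on itself by left translations *)
Definition gfree : gset G.
Proof.
refine (@GSet G G (fun g x => (g * x)%g) _ _).
- exact: mul1g.
- by move=> g h x; rewrite mulgA.
Defined.

Definition gfree_rmul (g : G) : ghom gfree gfree.
Proof.
refine (@GHom G gfree gfree (fun x => (x * g)%g) _).
by move=> h x; rewrite /= mulgA.
Defined.

End GSets.

Record span (G : finGroupType) (X Y : gset G) := Span {
  sapex : gset G;
  sleft : ghom sapex X;
  sright : ghom sapex Y }.

Section Spans.
Variable G : finGroupType.
Implicit Types X Y Z : gset G.

Definition span_iso X Y (s t : span X Y) : Prop :=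
  exists2 f : ghom (sapex s) (sapex t), bijective f &
    (forall x, sleft t (f x) = sleft s x) /\ (forall x, sright t (f x) = sright s x).

Definition sid X : span X X := Span (gid X) (gid X).

Definition scomp X Y Z (t : span Y Z) (s : span X Y) : span X Z :=
  Span (gcomp (sleft s) (gpull1 (sright s) (sleft t)))
       (gcomp (sright t) (gpull2 (sright s) (sleft t))).

Definition sadd X Y (s t : span X Y) : span X Y :=
  Span (gcopair (sleft s) (sleft t)) (gcopair (sright s) (sright t)).

Definition szero X Y : span X Y := Span (gof_empty X) (gof_empty Y).

Definition sprod X X' Y Y' (s : span X X') (t : span Y Y') :
    span (gprod X Y) (gprod X' Y') :=
  Span (gprodmap (sleft s) (sleft t)) (gprodmap (sright s) (sright t)).

(* The covariant and contravariant images of a map in spans *)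
Definition tr_span X Y (f : ghom X Y) : span X Y := Span (gid X) f.
Definition res_span X Y (f : ghom X Y) : span Y X := Span f (gid X).

Lemma span_iso_refl X Y (s : span X Y) : span_iso s s.
Proof. by exists (gid _) => //; exists id. Qed.

Lemma ghom_inv X Y (f : ghom X Y) : bijective f ->
  exists h : ghom Y X, cancel f h /\ cancel h f.
Proof.
case=> h fK hK.
have hE g y : h (gact g y) = gact g (h y) by apply: (can_inj fK); rewrite gfunE !hK.
by exists (GHom hE).
Qed.

Lemma span_iso_sym X Y (s t : span X Y) : span_iso s t -> span_iso t s.
Proof.
case=> f bf [l r]; have [h [fK hK]] := ghom_inv bf.
by exists h; [exists f | split=> x; rewrite -?l -?r hK].
Qed.

Lemma span_iso_trans X Y (s t u : span X Y) :
  span_iso s t -> span_iso t u -> span_iso s u.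
Proof.
case=> f bf [l r] [f' bf' [l' r']]; exists (gcomp f' f); first exact: bij_comp.
by split=> x /=; rewrite ?l' ?r' ?l ?r.
Qed.

Lemma sadd_iso X Y (s s' t t' : span X Y) :
  span_iso s s' -> span_iso t t' -> span_iso (sadd s t) (sadd s' t').
Proof.
case=> f [f' fK fK'] [l r] [h [h' hK hK'] [l' r']].
exists (gcopair (gcomp (ginl _ _) f) (gcomp (ginr _ _) h)).
  exists (fun z => match z with inl x => inl (f' x) | inr y => inr (h' y) end).
    by case=> x /=; rewrite ?fK ?hK.
  by case=> x /=; rewrite ?fK' ?hK'.
by split; case=> x /=; rewrite ?l ?r ?l' ?r'.
Qed.

Lemma saddC X Y (s t : span X Y) : span_iso (sadd s t) (sadd t s).
Proof.
exists (gcopair (ginr (sapex t) (sapex s)) (ginl (sapex t) (sapex s))); last by split; case.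
by exists (fun z => match z with inl x => inr x | inr y => inl y end); case.
Qed.

Lemma saddA X Y (s t u : span X Y) :
  span_iso (sadd s (sadd t u)) (sadd (sadd s t) u).
Proof.
exists (gcopair (gcomp (ginl _ _) (ginl _ _))
  (gcopair (gcomp (ginl _ _) (ginr _ _)) (ginr (gsum (sapex s) (sapex t)) (sapex u)))).
  exists (fun z => match z with
    | inl (inl x) => inl x | inl (inr y) => inr (inl y) | inr w => inr (inr w) end).
    by case=> [|[]].
  by case=> [[]|].
by split=> [] [|[]].
Qed.

Lemma sadd0 X Y (s : span X Y) : span_iso (sadd s (szero X Y)) s.
Proof.
exists (gcopair (gid _) (gof_empty _)); first by exists inl => // [] [|[]].
by split=> [] [|[]].
Qed.

Lemma scomp_iso X Y Z (t t' : span Y Z) (s s' : span X Y) :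
  span_iso t t' -> span_iso s s' -> span_iso (scomp t s) (scomp t' s').
Proof.
case=> h bh [l' r'] [f bf [l r]].
have H (z : sapex (scomp t s)) :
    sright s' (gprodmap f h (val z)).1 == sleft t' (gprodmap f h (val z)).2.
  by rewrite /= r l' (eqP (valP z)).
pose k (z : sapex (scomp t s)) : sapex (scomp t' s') :=
  exist _ (gprodmap f h (val z)) (H z).
have HE g z : k (gact g z) = gact g (k z).
  by apply: val_inj => /=; rewrite !gfunE.
exists (GHom HE); last by split=> x /=; rewrite ?l ?r'.
have [f' fK f'K] := bf; have [h' hK h'K] := bh.
apply: inj_surj_bij => [[[a1 b1] H1] [[a2 b2] H2] /(congr1 val) /= [e1 e2]|[[a b] /= ab]].
  by apply: val_inj; rewrite /= (can_inj fK e1) (can_inj hK e2).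
have Hab : sright s (f' a) == sleft t (h' b) by rewrite -r -l' f'K h'K.
by exists (exist _ (f' a, h' b) Hab); apply: val_inj; rewrite /= f'K h'K.
Qed.

Lemma scomp_id_l X Y (s : span X Y) : span_iso (scomp (sid Y) s) s.
Proof.
exists (gpull1 _ _); last by split=> // -[[x y] /= /eqP].
apply: inj_surj_bij => [[[x y] /= e] [[x' y'] /= e']|x] /=.
  by move=> xx'; subst x'; apply: val_inj => /=; rewrite -(eqP e) -(eqP e').
by exists (exist _ (x, sright s x) (eqxx _)).
Qed.

Lemma scomp_id_r X Y (s : span X Y) : span_iso (scomp s (sid X)) s.
Proof.
exists (gpull2 _ _); last by split=> // -[[x y] /= /eqP].
apply: inj_surj_bij => [[[x y] /= e] [[x' y'] /= e']|x] /=.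
  by move=> xx'; subst y'; apply: val_inj => /=; rewrite (eqP e) (eqP e').
by exists (exist _ (sleft s x, x) (eqxx _)).
Qed.

Lemma scompA X Y Z W (u : span Z W) (t : span Y Z) (s : span X Y) :
  span_iso (scomp u (scomp t s)) (scomp (scomp u t) s).
Proof.
pose A := sapex (scomp u (scomp t s)); pose B := sapex (scomp (scomp u t) s).
have H1 (z : A) : sright t (val (val z).1).2 == sleft u (val z).2 by exact: (valP z).
pose b1 (z : A) : sapex (scomp u t) := exist _ ((val (val z).1).2, (val z).2) (H1 z).
have H2 (z : A) : sright s (val (val z).1).1 == sleft (scomp u t) (b1 z).
  exact: (valP (val z).1).
pose f (z : A) : B := exist _ ((val (val z).1).1, b1 z) (H2 z).
have fE g (z : A) : f (gact g z) = gact g (f z).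
  by apply: val_inj; congr pair; apply: val_inj.
exists (GHom fE); last by [].
apply: inj_surj_bij => [[[[[a b] /= ab] c] /= abc] [[[[a' b'] /= ab'] c'] /= abc']|].
  move/(congr1 val) => /= [aa' bb' cc']; subst a' b' c'.
  by apply: val_inj => /=; congr pair; apply: val_inj.
move=> [[a [[b c] /= bc]] /= abc].
by exists (exist _ (exist _ (a, b) abc : sapex (scomp t s), c) bc);
  apply: val_inj; congr pair; apply: val_inj.
Qed.

Lemma scomp_addl X Y Z (t t' : span Y Z) (s : span X Y) :
  span_iso (scomp (sadd t t') s) (sadd (scomp t s) (scomp t' s)).
Proof.
apply: span_iso_sym.
pose A := sapex (sadd (scomp t s) (scomp t' s)).
pose B := sapex (scomp (sadd t t') s).
pose f (z : A) : B := match z with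
  | inl w => exist _ ((val w).1, inl (val w).2) (valP w)
  | inr w => exist _ ((val w).1, inr (val w).2) (valP w) end.
have fE g (z : A) : f (gact g z) = gact g (f z) by case: z => z; apply: val_inj.
exists (GHom fE); last by split; case.
apply: inj_surj_bij => [|[[a [b|b]] ab]].
- by move=> [[[a b] ab]|[[a b] ab]] [[[a' b'] ab']|[[a' b'] ab']] /(congr1 val) //=
    [aa' bb']; congr (_ _); apply: val_inj; rewrite /= aa' bb'.
- by exists (inl (exist _ (a, b) ab)); apply: val_inj.
- by exists (inr (exist _ (a, b) ab)); apply: val_inj.
Qed.

Lemma scomp_addr X Y Z (t : span Y Z) (s s' : span X Y) :
  span_iso (scomp t (sadd s s')) (sadd (scomp t s) (scomp t s')).
Proof.
apply: span_iso_sym.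
pose A := sapex (sadd (scomp t s) (scomp t s')).
pose B := sapex (scomp t (sadd s s')).
pose f (z : A) : B := match z with
  | inl w => exist _ (inl (val w).1, (val w).2) (valP w)
  | inr w => exist _ (inr (val w).1, (val w).2) (valP w) end.
have fE g (z : A) : f (gact g z) = gact g (f z) by case: z => z; apply: val_inj.
exists (GHom fE); last by split; case.
apply: inj_surj_bij => [|[[[a|a] b] ab]].
- by move=> [[[a b] ab]|[[a b] ab]] [[[a' b'] ab']|[[a' b'] ab']] /(congr1 val) //=
    [aa' bb']; congr (_ _); apply: val_inj; rewrite /= aa' bb'.
- by exists (inl (exist _ (a, b) ab)); apply: val_inj.
- by exists (inr (exist _ (a, b) ab)); apply: val_inj.
Qed.

Lemma span_iso_empty X Y (s t : span X Y) :
  (sapex s -> False) -> (sapex t -> False) -> span_iso s t.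
Proof.
move=> s0 t0; have fE g (x : sapex s) : (False_rect _ (s0 (gact g x)) : sapex t) =
    gact g (False_rect _ (s0 x)) by case: (s0 x).
exists (GHom fE); last by split=> x; case: (s0 x).
by exists (fun x => False_rect _ (t0 x)) => x; [case: (s0 x) | case: (t0 x)].
Qed.

Lemma scomp0 X Y Z (t : span Y Z) : span_iso (scomp t (szero X Y)) (szero X Z).
Proof. by apply: span_iso_empty => [[[[]]]|[]]. Qed.

Lemma scomp0l X Y Z (s : span X Y) : span_iso (scomp (szero Y Z) s) (szero X Z).
Proof. by apply: span_iso_empty => [[[? []]]|[]]. Qed.

Lemma scomp_res X Y Z (f : ghom X Y) (h : ghom Y Z) :
  span_iso (scomp (res_span f) (res_span h)) (res_span (gcomp h f)).
Proof.
exists (gpull2 _ _); last by split=> // -[[y x] /= /eqP ->].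
apply: inj_surj_bij => [[[y x] /= e] [[y' x'] /= e']|x] /=.
  by move=> xx'; subst x'; apply: val_inj => /=; rewrite (eqP e) (eqP e').
by exists (exist _ (f x, x) (eqxx _)).
Qed.

Lemma span_ext X Y A (l l' : ghom A X) (r r' : ghom A Y) :
  l =1 l' -> r =1 r' -> span_iso (Span l r) (Span l' r').
Proof. by move=> e e'; exists (gid A); [exists id | split=> x /=]. Qed.

Lemma scomp_tr X Y Z (f : ghom Y Z) (s : span X Y) :
  span_iso (scomp (tr_span f) s) (Span (sleft s) (gcomp f (sright s))).
Proof.
exists (gpull1 _ _); last by split=> // -[[x y] /= /eqP ->].
apply: inj_surj_bij => [[[x y] /= e] [[x' y'] /= e']|x] /=.
  by move=> xx'; subst x'; apply: val_inj => /=; rewrite -(eqP e) -(eqP e').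
by exists (exist _ (x, sright s x) (eqxx _)).
Qed.

Lemma scomp_resr X Y Z (f : ghom Y X) (s : span Y Z) :
  span_iso (scomp s (res_span f)) (Span (gcomp f (sleft s)) (sright s)).
Proof.
exists (gpull2 _ _); last by split=> // -[[x y] /= /eqP ->].
apply: inj_surj_bij => [[[x y] /= e] [[x' y'] /= e']|x] /=.
  by move=> xx'; subst y'; apply: val_inj => /=; rewrite (eqP e) (eqP e').
by exists (exist _ (sleft s x, x) (eqxx _)).
Qed.

(* s + t factors as the fold map of Y after [sfork s t] : X -> Y + Y *)
Definition sfork X Y (s t : span X Y) : span X (gsum Y Y) :=
  Span (gcopair (sleft s) (sleft t))
    (gcopair (gcomp (ginl Y Y) (sright s)) (gcomp (ginr Y Y) (sright t))).

Lemma sfork_fold X Y (s t : span X Y) :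
  span_iso (scomp (tr_span (gfold Y)) (sfork s t)) (sadd s t).
Proof. by apply: span_iso_trans (scomp_tr _ _) _; apply: span_ext => // -[]. Qed.

Lemma sfork_l X Y (s t : span X Y) :
  span_iso (scomp (res_span (ginl Y Y)) (sfork s t)) s.
Proof.
apply: span_iso_sym; pose B := sapex (scomp (res_span (ginl Y Y)) (sfork s t)).
pose f (a : sapex s) : B := exist _ (inl a, sright s a) (eqxx _).
have fE g a : f (gact g a) = gact g (f a).
  by apply: val_inj; congr pair; rewrite /= gfunE.
exists (GHom fE); last by [].
apply: inj_surj_bij => [a a' /(congr1 val) /= [] //|[[[a|a] b] //= e]].
exists a; apply: val_inj => /=; congr pair.
by move/eqP: e => [].
Qed.

Lemma sfork_r X Y (s t : span X Y) :
  span_iso (scomp (res_span (ginr Y Y)) (sfork s t)) t.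
Proof.
apply: span_iso_sym; pose B := sapex (scomp (res_span (ginr Y Y)) (sfork s t)).
pose f (a : sapex t) : B := exist _ (inr a, sright t a) (eqxx _).
have fE g a : f (gact g a) = gact g (f a).
  by apply: val_inj; congr pair; rewrite /= gfunE.
exists (GHom fE); last by [].
apply: inj_surj_bij => [a a' /(congr1 val) /= [] //|[[[a|a] b] //= e]].
exists a; apply: val_inj => /=; congr pair.
by move/eqP: e => [].
Qed.

Lemma scomp_fold X Y (s : span X Y) :
  span_iso (scomp s (tr_span (gfold X)))
    (sadd (scomp s (res_span (ginl X X))) (scomp s (res_span (ginr X X)))).
Proof.
apply: span_iso_trans (span_iso_sym (sadd_iso (scomp_resr _ _) (scomp_resr _ _))).
apply: span_iso_sym; pose B := sapex (scomp s (tr_span (gfold X))).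
pose f (z : gsum (sapex s) (sapex s)) : B := match z with
  | inl a => exist _ (inl (sleft s a), a) (eqxx _)
  | inr a => exist _ (inr (sleft s a), a) (eqxx _) end.
have fE g z : f (gact g z) = gact g (f z).
  by case: z => a; apply: val_inj; congr pair; rewrite /= gfunE.
exists (GHom fE); last by split=> -[].
apply: inj_surj_bij => [[a|a] [b|b] /(congr1 val) /= [] // _ ->//|[[[x|x] b] //= e]].
  by exists (inl b); apply: val_inj; rewrite /= (eqP e).
by exists (inr b); apply: val_inj; rewrite /= (eqP e).
Qed.

End Spans.

(* Formal differences s - t of spans; up to [veq] they are the elements of the
   group completion of the monoid of isomorphism classes of spans under disjoint
   union, i.e. the morphisms X -> Y of the Burnside category. *)
Definition vspan (G : finGroupType) (X Y : gset G) : Type := (span X Y * span X Y)%type.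

Section VSpans.
Variable G : finGroupType.
Implicit Types X Y Z : gset G.

Definition veq X Y (v w : vspan X Y) : Prop :=
  exists u : span X Y,
    span_iso (sadd (sadd v.1 w.2) u) (sadd (sadd w.1 v.2) u).

Definition vadd X Y (v w : vspan X Y) : vspan X Y :=
  (sadd v.1 w.1, sadd v.2 w.2).

(* The bilinear extension of the composition of spans *)
Definition vcomp X Y Z (w : vspan Y Z) (v : vspan X Y) : vspan X Z :=
  (sadd (scomp w.1 v.1) (scomp w.2 v.2), sadd (scomp w.1 v.2) (scomp w.2 v.1)).

Definition vof X Y (s : span X Y) : vspan X Y := (s, szero X Y).

Definition vid X : vspan X X := vof (sid X).

End VSpans.

(* Additive functors from the Burnside category to abelian groups *)
Record mackey (G : finGroupType) := Mackey {
  mobj :> gset G -> zmodType;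
  mmap : forall X Y : gset G, vspan X Y -> mobj X -> mobj Y;
  mmapD : forall X Y (v : vspan X Y), {morph mmap v : x y / x + y};
  mmap_veq : forall X Y (v w : vspan X Y), veq v w -> mmap v =1 mmap w;
  mmap_add : forall X Y (v w : vspan X Y) x,
    mmap (vadd v w) x = mmap v x + mmap w x;
  mmap_id : forall X x, mmap (vid X) x = x;
  mmap_comp : forall X Y Z (w : vspan Y Z) (v : vspan X Y) x,
    mmap (vcomp w v) x = mmap w (mmap v x) }.

Section MackeyBuilder.
Variables (G : finGroupType) (O : gset G -> zmodType).
Variable F : forall X Y : gset G, span X Y -> O X -> O Y.
Hypothesis FD : forall X Y (s : span X Y), {morph F s : x y / x + y}.
Hypothesis F_iso : forall X Y (s t : span X Y), span_iso s t -> F s =1 F t.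
Hypothesis F_add : forall X Y (s t : span X Y) x, F (sadd s t) x = F s x + F t x.
Hypothesis F_id : forall X x, F (sid X) x = x.
Hypothesis F_comp : forall X Y Z (t : span Y Z) (s : span X Y) x,
  F (scomp t s) x = F t (F s x).

Definition Fv X Y (v : vspan X Y) (x : O X) : O Y := F v.1 x - F v.2 x.

Lemma Fv_szero X Y x : F (szero X Y) x = 0.
Proof.
have := F_add (szero X Y) (szero X Y) x; rewrite (F_iso (sadd0 _)) => /eqP.
by rewrite -subr_eq subrr eq_sym => /eqP.
Qed.

Lemma FN X Y (s : span X Y) x : F s (- x) = - F s x.
Proof.
have F0 : F s 0 = 0.
  by have /eqP := FD s 0 0; rewrite addr0 -subr_eq subrr eq_sym => /eqP.
by apply/eqP; rewrite -addr_eq0 -FD addNr F0.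
Qed.

Lemma Fv_D X Y (v : vspan X Y) : {morph Fv v : x y / x + y}.
Proof. by move=> x y; rewrite /Fv !FD opprD addrACA. Qed.

Lemma Fv_veq X Y (v w : vspan X Y) : veq v w -> Fv v =1 Fv w.
Proof.
case=> u /F_iso e x; have := e x; rewrite !F_add => /addIr h.
by rewrite /Fv; apply/eqP; rewrite subr_eq addrAC eq_sym subr_eq h.
Qed.

Lemma Fv_add X Y (v w : vspan X Y) x : Fv (vadd v w) x = Fv v x + Fv w x.
Proof. by rewrite /Fv /= !F_add opprD addrACA. Qed.

Lemma Fv_id X x : Fv (vid X) x = x.
Proof. by rewrite /Fv /= F_id Fv_szero subr0. Qed.

Lemma Fv_comp X Y Z (w : vspan Y Z) (v : vspan X Y) x :
  Fv (vcomp w v) x = Fv w (Fv v x).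
Proof.
rewrite /Fv /= !F_add !F_comp !FD !FN !opprD !opprK -!addrA; congr (_ + _).
by rewrite addrCA; congr (_ + _); rewrite addrC.
Qed.

Definition mackey_of_spans : mackey G :=
  @Mackey G O Fv Fv_D Fv_veq Fv_add Fv_id Fv_comp.

Lemma mackey_of_spansE X Y (s : span X Y) x : mmap (m := mackey_of_spans) (vof s) x = F s x.
Proof. by rewrite /= /Fv /= Fv_szero subr0. Qed.

End MackeyBuilder.

Section MackeyHoms.
Variable G : finGroupType.
Implicit Types M N : mackey G.

Lemma mmap_iso M X Y (s t : span X Y) :
  span_iso s t -> mmap (m := M) (vof s) =1 mmap (vof t).
Proof.
move=> st; apply: mmap_veq; exists (szero X Y).
by apply: sadd_iso (span_iso_refl _); apply: sadd_iso (span_iso_refl _).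
Qed.

Lemma mmap_scomp M X Y Z (t : span Y Z) (s : span X Y) x :
  mmap (m := M) (vof (scomp t s)) x = mmap (vof t) (mmap (vof s) x).
Proof.
rewrite -mmap_comp; apply: mmap_veq; exists (szero X Z); apply: sadd_iso (span_iso_refl _).
rewrite /=; apply: sadd_iso.
  apply: span_iso_trans (span_iso_sym (sadd0 _)) _.
  by apply: sadd_iso (span_iso_refl _) _; apply: span_iso_sym; apply: scomp0.
apply: span_iso_trans (sadd_iso (scomp0 _ _) (scomp0l _ _)) _; exact: sadd0.
Qed.

Lemma mmap_sid M X x : mmap (m := M) (vof (sid X)) x = x.
Proof. exact: mmap_id. Qed.

Definition mres M X Y (f : ghom X Y) : M Y -> M X := mmap (vof (res_span f)).
Definition mtr M X Y (f : ghom X Y) : M X -> M Y := mmap (vof (tr_span f)).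

Definition is_mackey_hom M N (f : forall X, M X -> N X) : Prop :=
  (forall X, {morph f X : x y / x + y}) /\
  (forall X Y (v : vspan X Y) x, f Y (mmap v x) = mmap v (f X x)).

Definition mackey_iso M N : Prop :=
  exists (f : forall X, M X -> N X) (h : forall X, N X -> M X),
    [/\ is_mackey_hom f, is_mackey_hom h,
        forall X, cancel (@f X) (@h X) & forall X, cancel (@h X) (@f X)].

End MackeyHoms.

Record gmodule (G : finGroupType) := GModule {
  vcar :> zmodType;
  vact : G -> vcar -> vcar;
  vactD : forall g, {morph vact g : x y / x + y};
  vact1 : forall x, vact 1%g x = x;
  vactM : forall g h x, vact (g * h)%g x = vact g (vact h x) }.

Section FixedPoints.
Variables (G : finGroupType) (V : gmodule G).
Implicit Types X Y Z : gset G.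

Lemma vact0 g : vact g (0 : V) = 0.
Proof. by have /eqP := vactD g (0 : V) 0; rewrite addr0 -subr_eq subrr eq_sym => /eqP. Qed.

Lemma vactN g (x : V) : vact g (- x) = - vact g x.
Proof. by apply/eqP; rewrite -addr_eq0 -vactD addNr vact0. Qed.

Lemma vact_sum g I r (P : pred I) (F : I -> V) :
  vact g (\sum_(i <- r | P i) F i) = \sum_(i <- r | P i) vact g (F i).
Proof. by apply: (big_morph (vact g)); [exact: vactD | exact: vact0]. Qed.

(* FP(V)(X) is the group of equivariant functions X -> V; evaluation at the
   coset H identifies its value at G/H with the group of H-fixed points.  Under
   this identification restriction (precomposition) along G/K -> G/H is the
   inclusion of fixed points and transfer (the sum over the fibres) is
   v |-> \sum_(hK in H/K) h v. *)
Definition equivariant X : {pred {ffun X -> V}} :=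
  [pred f : {ffun X -> V} | [forall g, forall x, f (gact g x) == vact g (f x)]].

Lemma equivariantP X (f : {ffun X -> V}) :
  reflect (forall g x, f (gact g x) = vact g (f x)) (f \in @equivariant X).
Proof.
apply: (iffP forallP) => [h g x|h g]; first by have /forallP/(_ x)/eqP := h g.
by apply/forallP => x; rewrite h.
Qed.

Lemma equivariant_zmod X : zmod_closed (@equivariant X).
Proof.
split=> [|f h /equivariantP ef /equivariantP eh]; apply/equivariantP => g x.
  by rewrite !ffunE vact0.
by rewrite !ffunE ef eh vactD vactN.
Qed.
HB.instance Definition _ X :=
  GRing.isZmodClosed.Build {ffun X -> V} (@equivariant X) (@equivariant_zmod X).

Record fp_type X := FPType { fpval :> {ffun X -> V}; fpvalP : fpval \in @equivariant X }.

HB.instance Definition _ X := [isSub for @fpval X].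
HB.instance Definition _ X := [Choice of fp_type X by <:].
HB.instance Definition _ X := [SubChoice_isSubZmodule of fp_type X by <:].

Lemma fpE X (f : fp_type X) g x : f (gact g x) = vact g (f x).
Proof. exact: (equivariantP _ (fpvalP f)). Qed.

Lemma fp_span_subproof X Y (s : span X Y) (f : fp_type X) :
  [ffun y => \sum_(a | sright s a == y) f (sleft s a)] \in @equivariant Y.
Proof.
apply/equivariantP => g y; rewrite !ffunE vact_sum (reindex_inj (@gact_inj _ _ g)) /=.
apply: eq_big => [a|a _]; first by rewrite gfunE (inj_eq (@gact_inj _ _ g)).
by rewrite gfunE fpE.
Qed.
Definition fp_span X Y (s : span X Y) (f : fp_type X) : fp_type Y :=
  FPType (fp_span_subproof s f).

Lemma fp_spanD X Y (s : span X Y) : {morph fp_span s : x y / x + y}.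
Proof.
move=> f h; apply: val_inj; apply/ffunP => y; rewrite !ffunE -big_split.
by apply: eq_bigr => a _; rewrite ffunE.
Qed.

Lemma fp_span_iso X Y (s t : span X Y) : span_iso s t -> fp_span s =1 fp_span t.
Proof.
case=> k [k' kK k'K] [l r] f; apply: val_inj; apply/ffunP => y; rewrite !ffunE.
rewrite [RHS](reindex k) /=; last by exists k' => ? _.
by apply: eq_big => [a|a _]; rewrite ?r ?l.
Qed.

Lemma fp_span_add X Y (s t : span X Y) x :
  fp_span (sadd s t) x = fp_span s x + fp_span t x.
Proof.
apply: val_inj; apply/ffunP => y; rewrite !ffunE /=.
by rewrite big_sumType.
Qed.

Lemma fp_span_id X x : fp_span (sid X) x = x.
Proof. by apply: val_inj; apply/ffunP => y; rewrite !ffunE big_pred1_eq. Qed.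

Lemma fp_span_comp X Y Z (t : span Y Z) (s : span X Y) x :
  fp_span (scomp t s) x = fp_span t (fp_span s x).
Proof.
apply: val_inj; apply/ffunP => z; rewrite !ffunE /=.
under [RHS]eq_bigr => b _ do rewrite ffunE.
rewrite (exchange_big_dep predT) //= pair_big_dep /=.
pose P := fun p : gprod (sapex s) (sapex t) => sright s p.1 == sleft t p.2.
rewrite [LHS](eq_bigl (fun w => sright t (val w).2 == z)) //.
rewrite (eq_bigl (fun p : gprod (sapex s) (sapex t) => P p && (sright t p.2 == z))); last first.
  by move=> [a b]; rewrite /P /= andbC.
by rewrite -(big_sig _ P (fun p => sright t p.2 == z) (fun p => x (sleft s p.1))).
Qed.

Definition fp_mackey : mackey G :=
  mackey_of_spans fp_spanD fp_span_iso fp_span_add fp_span_id fp_span_comp.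

End FixedPoints.


Section Weyl.
Variables (G : finGroupType) (M : mackey G).

Definition weyl_act (g : G) : M (gfree G) -> M (gfree G) := mres (gfree_rmul g).

Lemma weyl_actD g : {morph weyl_act g : x y / x + y}.
Proof. exact: mmapD. Qed.

Lemma weyl_act1 x : weyl_act 1%g x = x.
Proof.
rewrite -[RHS]mmap_sid; apply: mmap_iso; apply: span_ext => // y.
exact: mulg1.
Qed.

Lemma weyl_actM g h x : weyl_act (g * h)%g x = weyl_act g (weyl_act h x).
Proof.
rewrite /weyl_act /mres -mmap_scomp; apply: mmap_iso.
apply: span_iso_trans (span_iso_sym (scomp_res _ _)); apply: span_ext => // y.
exact: mulgA.
Qed.

(* M(G/e) with G acting through the automorphisms x |-> x g of G/e *)
Definition weyl : gmodule G := GModule weyl_actD weyl_act1 weyl_actM.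

End Weyl.

(* X <- A -> B -> Y *)
Record bispan (G : finGroupType) (X Y : gset G) := Bispan {
  bsrc : gset G;
  btgt : gset G;
  bres : ghom bsrc X;
  bnorm : ghom bsrc btgt;
  btr : ghom btgt Y }.

Section Bispans.
Variable G : finGroupType.
Implicit Types X Y Z : gset G.

Definition bispan_iso X Y (p q : bispan X Y) : Prop :=
  exists (f : ghom (bsrc p) (bsrc q)) (h : ghom (btgt p) (btgt q)),
    [/\ bijective f, bijective h,
        forall a, bres q (f a) = bres p a,
        forall a, bnorm q (f a) = h (bnorm p a)
      & forall b, btr q (h b) = btr p b].

Definition bid X : bispan X X := Bispan (gid X) (gid X) (gid X).

Definition bres_map X Y (f : ghom X Y) : bispan Y X := Bispan f (gid X) (gid X).
Definition bnorm_map X Y (f : ghom X Y) : bispan X Y := Bispan (gid X) f (gid Y).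
Definition btr_map X Y (f : ghom X Y) : bispan X Y := Bispan (gid X) (gid X) f.
Definition bof_span X Y (s : span X Y) : bispan X Y :=
  Bispan (sleft s) (gid (sapex s)) (sright s).

Section Composition.
Variables (X Y Z : gset G) (q : bispan Y Z) (p : bispan X Y).

(* For p = (X <- A -> B -> Y) and q = (Y <- C -> D -> Z), the composite q o p
   is X <- A' -> D' -> Z where D' consists of the pairs of a point d of D and
   a section s, over the fibre of C -> D at d, of the pullback of B -> Y along
   C -> Y, and A' is the pullback of A -> B along the evaluation
   (d, s, c) |-> s c.  The section s is a partial function from C to B defined
   exactly on the fibre at d. *)
Definition bsection : pred (gprod (btgt q) (gpfun (bsrc q) (btgt p))) :=
  fun z => z.2 \in pfamily None [pred c | bnorm q c == z.1]
    (fun c => [pred o | if o is Some b then btr p b == bres q c else false]).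

Lemma bsection_act g z : bsection z -> bsection (gact g z).
Proof.
case: z => d s /pfamilyP [/= /subsetP sd sb]; apply/pfamilyP; split=> [|c].
  apply/subsetP => c; rewrite !inE /= ffunE => h.
  have /sd : gact g^-1%g c \in [pred c | s c != None].
    by rewrite inE; apply: contra h => /eqP ->.
  by rewrite inE gfunE => /eqP <-; rewrite gactVK.
rewrite inE => /eqP e; have /sb : gact g^-1%g c \in [pred c | bnorm q c == d].
  by rewrite inE gfunE e gactK.
by rewrite !inE ffunE; case: (s _) => //= b /eqP h; rewrite gfunE h gfunE gactVK.
Qed.

Definition bcomp_tgt : gset G := gsub bsection_act.

Definition beval : pred (gprod bcomp_tgt (gprod (bsrc q) (bsrc p))) :=
  fun z => (val z.1).2 z.2.1 == Some (bnorm p z.2.2).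

Lemma beval_act g z : beval z -> beval (gact g z).
Proof.
by case: z => [[[d s] ds] [c a]] /eqP /= e; rewrite /beval /= ffunE gactK e /= gfunE.
Qed.

Definition bcomp_src : gset G := gsub beval_act.

Definition bcomp : bispan X Z :=
  @Bispan G X Z bcomp_src bcomp_tgt
    (gcomp (bres p) (gcomp (gsnd _ _) (gcomp (gsnd _ _) (gval beval_act))))
    (gcomp (gfst _ _) (gval beval_act))
    (gcomp (btr q) (gcomp (gfst _ _) (gval bsection_act))).

End Composition.

Lemma bispan_iso_refl X Y (p : bispan X Y) : bispan_iso p p.
Proof. by exists (gid _), (gid _); split=> //; exists id. Qed.

Lemma bof_span_iso X Y (s t : span X Y) :
  span_iso s t -> bispan_iso (bof_span s) (bof_span t).
Proof. by case=> f bf [l r]; exists f, f; split. Qed.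

Lemma bof_span_comp X Y Z (t : span Y Z) (s : span X Y) :
  bispan_iso (bof_span (scomp t s)) (bcomp (bof_span t) (bof_span s)).
Proof.
pose P := sapex (scomp t s).
pose sec (w : P) : gpfun (sapex t) (sapex s) :=
  [ffun c => if c == (val w).2 then Some (val w).1 else None].
have sdP (w : P) : bsection (q := bof_span t) (p := bof_span s) ((val w).2, sec w).
  apply/pfamilyP; split=> [|c].
    by apply/subsetP => c; rewrite !inE /= ffunE; case: ifP.
  by rewrite !inE ffunE /= => /eqP ->; rewrite eqxx (valP w).
pose h (w : P) : bcomp_tgt (bof_span t) (bof_span s) := exist _ ((val w).2, sec w) (sdP w).
have evP (w : P) : beval (q := bof_span t) (p := bof_span s) (h w, ((val w).2, (val w).1)).
  by rewrite /beval /= ffunE eqxx.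
pose f (w : P) : bcomp_src (bof_span t) (bof_span s) := exist _ (h w, ((val w).2, (val w).1)) (evP w).
have hE g (w : P) : h (gact g w) = gact g (h w).
  apply: val_inj; congr pair; apply/ffunP => c; rewrite !ffunE /=.
  rewrite -(inj_eq (@gact_inj _ _ g^-1%g)) gactK.
  by case: eqP.
have fE g (w : P) : f (gact g w) = gact g (f w).
  by apply: val_inj; congr pair; exact: hE.
have hinj : injective h.
  move=> w w' /(congr1 val) /= [e2 /ffunP /(_ (val w).2)].
  rewrite !ffunE eqxx -e2 eqxx => -[e1]; apply: val_inj.
  by case: w w' e1 e2 => [[? ?] ?] [[? ?] ?] /= -> ->.
have secE (z : bcomp_tgt (bof_span t) (bof_span s)) c b : (val z).2 c = Some b ->
    exists w : P, val w = (b, c) /\ h w = z.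
  case: z => [[d s0] ds] /= e.
  have [/subsetP s1 s2] := pfamilyP ds.
  have cd : c = d.
    by apply/eqP; have := s1 c; rewrite !inE /= e; apply.
  have H : sright s b == sleft t c.
    by have := s2 c; rewrite !inE /= cd eqxx -cd e; apply.
  exists (exist _ (b, c) H); split=> //; apply: val_inj; congr pair; first exact: cd.
  apply/ffunP => c'; rewrite ffunE /=; case: eqP => [->|/eqP c'd]; first exact: esym e.
  apply/esym/eqP; rewrite -[_ == _]negbK; apply/negP => h0.
  by have := s1 c'; rewrite !inE => /(_ h0); rewrite /= -cd; exact/negP.
exists (GHom fE), (GHom hE); split=> //=.
  apply: inj_surj_bij => [w w' e|[[z [c a]] /= e]].
    by apply: hinj; have := congr1 val e => /(congr1 fst).
  have [w [e1 e2]] := secE _ _ _ (eqP e).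
  by exists w; apply: val_inj; rewrite /= e1 e2.
apply: inj_surj_bij => [//|z].
have [_ s2] := pfamilyP (valP z).
have := s2 (val z).1; rewrite !inE /= eqxx => /(_ isT).
case e : ((val z).2 _) => [b|] // _.
by have [w [_ e2]] := secE _ _ _ e; exists w.
Qed.

End Bispans.

(* A product-preserving functor from the category of polynomials to sets, all of
   whose values are abelian groups.  A morphism of polynomials is a diagram up to
   isomorphism, so a function on morphisms is an isomorphism-invariant function
   on diagrams.  The product of X and Y in the category of polynomials is their
   disjoint union, with the restrictions along the two summands as projections,
   and [gempty] is its terminal object.  The group law on each value is the one
   induced by the transfer along the fold map. *)
Record tambara (G : finGroupType) := Tambara {
  tobj :> gset G -> zmodType;
  tmap : forall X Y : gset G, bispan X Y -> tobj X -> tobj Y;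
  tmap_iso : forall X Y (p q : bispan X Y), bispan_iso p q -> tmap p =1 tmap q;
  tmap_id : forall X x, tmap (bid X) x = x;
  tmap_comp : forall X Y Z (q : bispan Y Z) (p : bispan X Y) x,
    tmap (bcomp q p) x = tmap q (tmap p x);
  tmap_empty : forall x : tobj (gempty G), x = 0;
  tmap_prod : forall X Y (x : tobj X) (y : tobj Y), exists! z : tobj (gsum X Y),
    tmap (bres_map (ginl X Y)) z = x /\ tmap (bres_map (ginr X Y)) z = y;
  tmap_add : forall X (z : tobj (gsum X X)),
    tmap (btr_map (gfold X)) z =
    tmap (bres_map (ginl X X)) z + tmap (bres_map (ginr X X)) z }.

Section UnderlyingMackey.
Variables (G : finGroupType) (R : tambara G).
Implicit Types X Y Z : gset G.

Definition smap X Y (s : span X Y) : R X -> R Y := tmap (bof_span s).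

Lemma smap_iso X Y (s t : span X Y) : span_iso s t -> smap s =1 smap t.
Proof. by move=> st; apply: tmap_iso; apply: bof_span_iso. Qed.

Lemma smap_comp X Y Z (t : span Y Z) (s : span X Y) x :
  smap (scomp t s) x = smap t (smap s x).
Proof. by rewrite /smap -tmap_comp; apply: tmap_iso; apply: bof_span_comp. Qed.

Lemma smap_id X x : smap (sid X) x = x.
Proof. exact: tmap_id. Qed.

Lemma smap_fold X (z : R (gsum X X)) :
  smap (tr_span (gfold X)) z =
  smap (res_span (ginl X X)) z + smap (res_span (ginr X X)) z.
Proof. exact: tmap_add. Qed.

Lemma smap_add X Y (s t : span X Y) x : smap (sadd s t) x = smap s x + smap t x.
Proof.
rewrite -(smap_iso (sfork_fold s t)) smap_comp smap_fold -!smap_comp.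
by rewrite (smap_iso (sfork_l s t)) (smap_iso (sfork_r s t)).
Qed.

Lemma smapD X Y (s : span X Y) : {morph smap s : x y / x + y}.
Proof.
move=> x y; have [z [[<- <-] _]] := tmap_prod x y.
rewrite -tmap_add -(smap_comp s (tr_span (gfold X))) (smap_iso (scomp_fold s)).
by rewrite smap_add !smap_comp.
Qed.

Definition underlying : mackey G :=
  mackey_of_spans smapD smap_iso smap_add smap_id smap_comp.

End UnderlyingMackey.

Section TambaraHoms.
Variable G : finGroupType.
Implicit Types R S : tambara G.

Definition tpair R X Y (x : R X) (y : R Y) : R (gsum X Y) :=
  sval (cid (tmap_prod x y)).

Definition tmul R X (x y : R X) : R X := tmap (bnorm_map (gfold X)) (tpair x y).

Definition tone R X : R X := tmap (bnorm_map (gof_empty X)) 0.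

Definition tunit R X (x : R X) : Prop := exists y, tmul x y = tone R X.

(* The product of R as a monoid for the box product *)
Definition text R X Y (x : R X) (y : R Y) : R (gprod X Y) :=
  tmul (tmap (bres_map (gfst X Y)) x) (tmap (bres_map (gsnd X Y)) y).

Definition is_tambara_hom R S (f : forall X, R X -> S X) : Prop :=
  forall X Y (p : bispan X Y) x, f Y (tmap p x) = tmap p (f X x).

Definition tambara_iso R S : Prop :=
  exists (f : forall X, R X -> S X) (h : forall X, S X -> R X),
    [/\ is_tambara_hom f, is_tambara_hom h,
        forall X, cancel (@f X) (@h X) & forall X, cancel (@h X) (@f X)].

End TambaraHoms.

Record gring (G : finGroupType) := GRing_ {
  rcar :> comPzRingType;
  ract : G -> rcar -> rcar;
  ractD : forall g, {morph ract g : x y / x + y};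
  ractM : forall g, {morph ract g : x y / x * y};
  ract_one : forall g, ract g 1 = 1;
  ract1 : forall x, ract 1%g x = x;
  ract_mulg : forall g h x, ract (g * h)%g x = ract g (ract h x) }.

Definition gring_module (G : finGroupType) (V : gring G) : gmodule G :=
  GModule (@ractD G V) (@ract1 G V) (@ract_mulg G V).

Definition gring_trivial (G : finGroupType) (V : comPzRingType) : gring G :=
  @GRing_ G V (fun _ x => x) (fun _ _ _ => erefl) (fun _ _ _ => erefl)
    (fun _ => erefl) (fun _ => erefl) (fun _ _ _ => erefl).

Section FixedPointTambara.
Variables (G : finGroupType) (V : gring G).
Implicit Types X Y Z : gset G.
Let W := gring_module V.

Lemma ract_prod g I r (P : pred I) (F : I -> V) :
  ract g (\prod_(i <- r | P i) F i) = \prod_(i <- r | P i) ract g (F i).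
Proof. by apply: (big_morph (ract g)); [exact: ractM | exact: ract_one]. Qed.

(* Restriction, then the product over the fibres (norm), then the sum over the
   fibres (transfer) *)
Definition fpt_fun X Y (p : bispan X Y) (f : X -> V) (y : Y) : V :=
  \sum_(b | btr p b == y) \prod_(a | bnorm p a == b) f (bres p a).

Lemma fpt_subproof X Y (p : bispan X Y) (f : fp_type W X) :
  [ffun y => fpt_fun p f y : W] \in @equivariant G W Y.
Proof.
apply/equivariantP => g y; rewrite !ffunE /fpt_fun vact_sum.
rewrite (reindex_inj (@gact_inj _ _ g)) /=.
apply: eq_big => [b|b _]; first by rewrite gfunE (inj_eq (@gact_inj _ _ g)).
rewrite ract_prod (reindex_inj (@gact_inj _ _ g)) /=.
apply: eq_big => [a|a _]; first by rewrite gfunE (inj_eq (@gact_inj _ _ g)).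
by rewrite gfunE; exact: (fpE f).
Qed.
Definition fpt_map X Y (p : bispan X Y) (f : fp_type W X) : fp_type W Y :=
  FPType (fpt_subproof p f).

Lemma fpt_iso X Y (p q : bispan X Y) : bispan_iso p q -> fpt_map p =1 fpt_map q.
Proof.
case=> k [h [[k' kK k'K] bh e1 e2 e3]] f; apply: val_inj; apply/ffunP => y.
rewrite !ffunE /fpt_fun [RHS](reindex h) /=; last exact: onW_bij.
apply: eq_big => [b|b _]; first by rewrite e3.
rewrite [RHS](reindex k) /=; last by exists k' => ? _.
by apply: eq_big => [a|a _]; rewrite ?e2 ?e1 // (inj_eq (bij_inj bh)).
Qed.

Lemma fpt_id X f : fpt_map (bid X) f = f.
Proof. by apply: val_inj; apply/ffunP => y; rewrite !ffunE /fpt_fun !big_pred1_eq. Qed.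

Lemma fpt_comp X Y Z (q : bispan Y Z) (p : bispan X Y) f :
  fpt_map (bcomp q p) f = fpt_map q (fpt_map p f).
Proof.
apply: val_inj; apply/ffunP => z; rewrite !ffunE /fpt_fun.
transitivity (\sum_(d | btr q d == z)
    \sum_(s in pfamily None [pred c | bnorm q c == d]
       (fun c => [pred o | if o is Some b then btr p b == bres q c else false]))
    \prod_(c | bnorm q c == d) \prod_(a | s c == Some (bnorm p a)) f (bres p a)); last first.
  apply: eq_bigr => d _.
  rewrite -(big_distr_big_dep None (fun c => bnorm q c == d)
     (fun c => [pred o | if o is Some b then btr p b == bres q c else false])
     (fun c o => \prod_(a | o == Some (bnorm p a)) f (bres p a))).
  apply: eq_bigr => c _; rewrite ffunE /fpt_fun.
  rewrite (reindex_omap (@Some (btgt p)) id) => [|[b|]] //=.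
  apply: eq_big => [b|b _]; first by rewrite ?inE /= ?eqxx ?andbT.
  by apply: eq_bigl => a; rewrite /= eq_sym.
rewrite pair_big_dep /=.
pose F (ds : gprod (btgt q) (gpfun (bsrc q) (btgt p))) : V :=
  \prod_(c | bnorm q c == ds.1) \prod_(a | ds.2 c == Some (bnorm p a)) f (bres p a).
transitivity (\sum_(t : bcomp_tgt q p | btr q (val t).1 == z) F (val t)); last first.
  rewrite (big_sig _ (bsection (q := q) (p := p)) (fun ds => btr q ds.1 == z) F).
  by apply: eq_bigl => -[d s]; rewrite andbC.
apply: eq_bigr => t _; rewrite /F.
rewrite (big_sig _ (beval (q := q) (p := p)) (fun w => w.1 == t) (fun w => f (bres p w.2.2))).
transitivity (\prod_(t' | t' == t)
    \prod_(w : gprod (bsrc q) (bsrc p) | (val t').2 w.1 == Some (bnorm p w.2)) f (bres p w.2)).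
  by rewrite pair_big_dep; apply: eq_bigl => -[t' w]; rewrite andbC.
rewrite big_pred1_eq.
transitivity (\prod_c \prod_(a | (val t).2 c == Some (bnorm p a)) f (bres p a)).
  by rewrite pair_big_dep.
rewrite [RHS]big_mkcond; apply: eq_bigr => c _; case: ifP => // cd.
apply: big_pred0 => a; apply: contraFF cd => /eqP e.
have [/subsetP /(_ c) + _] := pfamilyP (valP t).
by rewrite !inE e; apply.
Qed.

Lemma fpt_empty (f : fp_type W (gempty G)) : f = 0.
Proof. by apply: val_inj; apply/ffunP => -[]. Qed.

Lemma fpt_res X Y (h : ghom X Y) f x : fpt_map (bres_map h) f x = f (h x).
Proof. by rewrite ffunE /fpt_fun !big_pred1_eq. Qed.

Lemma fpt_prod X Y (x : fp_type W X) (y : fp_type W Y) :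
  exists! z : fp_type W (gsum X Y),
    fpt_map (bres_map (ginl X Y)) z = x /\ fpt_map (bres_map (ginr X Y)) z = y.
Proof.
pose z : {ffun gsum X Y -> W} :=
  [ffun u => match u with inl a => x a | inr b => y b end].
have zP : z \in @equivariant G W (gsum X Y).
  by apply/equivariantP => g [a|b]; rewrite !ffunE; [exact: (fpE x)|exact: (fpE y)].
exists (FPType zP); split=> [|z' [e1 e2]].
  by split; apply: val_inj; apply/ffunP => u; rewrite fpt_res /= ffunE.
by apply: val_inj; apply/ffunP => -[u|u]; rewrite ffunE -?e1 -?e2 fpt_res.
Qed.

Lemma fpt_add X (z : fp_type W (gsum X X)) :
  fpt_map (btr_map (gfold X)) z =
  fpt_map (bres_map (ginl X X)) z + fpt_map (bres_map (ginr X X)) z.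
Proof.
apply: val_inj; apply/ffunP => x; rewrite [RHS]ffunE !fpt_res ffunE /fpt_fun.
by rewrite big_sumType /= !big_pred1_eq. 
Qed.

Definition fp_tambara : tambara G :=
  Tambara fpt_iso fpt_id fpt_comp fpt_empty fpt_prod fpt_add.

End FixedPointTambara.

Record over (G : finGroupType) (X : gset G) := Over {
  ocar :> gset G;
  omap : ghom ocar X }.

Section Burnside.
Variable G : finGroupType.
Implicit Types X Y : gset G.

Definition over_iso X (S T : over X) : Prop :=
  exists2 f : ghom S T, bijective f & forall x, omap T (f x) = omap S x.

Definition over_add X (S T : over X) : over X := Over (gcopair (omap S) (omap T)).

(* Formal differences of finite G-sets over X, up to [vover_eq], form the group
   completion of the monoid of isomorphism classes of finite G-sets over X. *)
Definition vover X : Type := (over X * over X)%type.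

Definition vover_eq X (v w : vover X) : Prop :=
  exists U : over X,
    over_iso (over_add (over_add v.1 w.2) U) (over_add (over_add w.1 v.2) U).

(* The image in A(X) of the class of f : S -> X, namely tr_f(1) *)
Definition tclass (A : tambara G) X (S : over X) : A X :=
  tmap (btr_map (omap S)) (tone A S).

(* A(X) is the group completion of the isomorphism classes of finite G-sets
   over X.  As A is functorial on polynomials, transfers, restrictions and
   norms of the classes [tclass] are then given by composition, pullback and
   dependent product of G-sets, and this determines A. *)
Definition is_burnside (A : tambara G) : Prop :=
  (forall X (x : A X), exists v : vover X, x = tclass A v.1 - tclass A v.2) /\
  (forall X (v w : vover X),
     tclass A v.1 - tclass A v.2 = tclass A w.1 - tclass A w.2 <-> vover_eq v w).

(* [G/e] in A(G/G) *)
Definition free_class (A : tambara G) : A (gpoint G) :=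
  tclass A (Over (gto_point (gfree G))).

(* l : A -> L is initial among the maps of Tambara functors out of A that send
   x to a unit *)
Definition is_localization (A : tambara G) X (x : A X) (L : tambara G)
    (l : forall Y, A Y -> L Y) : Prop :=
  [/\ is_tambara_hom l, tunit (l X x)
    & forall (R : tambara G) (r : forall Y, A Y -> R Y),
        is_tambara_hom r -> tunit (r X x) ->
        (exists2 k : forall Y, L Y -> R Y, is_tambara_hom k &
           forall Y y, k Y (l Y y) = r Y y) /\
        (forall k k' : forall Y, L Y -> R Y, is_tambara_hom k -> is_tambara_hom k' ->
           (forall Y y, k Y (l Y y) = r Y y) -> (forall Y y, k' Y (l Y y) = r Y y) ->
           forall Y y, k Y y = k' Y y)].

End Burnside.

Inductive aterm (T : Type) : Type :=
  | AGen of T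
  | AZero
  | AOpp of aterm T
  | AAdd of aterm T & aterm T.
Arguments AZero {T}.

Inductive aeq (T : Type) (rel : aterm T -> aterm T -> Prop) : aterm T -> aterm T -> Prop :=
  | aeq_rel s t : rel s t -> aeq rel s t
  | aeq_refl s : aeq rel s s
  | aeq_sym s t : aeq rel s t -> aeq rel t s
  | aeq_trans s t u : aeq rel s t -> aeq rel t u -> aeq rel s u
  | aeq_opp s t : aeq rel s t -> aeq rel (AOpp s) (AOpp t)
  | aeq_add s s' t t' : aeq rel s s' -> aeq rel t t' -> aeq rel (AAdd s t) (AAdd s' t')
  | aeq_addA s t u : aeq rel (AAdd s (AAdd t u)) (AAdd (AAdd s t) u)
  | aeq_addC s t : aeq rel (AAdd s t) (AAdd t s)
  | aeq_add0 s : aeq rel (AAdd AZero s) s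
  | aeq_addN s : aeq rel (AAdd (AOpp s) s) AZero.

Record presab (T : Type) (rel : aterm T -> aterm T -> Prop) := PresAb {
  pclass : aterm T -> Prop;
  pclassP : exists t, pclass = aeq rel t }.

Section PresAb.
Variables (T : Type) (rel : aterm T -> aterm T -> Prop).
Local Notation P := (presab rel).

Definition ppi (t : aterm T) : P := PresAb (ex_intro _ t erefl).
Definition prepr (x : P) : aterm T := sval (cid (pclassP x)).

Lemma preprK x : ppi (prepr x) = x.
Proof.
rewrite /prepr; case: cid => t /=; case: x => c cP /= e; subst c.
by rewrite /ppi; congr PresAb; apply: Prop_irrelevance.
Qed.

Lemma ppiP s t : ppi s = ppi t <-> aeq rel s t.
Proof.
split=> [/(congr1 (@pclass _ _)) /= e|st].
  by rewrite e; exact: aeq_refl.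
suff e : aeq rel s = aeq rel t.
  rewrite /ppi; move: (ex_intro _ s _) (ex_intro _ t _); rewrite e => p q.
  by congr PresAb; apply: Prop_irrelevance.
apply: funext => u; apply: propext.
by split; [apply: aeq_trans (aeq_sym st) | apply: aeq_trans st].
Qed.

Lemma ppi_ind (Q : P -> Prop) : (forall t, Q (ppi t)) -> forall x, Q x.
Proof. by move=> h x; rewrite -(preprK x). Qed.

Lemma prepr_eq t : aeq rel (prepr (ppi t)) t.
Proof. by apply/ppiP; exact: preprK. Qed.

HB.instance Definition _ := gen_eqMixin P.
HB.instance Definition _ := gen_choiceMixin P.

Definition padd (x y : P) : P := ppi (AAdd (prepr x) (prepr y)).
Definition popp (x : P) : P := ppi (AOpp (prepr x)).

Lemma paddE s t : padd (ppi s) (ppi t) = ppi (AAdd s t).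
Proof. by apply/ppiP; apply: aeq_add; exact: prepr_eq. Qed.

Lemma poppE s : popp (ppi s) = ppi (AOpp s).
Proof. by apply/ppiP; apply: aeq_opp; exact: prepr_eq. Qed.

Lemma paddA : associative padd.
Proof.
elim/ppi_ind => x; elim/ppi_ind => y; elim/ppi_ind => z; rewrite !paddE.
by apply/ppiP; exact: aeq_addA.
Qed.

Lemma paddC : commutative padd.
Proof.
by elim/ppi_ind => x; elim/ppi_ind => y; rewrite !paddE; apply/ppiP; exact: aeq_addC.
Qed.

Lemma padd0 : left_id (ppi AZero) padd.
Proof. by elim/ppi_ind => x; rewrite !paddE; apply/ppiP; exact: aeq_add0. Qed.

Lemma paddN : left_inverse (ppi AZero) popp padd.
Proof. by elim/ppi_ind => x; rewrite poppE !paddE; apply/ppiP; exact: aeq_addN. Qed.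

HB.instance Definition _ := GRing.isZmodule.Build P paddA paddC padd0 paddN.

Definition pgen (t : T) : P := ppi (AGen t).

Lemma ppiD s t : ppi (AAdd s t) = ppi s + ppi t.
Proof. by rewrite -paddE. Qed.

Lemma ppiN s : ppi (AOpp s) = - ppi s.
Proof. by rewrite -poppE. Qed.

Lemma ppi0 : ppi AZero = 0.
Proof. by []. Qed.

Section Lift.
Variables (A : zmodType) (f : T -> A).

Fixpoint aeval (t : aterm T) : A := match t with
  | AGen x => f x
  | AZero => 0
  | AOpp s => - aeval s
  | AAdd s u => aeval s + aeval u end.

Hypothesis f_rel : forall s t, rel s t -> aeval s = aeval t.

Lemma aeval_eq s t : aeq rel s t -> aeval s = aeval t.
Proof.
elim=> //= {s t}.
- by move=> s t u _ -> _ ->.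
- by move=> s t _ ->.
- by move=> s s' t t' _ -> _ ->.
- by move=> s t u; rewrite addrA.
- by move=> s t; rewrite addrC.
- by move=> s; rewrite add0r.
- by move=> s; rewrite addNr.
Qed.

Definition plift (x : P) : A := aeval (prepr x).

Lemma pliftE t : plift (ppi t) = aeval t.
Proof. by apply: aeval_eq; exact: prepr_eq. Qed.

Lemma plift_gen t : plift (pgen t) = f t.
Proof. exact: pliftE. Qed.

Lemma pliftD : {morph plift : x y / x + y}.
Proof.
by elim/ppi_ind => s; elim/ppi_ind => t; rewrite -ppiD !pliftE.
Qed.

End Lift.

Lemma presab_ext (A : zmodType) (u v : P -> A) :
  {morph u : x y / x + y} -> {morph v : x y / x + y} ->
  (forall t, u (pgen t) = v (pgen t)) -> u =1 v.
Proof.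
have h0 (w : P -> A) : {morph w : x y / x + y} -> w 0 = 0.
  by move=> wD; have /eqP := wD 0 0; rewrite addr0 -subr_eq subrr eq_sym => /eqP.
have hN (w : P -> A) x : {morph w : x y / x + y} -> w (- x) = - w x.
  by move=> wD; apply/eqP; rewrite -addr_eq0 -wD addNr h0.
move=> uD vD e; elim/ppi_ind; elim=> [t||s IH|s IHs t IHt]; first exact: e.
- by rewrite ppi0 !h0.
- by rewrite ppiN !hN // IH.
- by rewrite ppiD uD vD IHs IHt.
Qed.

End PresAb.

(* The full subcategory of G-sets carried by some {0, ..., n-1} is a small
   skeleton up to isomorphism of the category of finite G-sets; the coend
   below is taken over it. *)
Record sgset (G : finGroupType) := SGSet {
  ssize : nat;
  sact : G -> 'I_ssize -> 'I_ssize;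
  sact1 : forall x, sact 1%g x = x;
  sactM : forall g h x, sact (g * h)%g x = sact g (sact h x) }.

Coercion sgset_gset (G : finGroupType) (X : sgset G) : gset G :=
  @GSet G 'I_(ssize X) (@sact G X) (@sact1 G X) (@sactM G X).

Record sspan (G : finGroupType) (X Y : gset G) := SSpan {
  ssapex : sgset G;
  ssleft : ghom ssapex X;
  ssright : ghom ssapex Y }.

Coercion sspan_span (G : finGroupType) (X Y : gset G) (s : sspan X Y) : span X Y :=
  Span (ssleft s) (ssright s).

Section Shrink.
Variable G : finGroupType.
Implicit Types X Y Z : gset G.

Definition shrink_act X g (x : 'I_#|X|) : 'I_#|X| := enum_rank (gact g (enum_val x : X)).

Lemma shrink_act1 X (x : 'I_#|X|) : shrink_act 1%g x = x.
Proof. by rewrite /shrink_act gact1 enum_valK. Qed.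

Lemma shrink_actM X g h (x : 'I_#|X|) :
  shrink_act (g * h)%g x = shrink_act g (shrink_act h x).
Proof. by rewrite /shrink_act gactM enum_rankK. Qed.

Definition shrink X : sgset G := SGSet (@shrink_act1 X) (@shrink_actM X).

Lemma unshrink_subproof X g (x : shrink X) :
  (enum_val (gact g x) : X) = gact g (enum_val x : X).
Proof. by rewrite enum_rankK. Qed.
Definition unshrink X : ghom (shrink X) X := GHom (@unshrink_subproof X).

Lemma unshrink_bij X : bijective (@unshrink X).
Proof. by exists enum_rank => x /=; rewrite ?enum_valK ?enum_rankK. Qed.

Definition shrink_span X Y (s : span X Y) : sspan X Y :=
  SSpan (gcomp (sleft s) (unshrink (sapex s))) (gcomp (sright s) (unshrink (sapex s))).

Lemma shrink_span_iso X Y (s : span X Y) : span_iso (shrink_span s) s.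
Proof. by exists (unshrink _) => //; exact: unshrink_bij. Qed.

End Shrink.

Section Box.
Variables (G : finGroupType) (M N : mackey G).
Implicit Types Z : gset G.

(* Generators w (x) m (x) n of the tensor products of the hom group of the
   Burnside category from X * Y to Z with M(X) and N(Y) *)
Record box_gen Z := BoxGen {
  bgX : sgset G;
  bgY : sgset G;
  bgw : sspan (gprod bgX bgY) Z;
  bgm : M bgX;
  bgn : N bgY }.

Definition bg Z (X Y : sgset G) (w : sspan (gprod X Y) Z) (m : M X) (n : N Y) :
  aterm (box_gen Z) := AGen (BoxGen w m n).

(* The relations: invariance under isomorphism and additivity in w, which is
   the group completion of spans; additivity in m and n; and the coend
   relation (w o (u * v)) (x) m (x) n = w (x) u m (x) v n *)
Inductive box_rel Z : aterm (box_gen Z) -> aterm (box_gen Z) -> Prop :=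
  | box_iso (X Y : sgset G) (w w' : sspan (gprod X Y) Z) m n :
      span_iso w w' -> box_rel (bg w m n) (bg w' m n)
  | box_addw (X Y : sgset G) (w w1 w2 : sspan (gprod X Y) Z) m n :
      span_iso w (sadd w1 w2) -> box_rel (bg w m n) (AAdd (bg w1 m n) (bg w2 m n))
  | box_addm (X Y : sgset G) (w : sspan (gprod X Y) Z) m m' n :
      box_rel (bg w (m + m') n) (AAdd (bg w m n) (bg w m' n))
  | box_addn (X Y : sgset G) (w : sspan (gprod X Y) Z) m n n' :
      box_rel (bg w m (n + n')) (AAdd (bg w m n) (bg w m n'))
  | box_coend (X X' Y Y' : sgset G) (u : span X X') (v : span Y Y')
      (w : sspan (gprod X' Y') Z) (w' : sspan (gprod X Y) Z) m n :
      span_iso w' (scomp w (sprod u v)) ->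
      box_rel (bg w' m n) (bg w (mmap (vof u) m) (mmap (vof v) n)).

Definition box_obj Z : zmodType := presab (@box_rel Z).

Definition bgen Z (X Y : sgset G) (w : sspan (gprod X Y) Z) (m : M X) (n : N Y) :
  box_obj Z := pgen (@box_rel Z) (BoxGen w m n).

Lemma bgen_iso Z (X Y : sgset G) (w w' : sspan (gprod X Y) Z) m n :
  span_iso w w' -> bgen w m n = bgen w' m n.
Proof. by move=> h; apply/ppiP; apply: aeq_rel; apply: box_iso. Qed.

Lemma bgen_addw Z (X Y : sgset G) (w w1 w2 : sspan (gprod X Y) Z) m n :
  span_iso w (sadd w1 w2) -> bgen w m n = bgen w1 m n + bgen w2 m n.
Proof. by move=> h; rewrite -ppiD; apply/ppiP; apply: aeq_rel; apply: box_addw. Qed.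

Lemma bgen_addm Z (X Y : sgset G) (w : sspan (gprod X Y) Z) m m' n :
  bgen w (m + m') n = bgen w m n + bgen w m' n.
Proof. by rewrite -ppiD; apply/ppiP; apply: aeq_rel; apply: box_addm. Qed.

Lemma bgen_addn Z (X Y : sgset G) (w : sspan (gprod X Y) Z) m n n' :
  bgen w m (n + n') = bgen w m n + bgen w m n'.
Proof. by rewrite -ppiD; apply/ppiP; apply: aeq_rel; apply: box_addn. Qed.

Lemma bgen_coend Z (X X' Y Y' : sgset G) (u : span X X') (v : span Y Y')
    (w : sspan (gprod X' Y') Z) (w' : sspan (gprod X Y) Z) m n :
  span_iso w' (scomp w (sprod u v)) ->
  bgen w' m n = bgen w (mmap (vof u) m) (mmap (vof v) n).
Proof. by move=> h; apply/ppiP; apply: aeq_rel; apply: box_coend. Qed.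

Definition box_fun Z Z' (s : span Z Z') (b : box_gen Z) : box_obj Z' :=
  bgen (shrink_span (scomp s (bgw b))) (bgm b) (bgn b).

Lemma box_fun_rel Z Z' (s : span Z Z') t t' :
  box_rel t t' -> aeval (box_fun s) t = aeval (box_fun s) t'.
Proof.
case=> {t t'} /= [X Y w w' m n h|X Y w w1 w2 m n h|X Y w m m' n|X Y w m n n'
  |X X' Y Y' u v w w' m n h]; rewrite /box_fun /=.
- apply: bgen_iso; apply: span_iso_trans (shrink_span_iso _) _.
  apply: span_iso_trans (span_iso_sym (shrink_span_iso _)).
  exact: scomp_iso (span_iso_refl _) h.
- apply: bgen_addw; apply: span_iso_trans (shrink_span_iso _) _.
  apply: span_iso_trans (scomp_iso (span_iso_refl s) h) _.
  apply: span_iso_trans (scomp_addr _ _ _) _.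
  by apply: span_iso_sym; apply: sadd_iso; exact: shrink_span_iso.
- exact: bgen_addm.
- exact: bgen_addn.
- apply: bgen_coend; apply: span_iso_trans (shrink_span_iso _) _.
  apply: span_iso_trans (scomp_iso (span_iso_refl s) h) _.
  apply: span_iso_trans (scompA _ _ _) _.
  by apply: scomp_iso (span_iso_refl _); apply: span_iso_sym; exact: shrink_span_iso.
Qed.

Definition box_map Z Z' (s : span Z Z') : box_obj Z -> box_obj Z' :=
  plift (rel := @box_rel Z) (box_fun s).

Lemma box_mapD Z Z' (s : span Z Z') : {morph box_map s : x y / x + y}.
Proof. exact: pliftD (@box_fun_rel _ _ s). Qed.

Lemma box_map_gen Z Z' (s : span Z Z') (X Y : sgset G) (w : sspan (gprod X Y) Z) m n :
  box_map s (bgen w m n) = bgen (shrink_span (scomp s w)) m n.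
Proof. exact: plift_gen (@box_fun_rel _ _ s) _. Qed.

Lemma box_ext Z (A : zmodType) (u v : box_obj Z -> A) :
  {morph u : x y / x + y} -> {morph v : x y / x + y} ->
  (forall (X Y : sgset G) (w : sspan (gprod X Y) Z) m n, u (bgen w m n) = v (bgen w m n)) ->
  u =1 v.
Proof. by move=> uD vD e; apply: presab_ext => // -[X Y w m n]; exact: e. Qed.

Lemma box_map_iso Z Z' (s t : span Z Z') : span_iso s t -> box_map s =1 box_map t.
Proof.
move=> st; apply: box_ext => [||X Y w m n]; try exact: box_mapD.
rewrite !box_map_gen; apply: bgen_iso.
apply: span_iso_trans (shrink_span_iso _) _.
apply: span_iso_trans (span_iso_sym (shrink_span_iso _)).
exact: scomp_iso st (span_iso_refl _).
Qed.

Lemma box_map_add Z Z' (s t : span Z Z') x :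
  box_map (sadd s t) x = box_map s x + box_map t x.
Proof.
pose v x := box_map s x + box_map t x; rewrite -[RHS]/(v x); move: x.
apply: box_ext => [|x y|X Y w m n]; first exact: box_mapD.
  by rewrite /v !box_mapD addrACA.
rewrite /v !box_map_gen; apply: bgen_addw.
apply: span_iso_trans (shrink_span_iso _) _.
apply: span_iso_trans (scomp_addl _ _ _) _.
by apply: span_iso_sym; apply: sadd_iso; exact: shrink_span_iso.
Qed.

Lemma box_map_id Z x : box_map (sid Z) x = x.
Proof.
move: x; apply: (@box_ext Z _ _ id) => [|//|X Y w m n]; first exact: box_mapD.
rewrite box_map_gen; apply: bgen_iso.
exact: span_iso_trans (shrink_span_iso _) (scomp_id_l _).
Qed.

Lemma box_map_comp X Y Z (t : span Y Z) (s : span X Y) x :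
  box_map (scomp t s) x = box_map t (box_map s x).
Proof.
move: x; apply: (@box_ext X _ _ (box_map t \o box_map s)) => [|x y|A B w m n].
- exact: box_mapD.
- by rewrite /= !box_mapD.
rewrite /= !box_map_gen; apply: bgen_iso.
apply: span_iso_trans (shrink_span_iso _) _.
apply: span_iso_trans (span_iso_sym (shrink_span_iso _)).
apply: span_iso_trans (span_iso_sym (scompA _ _ _)) _.
apply: scomp_iso (span_iso_refl _) _.
exact: span_iso_sym (shrink_span_iso _).
Qed.

Definition box : mackey G :=
  mackey_of_spans box_mapD box_map_iso box_map_add box_map_id box_map_comp.

(* The universal pairing M(X) * N(Y) -> (M [box] N)(X * Y) *)
Definition box_pair (X Y : gset G) (m : M X) (n : N Y) : box (gprod X Y) :=
  bgen (shrink_span (tr_span (gprodmap (unshrink X) (unshrink Y))))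
    (mres (unshrink X) m) (mres (unshrink Y) n).

End Box.

(* The action is a map R [box] M -> M; the unit and associativity diagrams are
   stated on the universal elements r (x) m, respectively r (x) r' (x) m. *)
Record tmodule (G : finGroupType) (R : tambara G) := TModule {
  tmod :> mackey G;
  tmod_act : forall X, box (underlying R) tmod X -> tmod X;
  tmod_act_hom : is_mackey_hom tmod_act;
  tmod_unit : forall (Y : gset G) (m : tmod Y),
    tmod_act (box_pair (M := underlying R) (tone R (gpoint G)) m) =
    mres (gsnd (gpoint G) Y) m;
  tmod_assoc : forall (X Y Z : gset G) (r : R X) (s : R Y) (m : tmod Z),
    tmod_act (box_pair (M := underlying R) (text r s) m) =
    mres (gassoc X Y Z)
      (tmod_act (box_pair (M := underlying R) r
        (tmod_act (box_pair (M := underlying R) s m)))) }.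

Definition is_tmodule_hom (G : finGroupType) (R : tambara G) (M N : tmodule R)
    (f : forall X, M X -> N X) : Prop :=
  is_mackey_hom f /\
  forall X Y (r : R X) (m : M Y),
    f _ (tmod_act (box_pair (M := underlying R) r m)) =
    tmod_act (box_pair (M := underlying R) r (f Y m)).

Record category := Category {
  cob :> Type;
  chom : cob -> cob -> Type;
  cid_ : forall x, chom x x;
  ccomp : forall x y z, chom y z -> chom x y -> chom x z;
  ccomp1l : forall x y (f : chom x y), ccomp (cid_ y) f = f;
  ccomp1r : forall x y (f : chom x y), ccomp f (cid_ x) = f;
  ccompA : forall x y z t (h : chom z t) (g : chom y z) (f : chom x y),
    ccomp h (ccomp g f) = ccomp (ccomp h g) f }.

Record cfunctor (C D : category) := CFunctor {
  fob :> C -> D;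
  fhom : forall x y : C, chom x y -> chom (fob x) (fob y);
  fhom_id : forall x, fhom (cid_ x) = cid_ (fob x);
  fhom_comp : forall (x y z : C) (g : chom y z) (f : chom x y),
    fhom (ccomp g f) = ccomp (fhom g) (fhom f) }.

Definition functor_id (C : category) : cfunctor C C :=
  @CFunctor C C id (fun _ _ f => f) (fun _ => erefl) (fun _ _ _ _ _ => erefl).

Lemma functor_comp_id (C D E : category) (K : cfunctor D E) (F : cfunctor C D) x :
  fhom K (fhom F (cid_ x)) = cid_ (K (F x)).
Proof. by rewrite !fhom_id. Qed.

Lemma functor_comp_comp (C D E : category) (K : cfunctor D E) (F : cfunctor C D)
    (x y z : C) (g : chom y z) (f : chom x y) :
  fhom K (fhom F (ccomp g f)) = ccomp (fhom K (fhom F g)) (fhom K (fhom F f)).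
Proof. by rewrite !fhom_comp. Qed.

Definition functor_comp (C D E : category) (K : cfunctor D E) (F : cfunctor C D) :
    cfunctor C E :=
  CFunctor (functor_comp_id K F) (functor_comp_comp K F).

Definition functor_iso (C D : category) (F K : cfunctor C D) : Prop :=
  exists (a : forall x, chom (F x) (K x)) (b : forall x, chom (K x) (F x)),
    [/\ forall x y (f : chom x y), ccomp (a y) (fhom F f) = ccomp (fhom K f) (a x),
        forall x, ccomp (b x) (a x) = cid_ (F x)
      & forall x, ccomp (a x) (b x) = cid_ (K x)].

Definition equivalent_categories (C D : category) : Prop :=
  exists (F : cfunctor C D) (K : cfunctor D C),
    functor_iso (functor_comp K F) (functor_id C) /\
    functor_iso (functor_comp F K) (functor_id D).

Section TModuleCategory.
Variables (G : finGroupType) (R : tambara G).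
Implicit Types M N P : tmodule R.

Definition tmodule_hom M N : Type :=
  {f : forall X, M X -> N X | is_tmodule_hom f}.

Lemma tmodule_id_subproof M : is_tmodule_hom (fun X (x : M X) => x).
Proof. by []. Qed.
Definition tmodule_id M : tmodule_hom M M := exist _ _ (tmodule_id_subproof M).

Lemma tmodule_comp_subproof M N P (g : tmodule_hom N P) (f : tmodule_hom M N) :
  is_tmodule_hom (fun X (x : M X) => sval g X (sval f X x)).
Proof.
case: g f => [g [[gD gM] gA]] [f [[fD fM] fA]] /=; split; first split.
- by move=> X x y; rewrite fD gD.
- by move=> X Y v x; rewrite fM gM.
- by move=> X Y r m; rewrite fA gA.
Qed.
Definition tmodule_comp M N P (g : tmodule_hom N P) (f : tmodule_hom M N) :
  tmodule_hom M P := exist _ _ (tmodule_comp_subproof g f).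

Lemma tmodule_comp1l M N (f : tmodule_hom M N) : tmodule_comp (tmodule_id N) f = f.
Proof. by case: f => f hf; apply: eq_exist. Qed.

Lemma tmodule_comp1r M N (f : tmodule_hom M N) : tmodule_comp f (tmodule_id M) = f.
Proof. by case: f => f hf; apply: eq_exist. Qed.

Lemma tmodule_compA M N P Q (h : tmodule_hom P Q) (g : tmodule_hom N P)
    (f : tmodule_hom M N) :
  tmodule_comp h (tmodule_comp g f) = tmodule_comp (tmodule_comp h g) f.
Proof. by apply: eq_exist. Qed.

Definition tmodule_category : category :=
  Category tmodule_comp1l tmodule_comp1r tmodule_compA.

End TModuleCategory.

Section LmodCategory.
Variable A : pzRingType.
Implicit Types U V W : lmodType A.

Definition lmod_hom U V : Type := {f : U -> V | linear f}.

Lemma lmod_id_subproof U : linear (@id U).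
Proof. by []. Qed.
Definition lmod_id U : lmod_hom U U := exist _ _ (@lmod_id_subproof U).

Lemma lmod_comp_subproof U V W (g : lmod_hom V W) (f : lmod_hom U V) :
  linear (fun x => sval g (sval f x)).
Proof. by case: g f => [g gl] [f fl] a x y /=; rewrite fl gl. Qed.
Definition lmod_comp U V W (g : lmod_hom V W) (f : lmod_hom U V) : lmod_hom U W :=
  exist _ _ (lmod_comp_subproof g f).

Lemma lmod_comp1l U V (f : lmod_hom U V) : lmod_comp (lmod_id V) f = f.
Proof. by case: f => f hf; apply: eq_exist. Qed.

Lemma lmod_comp1r U V (f : lmod_hom U V) : lmod_comp f (lmod_id U) = f.
Proof. by case: f => f hf; apply: eq_exist. Qed.

Lemma lmod_compA U V W T (h : lmod_hom W T) (g : lmod_hom V W) (f : lmod_hom U V) :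
  lmod_comp h (lmod_comp g f) = lmod_comp (lmod_comp h g) f.
Proof. by apply: eq_exist. Qed.

Definition lmod_category : category :=
  @Category (lmodType A) lmod_hom lmod_id lmod_comp lmod_comp1l lmod_comp1r lmod_compA.

End LmodCategory.

(* Z[1/n], as a subring of the rationals *)
Section Zinv.
Variable n : nat.

Definition zinv_pred : {pred rat} :=
  [pred x : rat | `[< exists k : nat, n%:R ^+ k * x \is a Num.int >]].

Lemma zinvP (x : rat) :
  reflect (exists k : nat, n%:R ^+ k * x \is a Num.int) (x \in zinv_pred).
Proof. exact: asboolP. Qed.

Lemma zinv_subring : subring_closed zinv_pred.
Proof.
split=> [|x y /zinvP[k xk] /zinvP[l yl]|x y /zinvP[k xk] /zinvP[l yl]]; apply/zinvP.
- by exists 0%N; rewrite mulr1 expr0 rpred1.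
- exists (k + l)%N; rewrite mulrBr; apply: rpredB.
    by rewrite addnC exprD -mulrA rpredM // rpredX // rpred_nat.
  by rewrite exprD -mulrA rpredM // rpredX // rpred_nat.
- by exists (k + l)%N; rewrite exprD mulrACA rpredM.
Qed.
HB.instance Definition _ := GRing.isSubringClosed.Build rat zinv_pred zinv_subring.

Record zinv := Zinv { zinv_val :> rat; zinv_valP : zinv_val \in zinv_pred }.

HB.instance Definition _ := [isSub for zinv_val].
HB.instance Definition _ := [Choice of zinv by <:].
HB.instance Definition _ := [SubChoice_isSubComNzRing of zinv by <:].

End Zinv.

Section GroupRing.
Variables (R : pzRingType) (G : finGroupType).

Definition group_ring : Type := {ffun G -> R}.
HB.instance Definition _ := GRing.Zmodule.copy group_ring {ffun G -> R}.

Definition gr_one : group_ring := [ffun g => (g == 1%g)%:R].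
Definition gr_mul (a b : group_ring) : group_ring :=
  [ffun g => \sum_h a h * b (h^-1 * g)%g].

Lemma gr_mulA : associative gr_mul.
Proof.
move=> a b c; apply/ffunP => g; rewrite !ffunE.
under eq_bigr => h _ do rewrite ffunE big_distrr /=.
under [RHS]eq_bigr => h _ do rewrite ffunE big_distrl /=.
rewrite [RHS]exchange_big /=; apply: eq_bigr => h _.
rewrite [RHS](reindex_inj (mulgI h)); apply: eq_bigr => k _ /=.
by rewrite mulKg invMg -mulrA mulgA.
Qed.

Lemma gr_mul1l : left_id gr_one gr_mul.
Proof.
move=> a; apply/ffunP => g; rewrite ffunE (bigD1 1%g) //= big1 => [|h /negPf h1].
  by rewrite ffunE eqxx mul1r invg1 mul1g addr0.
by rewrite ffunE h1 mul0r.
Qed.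

Lemma gr_mul1r : right_id gr_one gr_mul.
Proof.
move=> a; apply/ffunP => g; rewrite ffunE (bigD1 g) //= big1 => [|h /negPf hg].
  by rewrite ffunE mulVg eqxx mulr1 addr0.
rewrite ffunE -(inj_eq (mulgI h)) mulKVg mulg1 eq_sym hg mulr0 //.
Qed.

Lemma gr_mulDl : left_distributive gr_mul +%R.
Proof.
move=> a b c; apply/ffunP => g; rewrite !ffunE -big_split.
by apply: eq_bigr => h _; rewrite ffunE mulrDl.
Qed.

Lemma gr_mulDr : right_distributive gr_mul +%R.
Proof.
move=> a b c; apply/ffunP => g; rewrite !ffunE -big_split.
by apply: eq_bigr => h _; rewrite ffunE mulrDr.
Qed.

HB.instance Definition _ :=
  GRing.Zmodule_isPzRing.Build group_ring gr_mulA gr_mul1l gr_mul1r gr_mulDl gr_mulDr.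

End GroupRing.

(* Main.v *)
Require Import Defs.
From HB Require Import structures.
From mathcomp Require Import all_boot all_order all_algebra all_fingroup.
From mathcomp Require Import boolp.
(* Restores the names, such as gact, that the group theory library shadows. *)
Import Defs.

Set Implicit Arguments.
Unset Strict Implicit.
Unset Printing Implicit Defensive.

(** Let n be the order of G. Transfer after restriction along the projection of G/e x X onto X defines a
    natural endomorphism e of M(X) for every Mackey functor M; over a Tambara functor it is multiplication
    by [G/e], by Frobenius reciprocity. So the localization makes e invertible on its own values and on those
    of all its modules, and the theorem follows from a computation of e.

    The G-set G/e x X is free with one orbit for each point x of X, hence e is the sum over x of tr_x res_x,
    where x also denotes the orbit map g |-> g x from G/e to X. Sending m to the family of the res_x m gives
    a map [to_fixed] from M to FP(M(G/e)), sending a family f to the sum of the tr_x (f x) gives a map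
    backwards. One composite is e, the other one is multiplication by n by the double coset formula. At
    X = G/e also e is multiplication by n. If e is invertible, then so is n on M(G/e), and [to_fixed] is an
    isomorphism ([to_fixed_iso]). This is (b).

    For (a), restricting to orbits shows that the elements of a Tambara functor S with e invertible are
    determined by their restrictions to G/e. A polynomial map with target G/e is a sum of products of
    restrictions along orbit maps, because G-sets over G/e are free. Hence a family of maps R(X) -> S(X) that
    commutes with restrictions and is a ring homomorphism at G/e is a map of Tambara functors
    ([tambara_hom_criterion]). If R(G/e) is generated by 1 up to division by powers of n, there is at most one
    such family, and if moreover 1 has infinite order there is one ([tambara_hom_unique],
    [tambara_hom_exists]). The Burnside functor, whose value at G/e is the ring of integers, and the constant
    functor on Z[1/n] both qualify as R, so that the universal property identifies the localization with
    Z[1/n] ([localization_iso]).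

    For (c), a module M is sent to M(G/e), on which n is invertible, with the Weyl action of G; a
    Z[1/n][G]-module V is sent to FP(V), on which the localization acts pointwise through its map to Z[1/n].
    The map [to_fixed] is the unit of the equivalence. It is linear since an element r of the
    localization over G/e satisfies n^j r = a for some integer a, which determines its action
    ([box_act_diag]). Evaluation at 1 is the counit ([modules_equivalent]). *)

Import GRing.Theory Num.Theory.

Local Open Scope ring_scope.

(** * Free G-sets and their orbits *)

Section FreeOrbits.
Variable G : finGroupType.
Implicit Types X Y Z : gset G.

Definition orbit_map X (x : X) : ghom (gfree G) X.
Proof.
refine (@GHom G (gfree G) X (fun g => gact g x) _).
by move=> g h; rewrite -gactM.
Defined.

Lemma orbit_map1 : orbit_map (1%g : gfree G) =1 id.
Proof. by move=> g; rewrite /= mulg1. Qed.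

Fixpoint free_copies (T : Type) (r : seq T) : gset G :=
  if r is _ :: r' then gsum (gfree G) (free_copies r') else gempty G.

Fixpoint orbits_map X (r : seq X) : ghom (free_copies r) X :=
  match r return ghom (free_copies r) X with
  | [::] => gof_empty X
  | x :: r' => gcopair (orbit_map x) (orbits_map r')
  end.

Definition free_basis X (r : seq X) : Prop :=
  [/\ uniq r,
      forall x, exists g, exists2 b, b \in r & x = gact g b
    & forall g g' b b', b \in r -> b' \in r ->
        gact g b = gact g' b' -> g = g' /\ b = b'].

Lemma orbits_map_in X (r : seq X) z :
  exists g, exists2 b, b \in r & orbits_map r z = gact g b.
Proof.
elim: r z => [|x r IH] z; first by case: z.
case: z => [g|z].
- by exists g, x; rewrite ?mem_head.
- by have [g [b br /= ->]] := IH z; exists g, b; rewrite // inE br orbT.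
Qed.

Lemma orbits_map_bij X (r : seq X) : free_basis r -> bijective (orbits_map r).
Proof.
case=> ur sr fr; apply: inj_surj_bij => [|x]; last first.
  have [g [b br ->]] := sr x; elim: r br {ur sr fr} => [|y r IH] //=.
  rewrite inE => /orP[/eqP ->|/IH [z <-]]; first by exists (inl g).
  by exists (inr z).
elim: r ur fr {sr} => [|x r IH] /=; first by move=> _ _ [].
case/andP=> xr ur fr; have {}IH := IH ur.
have /IH {}IH : forall g g' b b', b \in r -> b' \in r ->
    gact g b = gact g' b' -> g = g' /\ b = b'.
  by move=> g g' b b' br br'; apply: fr; rewrite inE ?br ?br' orbT.
(* The orbit of x is disjoint from those of the points of r. *)
have disj g z : gact g x <> orbits_map r z.
  have [h [b br ->]] := orbits_map_in z.
  case/fr => [||_ e]; rewrite ?inE ?eqxx ?br ?orbT //.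
  by rewrite e br in xr.
move=> [g|z] [g'|z'] /= e; first by have [-> _] := fr _ _ _ _ (mem_head _ _) (mem_head _ _) e.
- by case: (disj _ _ e).
- by case: (disj _ _ (esym e)).
- by rewrite (IH _ _ e).
Qed.

(** A G-set over G/e is free, and its fibre over 1 meets every orbit exactly once. *)
Lemma free_basis_fibre X (f : ghom X (gfree G)) :
  free_basis (enum [pred a | f a == 1%g]).
Proof.
split=> [|x|g g' b b']; first exact: enum_uniq.
  exists (f x), (gact (f x)^-1%g x); last by rewrite gactVK.
  by rewrite mem_enum inE gfunE /= mulVg.
rewrite !mem_enum !inE => /eqP b1 /eqP b1' e.
have gg' : g = g'.
  by have := congr1 f e; rewrite !gfunE /= b1 b1' !mulg1.
by split=> //; apply: (@gact_inj _ _ g); rewrite e gg'.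
Qed.

(** The product of G/e with any X is free on the points (1, x): the diagonal action becomes the translation
    of the first factor after the shear (g, x) |-> (g, g^-1 x). *)
Lemma free_basis_free X : free_basis [seq ((1%g, x) : gprod (gfree G) X) | x <- enum X].
Proof.
split=> [|[g x]|g g' b b' /mapP[x _ ->] /mapP[x' _ ->] /=]; last first.
- by rewrite !mulg1 => -[-> /gact_inj ->].
- exists g, (1%g, gact g^-1%g x); last by rewrite /= mulg1 gactVK.
  by apply/mapP; exists (gact g^-1%g x); rewrite ?mem_enum.
- by rewrite map_inj_uniq ?enum_uniq // => x x' [].
Qed.

End FreeOrbits.

Section MackeyOrbits.
Variables (G : finGroupType) (M : mackey G).
Implicit Types X Y Z : gset G.

Lemma mmap_sadd X Y (s t : span X Y) (m : M X) :
  mmap (vof (sadd s t)) m = mmap (vof s) m + mmap (vof t) m.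
Proof.
rewrite -mmap_add; apply: mmap_veq; exists (szero X Y); rewrite /=.
apply: sadd_iso (span_iso_refl _); apply: sadd_iso (span_iso_refl _) _.
exact: sadd0.
Qed.

Lemma mmap_szero X Y (m : M X) : mmap (vof (szero X Y)) m = 0.
Proof.
have := mmap_sadd (szero X Y) (szero X Y) m; rewrite (mmap_iso (sadd0 _)).
by move/eqP; rewrite -subr_eq subrr eq_sym => /eqP.
Qed.

(** A morphism of the Burnside category is a difference of spans, so additivity leaves nothing but spans
    to be checked in what follows. *)
Lemma mmap_sub X Y (v : vspan X Y) (m : M X) :
  mmap v m = mmap (vof v.1) m - mmap (vof v.2) m.
Proof.
apply/eqP; rewrite eq_sym subr_eq -mmap_add eq_sym; apply/eqP; apply: mmap_veq.
exists (szero X Y); apply: sadd_iso (span_iso_refl _); rewrite /=.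
apply: span_iso_trans (sadd0 _) _; apply: sadd_iso (span_iso_refl _) _.
apply: span_iso_sym; exact: sadd0.
Qed.

Lemma mmap0 X Y (v : vspan X Y) : mmap v (0 : M X) = 0.
Proof. by have /eqP := mmapD v (0 : M X) 0; rewrite addr0 -subr_eq subrr eq_sym => /eqP. Qed.

Lemma mmapMn X Y (v : vspan X Y) (m : M X) k : mmap v (m *+ k) = mmap v m *+ k.
Proof. by elim: k => [|k IH]; rewrite ?mmap0 // !mulrS mmapD IH. Qed.

Lemma mres_comp X Y Z (f : ghom Y Z) (h : ghom X Y) (m : M Z) :
  mres h (mres f m) = mres (gcomp f h) m.
Proof. by rewrite /mres -mmap_scomp; apply: mmap_iso; exact: scomp_res. Qed.

Lemma mres_ext X Y (f h : ghom X Y) : f =1 h -> mres (M := M) f =1 mres h.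
Proof. by move=> fh; apply: mmap_iso; apply: span_ext. Qed.

Lemma mtr_comp X Y Z (f : ghom Y Z) (h : ghom X Y) (m : M X) :
  mtr f (mtr h m) = mtr (gcomp f h) m.
Proof. by rewrite /mtr -mmap_scomp; apply: mmap_iso; exact: scomp_tr. Qed.

Lemma mtr_ext X Y (f h : ghom X Y) : f =1 h -> mtr (M := M) f =1 mtr h.
Proof. by move=> fh; apply: mmap_iso; apply: span_ext. Qed.

Lemma mres_id X (f : ghom X X) (m : M X) : f =1 id -> mres f m = m.
Proof. by move=> fi; rewrite (mres_ext (h := gid X)) // [LHS]mmap_sid. Qed.

Lemma mmap_span X Y (s : span X Y) (m : M X) :
  mmap (vof s) m = mtr (sright s) (mres (sleft s) m).
Proof.
rewrite /mtr /mres -mmap_scomp; apply: mmap_iso.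
apply: span_iso_trans (span_iso_sym (scomp_tr _ _)).
by case: s => A l r; apply: span_ext.
Qed.

(** A free apex is a disjoint union of copies of G/e, and a Mackey functor turns disjoint unions of spans
    into sums. *)
Lemma mmap_free_basis X Y (s : span X Y) (r : seq (sapex s)) (m : M X) :
  free_basis r ->
  mmap (vof s) m =
  \sum_(a <- r) mmap (vof (Span (orbit_map (sleft s a)) (orbit_map (sright s a)))) m.
Proof.
move/orbits_map_bij => br.
have /mmap_iso <- : span_iso
    (Span (gcomp (sleft s) (orbits_map r)) (gcomp (sright s) (orbits_map r))) s.
  by exists (orbits_map r).
elim: r {br} => [|a r IH].
  rewrite big_nil -(mmap_szero Y m); apply: mmap_iso.
  by apply: span_iso_empty => -[].
rewrite big_cons -IH -mmap_sadd; apply: mmap_iso.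
by apply: span_ext => [] [g|z] //=; rewrite gfunE.
Qed.

Lemma mmap_to_free X (s : span X (gfree G)) (m : M X) :
  mmap (vof s) m = \sum_(a | sright s a == 1%g) mres (orbit_map (sleft s a)) m.
Proof.
rewrite (mmap_free_basis m (free_basis_fibre (sright s))) big_enum_cond /=.
apply: eq_big => a; first by rewrite andbT.
rewrite andbT inE => /eqP a1; apply: mmap_iso; apply: span_ext => // g /=.
by rewrite a1 mulg1.
Qed.

End MackeyOrbits.

Section OrbitValues.
Variables (G : finGroupType) (M : mackey G).
Implicit Types X Y Z : gset G.

Definition orbit_values X (m : M X) : {ffun X -> weyl M} :=
  [ffun x => mres (orbit_map x) m : weyl M].

Lemma orbit_values_subproof X (m : M X) :
  orbit_values m \in @equivariant G (weyl M) X.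
Proof.
apply/equivariantP => g x; rewrite !ffunE /= /weyl_act mres_comp.
by apply: mres_ext => h /=; rewrite -gactM.
Qed.
(** The comparison map of part (b): an element of M(X) is sent to the family of its restrictions along the
    orbit maps G/e -> X, which is equivariant for the Weyl action. *)
Definition to_fixed X (m : M X) : fp_mackey (weyl M) X := FPType (orbit_values_subproof m).

Lemma to_fixedE X (m : M X) x : to_fixed m x = mres (orbit_map x) m.
Proof. by rewrite ffunE. Qed.

Lemma fp_ext (V : gmodule G) X (f h : fp_mackey V X) : f =1 h -> f = h.
Proof. by move=> fh; apply: val_inj; apply/ffunP. Qed.

Lemma fp_spanE (V : gmodule G) X Y (s : span X Y) (f : fp_mackey V X) y :
  (mmap (vof s) f : fp_mackey V Y) y = \sum_(a | sright s a == y) f (sleft s a).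
Proof.
have -> : mmap (vof s) f = fp_span s f by exact: mackey_of_spansE.
by rewrite ffunE.
Qed.

Lemma fp_resE (V : gmodule G) X Y (h : ghom X Y) (f : fp_mackey V Y) x :
  (mres h f : fp_mackey V X) x = f (h x).
Proof. by rewrite /mres fp_spanE /= big_pred1_eq. Qed.

Lemma mackey_hom_spans (N : mackey G) (f : forall X, M X -> N X) :
  (forall X, {morph f X : x y / x + y}) ->
  (forall X Y (s : span X Y) x, f Y (mmap (vof s) x) = mmap (vof s) (f X x)) ->
  is_mackey_hom f.
Proof.
move=> fD fs; split=> // X Y v x; rewrite mmap_sub [RHS]mmap_sub -!fs.
by apply/eqP; rewrite eq_sym subr_eq -fD subrK.
Qed.

Lemma to_fixedD X : {morph @to_fixed X : x y / x + y}.
Proof. by move=> m m'; apply: fp_ext => x; rewrite [RHS]ffunE !to_fixedE; exact: mmapD. Qed.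

(** The base change of a span X <- S -> Y along the orbit map of y has an apex over G/e, hence free, with
    one orbit for each point of S over y; this is the sum that defines the span on fixed points. *)
Lemma to_fixed_span X Y (s : span X Y) m : to_fixed (mmap (vof s) m) = mmap (vof s) (to_fixed m).
Proof.
apply: fp_ext => y; rewrite to_fixedE fp_spanE /mres -mmap_scomp mmap_to_free.
pose P (p : gprod (sapex s) (gfree G)) := sright s p.1 == orbit_map y p.2.
rewrite (big_sig _ P (fun p => p.2 == 1%g)
  (fun p => mres (orbit_map (sleft s p.1)) m)).
rewrite (reindex_onto (fun a : sapex s => (a, 1%g) : gprod (sapex s) (gfree G)) fst);
  last by case=> a g /andP[_ /eqP /= ->].
apply: eq_big => [a|a _]; first by rewrite /P /= gact1 !eqxx !andbT.
by rewrite to_fixedE.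
Qed.

Lemma to_fixed_hom : is_mackey_hom to_fixed.
Proof. by apply: mackey_hom_spans; [exact: to_fixedD | exact: to_fixed_span]. Qed.

Lemma mackey_hom_inv (N : mackey G) (f : forall X, M X -> N X) :
  is_mackey_hom f -> (forall X, injective (f X)) -> (forall X y, exists x, f X x = y) ->
  mackey_iso M N.
Proof.
move=> [fD fM] fi fs; pose h X y := sval (cid (fs X y)).
have hK X y : f X (h X y) = y by rewrite /h; case: cid.
exists f, h; split=> [||X x|X y]; [by [] | | exact: fi (hK _ _) | exact: hK].
by split=> [X y y'|X Y v y]; apply: fi; rewrite ?fD ?fM !hK.
Qed.

End OrbitValues.

(** * Mackey functors in which the free orbit is invertible *)

Lemma fp_mulrn (G : finGroupType) (V : gmodule G) (X : gset G) (f : fp_mackey V X) k x :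
  (f *+ k) x = f x *+ k.
Proof. by elim: k => [|k IH]; rewrite ?ffunE // !mulrS ffunE IH. Qed.

(** Each group element a contributes exactly once, at x = a^-1 y. *)
Lemma sum_translators (G : finGroupType) (A : zmodType) (X : gset G) (y : X) (v : A) :
  \sum_(x : X) \sum_(a : gfree G | gact a x == y) v = v *+ #|{: G}|.
Proof.
rewrite (exchange_big_dep predT) //= -sumr_const; apply: eq_bigr => a _.
rewrite (big_pred1 (gact a^-1%g y)) // => x /=.
by rewrite -(inj_eq (@gact_inj _ _ a^-1%g)) gactK.
Qed.

Section FreeInverted.
Variables (G : finGroupType) (M : mackey G).
Implicit Types X Y Z : gset G.
Local Notation n := #|{: G}|.

Definition free_span X : span X X := Span (gsnd (gfree G) X) (gsnd (gfree G) X).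

(** The span acts as transfer after restriction along G/e x X -> X, which is multiplication by [G/e] as
    soon as M is a module over a Tambara functor. Its invertibility is thus the way to say, for a bare
    Mackey functor, that [G/e] acts invertibly. *)
Definition free_inverted : Prop :=
  forall X, bijective (mmap (m := M) (vof (free_span X))).

(** G/e x X is free with one orbit for each point of X. *)
Lemma free_span_sum X (m : M X) :
  mmap (vof (free_span X)) m = \sum_x mtr (orbit_map x) (mres (orbit_map x) m).
Proof.
rewrite (@mmap_free_basis _ _ _ _ (free_span X) _ m (free_basis_free X)) big_map big_enum_cond /=.
by apply: eq_bigr => x _; rewrite mmap_span.
Qed.

Lemma free_span_free (m : M (gfree G)) :
  mmap (vof (free_span (gfree G))) m = m *+ n.
Proof.
rewrite free_span_sum -sumr_const; apply: eq_bigr => x _.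
rewrite -(mmap_span (Span (orbit_map x) (orbit_map x))) -[RHS]mmap_sid; apply: mmap_iso.
by exists (orbit_map x) => //=; exists (fun g => g * x^-1)%g => g; rewrite ?mulgK ?mulgKV.
Qed.

(** The map backwards: both composites with [to_fixed] are computed below, and both become invertible together
    with [G/e]. *)
Definition transfer_values X (f : X -> M (gfree G)) : M X :=
  \sum_x mtr (orbit_map x) (f x).

Lemma transfer_values_to_fixed X (m : M X) :
  transfer_values (to_fixed m) = mmap (vof (free_span X)) m.
Proof. by rewrite free_span_sum; apply: eq_bigr => x _; rewrite to_fixedE. Qed.

(** The double coset formula: restricting to the orbit of y the transfer from the orbit of x gives one
    Weyl translate for each g with g x = y, and equivariance of f turns each of them into f y. *)
Lemma to_fixed_transfer_values X (f : fp_mackey (weyl M) X) :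
  to_fixed (transfer_values f) = f *+ n.
Proof.
rewrite /transfer_values (big_morph _ (@to_fixedD G M X) (id1 := 0)); last first.
  by apply: fp_ext => x; rewrite to_fixedE ffunE; exact: mmap0.
apply: fp_ext => y; transitivity (\sum_x to_fixed (mtr (orbit_map x) (f x)) y).
  by apply: (big_morph (fun h : fp_mackey (weyl M) X => h y)) => [h h'|]; rewrite ffunE.
pose fy : weyl M := f y.
transitivity (\sum_(x : X) \sum_(a : gfree G | gact a x == y) fy).
  apply: eq_bigr => x _; rewrite to_fixed_span fp_spanE; apply: eq_bigr => a /eqP ay.
  by rewrite /fy -ay fpE to_fixedE; apply: mres_ext.
rewrite fp_mulrn; exact: sum_translators.
Qed.

Hypothesis Mfree : free_inverted.

Lemma card_inj : injective (fun m : M (gfree G) => m *+ n).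
Proof.
by move=> m m' /= e; apply: (bij_inj (Mfree (gfree G))); rewrite !free_span_free.
Qed.

Lemma card_surj (m : M (gfree G)) : exists m', m' *+ n = m.
Proof. by have [h _ hK] := Mfree (gfree G); exists (h m); rewrite -free_span_free. Qed.

Lemma to_fixed_inj X : injective (@to_fixed G M X).
Proof.
move=> m m' e; apply: (bij_inj (Mfree X)).
by rewrite -!transfer_values_to_fixed e.
Qed.

(** Divide f by |G| pointwise, then transfer; injectivity of the multiplication by |G| makes the quotient
    equivariant. *)
Lemma to_fixed_surj X (f : fp_mackey (weyl M) X) : exists m, to_fixed m = f.
Proof.
pose f' : {ffun X -> weyl M} := [ffun x => sval (cid (card_surj (f x)))].
have f'n x : f' x *+ n = f x by rewrite ffunE; case: cid.
have f'E : f' \in @equivariant G (weyl M) X.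
  apply/equivariantP => g x; apply: card_inj => /=.
  rewrite f'n fpE -f'n; exact: mmapMn.
exists (transfer_values (FPType f'E)); rewrite to_fixed_transfer_values.
apply: fp_ext => x; rewrite -f'n.
exact: fp_mulrn.
Qed.

Lemma to_fixed_iso : mackey_iso M (fp_mackey (weyl M)).
Proof. exact: mackey_hom_inv (to_fixed_hom M) to_fixed_inj to_fixed_surj. Qed.

End FreeInverted.

(** * Composites of polynomials *)

Section BispanComposites.
Variable G : finGroupType.
Implicit Types X Y Z : gset G.

(** A recognition principle for composites of polynomials. The points of the middle object of the composite
    are pairs of a point d of the target of the norm and a section over the fibre at d, those of the source
    are triples (middle point, c, a) with the section taking at c the value under a. A diagram r whose points
    are parametrized in this way is the composite. Sections are only compared on the fibre at d: the values
    of [sec] elsewhere are arbitrary, and the option type allows for an empty target. *)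
Lemma bcomp_iso X Y Z (q : bispan Y Z) (p : bispan X Y) (r : bispan X Z)
    (d : ghom (btgt r) (btgt q)) (sec : btgt r -> bsrc q -> option (btgt p))
    (c : ghom (bsrc r) (bsrc q)) (a : ghom (bsrc r) (bsrc p)) :
  (forall w, btr q (d w) = btr r w) ->
  (forall w c0, bnorm q c0 = d w ->
     exists2 b, sec w c0 = Some b & btr p b = bres q c0) ->
  (forall g w c0, bnorm q c0 = d w ->
     sec (gact g w) (gact g c0) = Option.map (gact g) (sec w c0)) ->
  (forall w w', d w = d w' ->
     (forall c0, bnorm q c0 = d w -> sec w c0 = sec w' c0) -> w = w') ->
  (forall d0 (s : bsrc q -> option (btgt p)),
     (forall c0, bnorm q c0 = d0 -> exists2 b, s c0 = Some b & btr p b = bres q c0) ->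
     exists2 w, d w = d0 & forall c0, bnorm q c0 = d0 -> sec w c0 = s c0) ->
  (forall z, bres p (a z) = bres r z) ->
  (forall z, bnorm q (c z) = d (bnorm r z)) ->
  (forall z, sec (bnorm r z) (c z) = Some (bnorm p (a z))) ->
  (forall z z', bnorm r z = bnorm r z' -> c z = c z' -> a z = a z' -> z = z') ->
  (forall w c0 a0, bnorm q c0 = d w -> sec w c0 = Some (bnorm p a0) ->
     exists z, [/\ bnorm r z = w, c z = c0 & a z = a0]) ->
  bispan_iso r (bcomp q p).
Proof.
move=> dr secP secE dinj dsurj ar cd sa zinj zsurj.
(* The partial function of the section: [sec w], cut off outside the fibre at d w. *)
pose s w : gpfun (bsrc q) (btgt p) :=
  [ffun c0 => if bnorm q c0 == d w then sec w c0 else None].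
have sP w : bsection (q := q) (p := p) (d w, s w).
  apply/pfamilyP; split=> [|c0]; first by apply/subsetP => c0; rewrite !inE /= ffunE; case: ifP.
  rewrite !inE ffunE /= => /eqP e; rewrite e eqxx.
  by have [b -> ->] := secP _ _ e.
pose h w : bcomp_tgt q p := exist _ (d w, s w) (sP w).
have hE g w : h (gact g w) = gact g (h w).
  apply: val_inj; rewrite /= gfunE; congr pair; apply/ffunP => c0.
  rewrite -(gactVK g c0); set c1 := gact _ c0; rewrite !ffunE gactK !gfunE.
  rewrite (inj_eq (@gact_inj _ _ g)); by case: eqP => // e; apply: secE; rewrite gfunE.
have ev z : beval (q := q) (p := p) (h (bnorm r z), (c z, a z)).
  by rewrite /beval /= ffunE cd eqxx sa.
pose f z : bcomp_src q p := exist _ (h (bnorm r z), (c z, a z)) (ev z).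
have fE g z : f (gact g z) = gact g (f z).
  apply: val_inj; rewrite /= !gfunE; congr pair; exact: hE.
have hsec w c0 : bnorm q c0 = d w -> (val (h w)).2 c0 = sec w c0.
  by move=> e; rewrite ffunE e eqxx.
have hinj : injective h.
  move=> w w' e; have e1 : d w = d w' := congr1 (fun u => (val u).1) e.
  apply: dinj => // c0 ec; rewrite -(hsec w) // -(hsec w') ?e //.
  by rewrite ec e1.
have hsurj w' : exists w, h w = w'.
  case: w' => [[d0 s0] ds].
  have [/subsetP s1 s2] := pfamilyP ds.
  have [c1 e|w ew ws] := dsurj d0 s0.
    have := s2 c1; rewrite !inE /= e eqxx => /(_ isT).
    by case: (s0 c1) => // b /eqP; exists b.
  exists w; apply: val_inj; congr pair => //; apply/ffunP => c1; rewrite ffunE ew.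
  case: eqP => [/ws //|/eqP ne]; apply/esym/eqP; rewrite -[_ == _]negbK.
  by apply: contra ne => /s1; rewrite inE.
exists (GHom fE), (GHom hE); split=> //.
- apply: inj_surj_bij => [z z' e|[[w' [c0 a0]] /= e]].
    have /= e1 := congr1 (fun u : bcomp_src q p => (val u).1) e.
    have /= [e2 e3] := congr1 (fun u : bcomp_src q p => (val u).2) e.
    apply: zinj => //; exact: hinj e1.
  have [w hw] := hsurj w'; subst w'.
  have /eqP e' := e.
  have ec : bnorm q c0 = d w.
    by apply/eqP; move: e'; rewrite /= ffunE; case: ifP.
  have [|z [e1 e2 e3]] := zsurj w c0 a0 ec; first by rewrite -(hsec w c0 ec).
  by exists z; apply: val_inj; rewrite /= e1 e2 e3.
exact: inj_surj_bij.
Qed.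

End BispanComposites.

(** * Restrictions, norms and transfers in a Tambara functor *)

Section TambaraMaps.
Variables (G : finGroupType) (R : tambara G).
Implicit Types X Y Z : gset G.

Local Notation Res f := (tmap (t := R) (bres_map f)).
Local Notation Nm f := (tmap (t := R) (bnorm_map f)).
Local Notation Tr f := (tmap (t := R) (btr_map f)).

Lemma tmap_bcomp X Y Z (q : bispan Y Z) (p : bispan X Y) (r : bispan X Z) (x : R X) :
  bispan_iso r (bcomp q p) -> tmap q (tmap p x) = tmap r x.
Proof. by move/tmap_iso => ->; rewrite tmap_comp. Qed.

Lemma tmap_res X Y Z (f : ghom Y X) (q : bispan Y Z) (x : R X) :
  tmap q (Res f x) = tmap (Bispan (gcomp f (bres q)) (bnorm q) (btr q)) x.
Proof.
apply: tmap_bcomp; apply: (@bcomp_iso _ _ _ _ q (bres_map f)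
  (Bispan (gcomp f (bres q)) (bnorm q) (btr q)) (gid _) (fun _ c => Some (bres q c)) (gid _) (bres q)) => //=.
- by move=> w c _; exists (bres q c).
- by move=> g w c _; rewrite gfunE.
- by move=> d s sP; exists d => // c /sP [b -> <-].
- by move=> w c b e [e1]; exists c.
Qed.

Lemma tr_tmap X Y Z (t : ghom Y Z) (p : bispan X Y) (x : R X) :
  Tr t (tmap p x) = tmap (Bispan (bres p) (bnorm p) (gcomp t (btr p))) x.
Proof.
apply: tmap_bcomp; apply: (@bcomp_iso _ _ _ _ (btr_map t) p
  (Bispan (bres p) (bnorm p) (gcomp t (btr p))) (btr p) (fun w _ => Some w)
  (gcomp (btr p) (bnorm p)) (gid _)) => //=.
- by move=> w c ->; exists w.
- by move=> w w' _ /(_ _ erefl) [].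
- move=> d s sP; have [b sb bd] := sP d erefl.
  by exists b => // c ->; rewrite sb.
- by move=> w c a e [e1]; exists a; rewrite e e1.
Qed.

Lemma norm_tmap X A Y Z (r : ghom A X) (f : ghom A Y) (h : ghom Y Z) (x : R X) :
  Nm h (tmap (Bispan r f (gid Y)) x) = tmap (Bispan r (gcomp h f) (gid Z)) x.
Proof.
apply: tmap_bcomp; apply: (@bcomp_iso _ _ _ _ (bnorm_map h) (Bispan r f (gid Y))
  (Bispan r (gcomp h f) (gid Z)) (gid Z) (fun _ c => Some c) f (gid A)) => //=.
- by move=> w c _; exists c.
- by move=> d s sP; exists d => // c /sP [b -> ->].
- by move=> w c a e [e1]; exists a; rewrite -e e1.
Qed.

Lemma tmap_decomp X Y (p : bispan X Y) (x : R X) :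
  tmap p x = Tr (btr p) (Nm (bnorm p) (Res (bres p) x)).
Proof. by rewrite tmap_res tr_tmap; apply: tmap_iso; exists (gid _), (gid _); split=> //; exists id. Qed.

Lemma norm_comp X Y Z (h : ghom Y Z) (f : ghom X Y) (x : R X) :
  Nm h (Nm f x) = Nm (gcomp h f) x.
Proof. exact: norm_tmap. Qed.

Lemma res_comp X Y Z (f : ghom Y Z) (h : ghom X Y) (z : R Z) :
  Res h (Res f z) = Res (gcomp f h) z.
Proof. exact: tmap_res. Qed.

Lemma norm_ext X Y (f f' : ghom X Y) (x : R X) : f =1 f' -> Nm f x = Nm f' x.
Proof.
move=> ff'; apply: tmap_iso; exists (gid _), (gid _).
by split=> //= *; rewrite ?ff' //; exists id.
Qed.

Lemma res_ext X Y (f f' : ghom X Y) (y : R Y) : f =1 f' -> Res f y = Res f' y.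
Proof.
move=> ff'; apply: tmap_iso; exists (gid _), (gid _).
by split=> //= *; rewrite ?ff' //; exists id.
Qed.

Lemma res_id X (f : ghom X X) (x : R X) : f =1 id -> Res f x = x.
Proof. by move=> fi; rewrite (res_ext (f' := gid X)) //; exact: tmap_id. Qed.

Lemma norm_id X (f : ghom X X) (x : R X) : f =1 id -> Nm f x = x.
Proof. by move=> fi; rewrite (norm_ext (f' := gid X)) //; exact: tmap_id. Qed.

Lemma norm_bij X Y (f : ghom X Y) (k : ghom Y X) (x : R X) :
  cancel f k -> cancel k f -> Nm f x = Res k x.
Proof.
move=> fK kK; apply: tmap_iso; exists f, (gid Y); split=> //=; last by exists id.
by exists k.
Qed.

(** Base change of a norm along a pullback square, given by its universal property on points so that any
    model of the pullback can be used. *)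
Lemma res_norm P X Y Y' (f : ghom Y' Y) (h : ghom X Y) (p1 : ghom P Y') (p2 : ghom P X)
    (x : R X) :
  (forall z, f (p1 z) = h (p2 z)) ->
  (forall z z', p1 z = p1 z' -> p2 z = p2 z' -> z = z') ->
  (forall y a, f y = h a -> exists z, p1 z = y /\ p2 z = a) ->
  Res f (Nm h x) = Nm p1 (Res p2 x).
Proof.
move=> e pinj psurj; rewrite tmap_res.
apply: tmap_bcomp; apply: (@bcomp_iso _ _ _ _ (bres_map f) (bnorm_map h)
  (Bispan (gcomp p2 (gid P)) p1 (gid Y')) (gid Y') (fun _ c => Some (f c)) p1 p2) => //=.
- by move=> w c _; exists (f c).
- by move=> g w c _; rewrite gfunE.
- by move=> d s sP; exists d => // c /sP [b -> <-].
- by move=> z; rewrite e.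
- by move=> z z' e1 _ e2; exact: pinj.
- by move=> w c a <- [/psurj [z [<- <-]]]; exists z.
Qed.

Lemma tpair_res X Y (x : R X) (y : R Y) :
  Res (ginl X Y) (tpair x y) = x /\ Res (ginr X Y) (tpair x y) = y.
Proof. by have [] := svalP (cid (tmap_prod x y)). Qed.

Lemma tpair_uniq X Y (z z' : R (gsum X Y)) :
  Res (ginl X Y) z = Res (ginl X Y) z' -> Res (ginr X Y) z = Res (ginr X Y) z' -> z = z'.
Proof.
move=> e1 e2; have [w [_ wu]] := tmap_prod (Res (ginl X Y) z') (Res (ginr X Y) z').
by rewrite -(wu z) ?(wu z').
Qed.

Lemma tpair_eta X Y (z : R (gsum X Y)) : tpair (Res (ginl X Y) z) (Res (ginr X Y) z) = z.
Proof. by have [e1 e2] := tpair_res (Res (ginl X Y) z) (Res (ginr X Y) z); apply: tpair_uniq. Qed.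

Lemma res_copair X Y Z (f : ghom X Z) (h : ghom Y Z) (z : R Z) :
  Res (gcopair f h) z = tpair (Res f z) (Res h z).
Proof. by rewrite -[LHS]tpair_eta !res_comp; congr tpair; apply: res_ext. Qed.

Definition gsummap X X' Y Y' (f : ghom X X') (h : ghom Y Y') :
    ghom (gsum X Y) (gsum X' Y') :=
  gcopair (gcomp (ginl X' Y') f) (gcomp (ginr X' Y') h).

Lemma res_summap X X' Y Y' (f : ghom X X') (h : ghom Y Y') (x : R X') (y : R Y') :
  Res (gsummap f h) (tpair x y) = tpair (Res f x) (Res h y).
Proof. by rewrite res_copair -!res_comp; have [-> ->] := tpair_res x y. Qed.

Lemma norm_summap X X' Y Y' (f : ghom X X') (h : ghom Y Y') (x : R X) (y : R Y) :
  Nm (gsummap f h) (tpair x y) = tpair (Nm f x) (Nm h y).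
Proof.
have [e1 e2] := tpair_res (Nm f x) (Nm h y); have [e1' e2'] := tpair_res x y.
apply: tpair_uniq; rewrite ?e1 ?e2.
  rewrite (res_norm (p1 := f) (p2 := ginl X Y)) ?e1' //=; first by move=> z z' _ [].
  by move=> a [b|b] // [->]; exists b.
rewrite (res_norm (p1 := h) (p2 := ginr X Y)) ?e2' //=; first by move=> z z' _ [].
by move=> a [b|b] // [->]; exists b.
Qed.

(** The norm along a fold map is by definition the product. *)
Lemma norm_copair X Y Z (f : ghom X Z) (h : ghom Y Z) (x : R X) (y : R Y) :
  Nm (gcopair f h) (tpair x y) = tmul (Nm f x) (Nm h y).
Proof. by rewrite /tmul -norm_summap norm_comp; apply: norm_ext => -[]. Qed.

Lemma res_mul X Y (f : ghom X Y) (x y : R Y) :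
  Res f (tmul x y) = tmul (Res f x) (Res f y).
Proof.
rewrite /tmul -res_summap; apply: res_norm => /= [[z|z]|[z|z] [z'|z']|y' [a|a] <-] //=.
- by move=> ->.
- by move=> ->.
- by exists (inl y').
- by exists (inr y').
Qed.

Lemma norm_empty X (f : ghom (gempty G) X) (x : R (gempty G)) : Nm f x = tone R X.
Proof. by rewrite (tmap_empty x); apply: norm_ext => -[]. Qed.

Lemma res_one X Y (f : ghom X Y) : Res f (tone R Y) = tone R X.
Proof.
by rewrite /tone (res_norm (p1 := gof_empty X) (p2 := gid _)) ?norm_empty // => -[].
Qed.

Lemma tmulC X (x y : R X) : tmul x y = tmul y x.
Proof.
pose sw X Y : ghom (gsum X Y) (gsum Y X) := gcopair (ginr Y X) (ginl Y X).
have e : tpair x y = Nm (sw X X) (tpair y x).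
  rewrite (norm_bij (k := sw X X)); try by case.
  by rewrite res_copair; have [-> ->] := tpair_res y x.
by rewrite /tmul e norm_comp; apply: norm_ext => -[].
Qed.

Lemma tmul1 X (x : R X) : tmul x (tone R X) = x.
Proof.
have := norm_copair (gid X) (gof_empty X) x 0.
have [e _] := tpair_res x (0 : R (gempty G)).
rewrite norm_empty [Nm (gid X) x]tmap_id => <-.
rewrite (norm_bij (k := ginl X (gempty G))) //; last by case.
Qed.

Lemma tmulA X (x y z : R X) : tmul x (tmul y z) = tmul (tmul x y) z.
Proof.
have e1 : tmul x (tmul y z) = Nm (gcopair (gid X) (gfold X)) (tpair x (tpair y z)).
  by rewrite norm_copair [Nm (gid X) x]tmap_id.
have e2 : tmul (tmul x y) z = Nm (gcopair (gfold X) (gid X)) (tpair (tpair x y) z).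
  by rewrite norm_copair [Nm (gid X) z]tmap_id.
pose f : ghom (gsum X (gsum X X)) (gsum (gsum X X) X) :=
  gcopair (gcomp (ginl _ _) (ginl _ _)) (gcopair (gcomp (ginl _ _) (ginr _ _)) (ginr _ _)).
pose k : ghom (gsum (gsum X X) X) (gsum X (gsum X X)) :=
  gcopair (gcopair (ginl _ _) (gcomp (ginr _ _) (ginl _ _))) (gcomp (ginr _ _) (ginr _ _)).
have e3 : tpair (tpair x y) z = Nm f (tpair x (tpair y z)).
  rewrite (norm_bij (k := k)); try by repeat case.
  rewrite !res_copair -!res_comp.
  have [-> ->] := tpair_res x (tpair y z).
  by have [-> ->] := tpair_res y z.
by rewrite e1 e2 e3 norm_comp; apply: norm_ext => -[|[]].
Qed.

Lemma res_tr P X Y Y' (f : ghom Y' Y) (h : ghom X Y) (p1 : ghom P Y') (p2 : ghom P X)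
    (x : R X) :
  (forall z, f (p1 z) = h (p2 z)) ->
  (forall z z', p1 z = p1 z' -> p2 z = p2 z' -> z = z') ->
  (forall y a, f y = h a -> exists z, p1 z = y /\ p2 z = a) ->
  Res f (Tr h x) = Tr p1 (Res p2 x).
Proof.
move=> e pinj psurj; rewrite tr_tmap.
apply: tmap_bcomp; apply: (@bcomp_iso _ _ _ _ (bres_map f) (btr_map h)
  (Bispan (gcomp p2 (gid P)) (gid P) (gcomp p1 (gid P))) p1 (fun w _ => Some (p2 w)) p1 p2) => //=.
- by move=> w c ->; exists (p2 w).
- by move=> g w c _; rewrite gfunE.
- by move=> w w' e1 /(_ _ erefl) [e2]; exact: pinj.
- move=> d s sP; have [a sa ad] := sP d erefl.
  have [z [z1 z2]] := psurj _ _ (esym ad).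
  by exists z => // c ->; rewrite z2 sa.
- by move=> w c a e1 [e2]; exists w; rewrite -e1 e2.
Qed.

Lemma tpair_tr X Y (f : ghom X Y) (y : R Y) (x : R X) :
  tpair y (Tr f x) = Tr (gsummap (gid Y) f) (tpair y x).
Proof.
have [e1 e2] := tpair_res y (Tr f x); have [e1' e2'] := tpair_res y x.
apply: tpair_uniq; rewrite ?e1 ?e2.
  rewrite (res_tr (p1 := gid Y) (p2 := ginl Y X)) ?e1' //=.
  - by rewrite [RHS]tmap_id.
  - by move=> b [a|a] // [->]; exists a.
rewrite (res_tr (p1 := f) (p2 := ginr Y X)) ?e2' //=.
  by move=> z z' _ [].
by move=> b [a|a] // [->]; exists a.
Qed.

(** The distributive law for the fold map of Y: a section over y of id + f : Y + X -> Y + Y along the fold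
    consists of y itself on the left and of a point x over y on the right, so that these sections form X. *)
Lemma norm_fold_tr X Y (f : ghom X Y) (z : R (gsum Y X)) :
  Nm (gfold Y) (Tr (gsummap (gid Y) f) z) =
  Tr f (Nm (gfold X) (Res (gsummap f (gid X)) z)).
Proof.
rewrite -(tmap_decomp (Bispan (gsummap f (gid X)) (gfold X) f)).
pose sec (x : X) (c : gsum Y Y) : option (gsum Y X) :=
  match c with inl y => Some (inl y) | inr _ => Some (inr x) end.
apply: tmap_bcomp; apply: (@bcomp_iso _ _ _ _ (bnorm_map (gfold Y))
  (btr_map (gsummap (gid Y) f)) (Bispan (gsummap f (gid X)) (gfold X) f)
  f sec (gsummap f f) (gsummap f (gid X))) => //=.
- by move=> x [y|y] /= e; [exists (inl y) | exists (inr x); rewrite //= e].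
- by move=> g x [y|y].
- by move=> x x' _ /(_ (inr (f x)) erefl) [].
- move=> d s sP; have [[y|x] sx //= [fx]] := sP (inr d) erefl.
  exists x => // -[y|y] /= yd; last by rewrite yd sx.
  by have [[y'|x'] -> //= [->]] := sP (inl y) yd.
- by case.
- by case.
- by case=> x [] x' //= -> .
- move=> x [y|y] [y'|x'] //= yx []; first by move=> yy'; exists (inl x); rewrite -yy' yx.
  by move=> xx'; exists (inr x); rewrite -xx' yx.
Qed.

(** The product is the norm along the fold map, so this is an instance of the distributive law. *)
Lemma frobenius X Y (f : ghom X Y) (y : R Y) (x : R X) :
  tmul y (Tr f x) = Tr f (tmul (Res f y) x).
Proof.
by rewrite /tmul tpair_tr norm_fold_tr res_summap [Res (gid X) x]tmap_id.
Qed.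

End TambaraMaps.

(** * Elements in a fixed ratio *)

Section Ratios.
Variable N : nat.

Lemma morph_zero (A B : zmodType) (g : A -> B) : {morph g : x y / x + y} -> g 0 = 0.
Proof. by move=> gD; have /eqP := gD 0 0; rewrite addr0 -subr_eq subrr eq_sym => /eqP. Qed.

Lemma morph_mulrz (A B : zmodType) (g : A -> B) (x : A) (a : int) :
  {morph g : x y / x + y} -> g (x *~ a) = g x *~ a.
Proof.
move=> gD; have gn k : g (x *+ k) = g x *+ k.
  by elim: k => [|k IH]; rewrite ?(morph_zero gD) // !mulrS gD IH.
case: a => k; first by rewrite -!pmulrn.
rewrite NegzE !mulrNz -!pmulrn.
by apply/eqP; rewrite -addr_eq0 -gn -gD addNr (morph_zero gD).
Qed.

Lemma morph_mulrn (A B : zmodType) (g : A -> B) (x : A) k :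
  {morph g : x y / x + y} -> g (x *+ k) = g x *+ k.
Proof. by move=> gD; rewrite !pmulrn (morph_mulrz _ _ gD). Qed.

(** Both x/e and y/u are the fraction a / N^j. If e generates A up to division by powers of N, this says that
    y is the image of x under the additive map with e |-> u, and it makes sense before such a map is known
    to exist. *)
Definition same_ratio (A B : zmodType) (e x : A) (u y : B) : Prop :=
  exists j (a : int), x *+ N ^ j = e *~ a /\ y *+ N ^ j = u *~ a.

Definition torsion_free (A : zmodType) (e : A) : Prop := forall a : int, e *~ a = 0 -> a = 0.

Definition has_ratio (A : zmodType) (e x : A) : Prop := exists j (a : int), x *+ N ^ j = e *~ a.

Variables (A B : zmodType).
Implicit Types (x e : A) (y u : B).

Lemma mulrn_expn_inj j : injective (fun y => y *+ N) -> injective (fun y => y *+ N ^ j).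
Proof.
move=> iN; elim: j => [|j IH] y y'; first by rewrite !expn0.
by rewrite /= !expnSr !mulrnA => /iN /IH.
Qed.

Lemma mulrn_expn_surj j y : (forall y, exists y', y' *+ N = y) -> exists y', y' *+ N ^ j = y.
Proof.
move=> sN; elim: j y => [|j IH] y; first by exists y.
by have [y' <-] := sN y; have [z <-] := IH y'; exists z; rewrite expnSr mulrnA.
Qed.

Lemma mulrz_mulrn (C : zmodType) (c : C) (a : int) k : (c *~ a) *+ k = c *~ (a *+ k).
Proof. by elim: k => [|k IH]; rewrite ?mulr0n ?mulr0z // !mulrS mulrzDr IH. Qed.

(** Two fractions a / N^j = b / N^k for x satisfy a N^k = b N^j because e is torsion-free, so that
    N^(j+k) y and N^(j+k) y' agree. *)
Lemma same_ratio_uniq e x u y y' :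
  torsion_free e -> injective (fun y => y *+ N) ->
  same_ratio e x u y -> same_ratio e x u y' -> y = y'.
Proof.
move=> et iN [j [a [xa ya]]] [k [b [xb yb]]].
have ab : a *+ N ^ k = b *+ N ^ j.
  apply/eqP; rewrite -subr_eq0; apply/eqP; apply: et; rewrite mulrzBr.
  by rewrite -!mulrz_mulrn -xa -xb -!mulrnA mulnC subrr.
apply: (mulrn_expn_inj (j := j + k)) => //=; rewrite expnD mulrnA ya mulrz_mulrn ab.
by rewrite mulnC mulrnA yb mulrz_mulrn.
Qed.

Lemma same_ratio_ex e x u :
  has_ratio e x -> (forall y, exists y', y' *+ N = y) -> exists y : B, same_ratio e x u y.
Proof.
move=> [j [a xa]] sN; have [y ya] := mulrn_expn_surj j (u *~ a) sN.
by exists y, j, a.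
Qed.

Lemma same_ratio_refl e (u : B) : same_ratio e e u u.
Proof. by exists 0%N, 1; rewrite expn0. Qed.

Lemma same_ratioD e x x' u y y' :
  same_ratio e x u y -> same_ratio e x' u y' -> same_ratio e (x + x') u (y + y').
Proof.
move=> [j [a [xa ya]]] [k [b [xb yb]]].
exists (j + k)%N, (a *+ N ^ k + b *+ N ^ j).
rewrite !mulrzDr !mulrnDl !expnD !(mulrnA x) !(mulrnA y) xa ya.
by rewrite ![(_ ^ j * _)%N]mulnC !mulrnA xb yb !mulrz_mulrn.
Qed.

(** Fractions multiply; this is how multiplicativity of maps defined by ratios is obtained. *)
Lemma same_ratio_trans e x x' u y y' :
  same_ratio e x u y -> same_ratio x x' y y' -> same_ratio e x' u y'.
Proof.
move=> [j [a [xa ya]]] [k [b [xb yb]]]; exists (k + j)%N, (a * b).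
by rewrite !expnD !mulrnA xb yb !pmulrn ![_ *~ b *~ _]mulrzAC -!pmulrn xa ya -!mulrzA.
Qed.

End Ratios.

Lemma same_ratio_morph N (A B A' B' : zmodType) (g : A -> A') (h : B -> B') e x u y :
  {morph g : x y / x + y} -> {morph h : x y / x + y} ->
  same_ratio N e x u y -> same_ratio N (g e) (g x) (h u) (h y).
Proof.
move=> gD hD [j [a [xa ya]]]; exists j, a.
by rewrite -(morph_mulrn _ _ gD) -(morph_mulrn _ _ hD) xa ya (morph_mulrz _ _ gD) (morph_mulrz _ _ hD).
Qed.

(** * Maps of Tambara functors determined at the free orbit *)

Section TambaraRing.
Variables (G : finGroupType) (R : tambara G).
Implicit Types X Y Z : gset G.
Local Notation Res f := (tmap (t := R) (bres_map f)).
Local Notation Nm f := (tmap (t := R) (bnorm_map f)).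
Local Notation Tr f := (tmap (t := R) (btr_map f)).
Local Notation U := (underlying R).

Lemma mres_underlying X Y (f : ghom X Y) (y : R Y) : mres (M := U) f y = Res f y.
Proof. exact: mackey_of_spansE. Qed.

Lemma mtr_underlying X Y (f : ghom X Y) (x : R X) : mtr (M := U) f x = Tr f x.
Proof. exact: mackey_of_spansE. Qed.

Lemma resD X Y (f : ghom X Y) : {morph Res f : x y / x + y}.
Proof. exact: (@smapD G R _ _ (res_span f)). Qed.

Lemma tr_fold X (z : R (gsum X X)) : Tr (gfold X) z = Res (ginl X X) z + Res (ginr X X) z.
Proof. exact: tmap_add. Qed.

(** Addition is a transfer along a fold map, hence distributivity is Frobenius reciprocity for that map. *)
Lemma tmulDr X (x : R X) : {morph tmul x : y z / y + z}.
Proof.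
move=> y z; have [e1 e2] := tpair_res y z.
have -> : y + z = Tr (gfold X) (tpair y z) by rewrite tr_fold e1 e2.
rewrite frobenius tr_fold !res_mul !res_comp e1 e2.
by rewrite !(@res_id _ _ X).
Qed.

(** A G-set over G/e is a disjoint union of copies of G/e, each mapped isomorphically, and norms turn
    disjoint unions into products. *)
Lemma norm_to_free X (h : ghom X (gfree G)) (x : R X) :
  Nm h x = \big[@tmul G R _/tone R _]_(a <- enum [pred a | h a == 1%g]) Res (orbit_map a) x.
Proof.
have bh := orbits_map_bij (free_basis_fibre h).
have hr : all [pred a | h a == 1%g] (enum [pred a | h a == 1%g]).
  by apply/allP => a; rewrite mem_enum.
have [k [fK kK]] := ghom_inv bh.
have -> : Nm h x = Nm (gcomp h (orbits_map (enum [pred a | h a == 1%g])))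
    (Res (orbits_map (enum [pred a | h a == 1%g])) x).
  rewrite -norm_comp (norm_bij _ fK kK) res_comp res_id // => a; exact: kK.
move: (enum _) hr => r {bh k fK kK}.
elim: r => [|a r IH] /=; first by rewrite big_nil norm_empty.
case/andP => /eqP ha /IH {}IH; rewrite big_cons -IH res_copair.
have hid : gcomp h (orbit_map a) =1 id by move=> g; rewrite /= gfunE /= ha mulg1.
rewrite -[X in tmul X _](norm_id (Res (orbit_map a) x) hid).
by rewrite -norm_copair; apply: norm_ext => -[].
Qed.

Lemma res_free_class X : Res (gto_point X) (free_class R) = Tr (gsnd (gfree G) X) (tone R _).
Proof.
rewrite /free_class /tclass (res_tr (p1 := gsnd (gfree G) X) (p2 := gfst (gfree G) X)) //=.
- by rewrite res_one.
- by move=> [g x] [g' x'] /= -> ->.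
- by move=> y a _; exists (a, y).
Qed.

(** tr (res x) = tr (res x * 1) = x * tr 1, and tr 1 is the restriction of [G/e]. *)
Lemma free_span_underlying X (x : R X) :
  mmap (m := U) (vof (free_span X)) x = tmul x (Res (gto_point X) (free_class R)).
Proof.
rewrite mmap_span mres_underlying mtr_underlying res_free_class frobenius.
by rewrite tmul1.
Qed.

(** On R(G/G) the multiplication by [G/e] hits 1 exactly when [G/e] is a unit; conversely multiplication by
    the restriction of an inverse inverts it on every R(X). *)
Lemma tunit_free_inverted : tunit (free_class R) <-> free_inverted U.
Proof.
split=> [[v uv] X|/(_ (gpoint G)) [h _ hK]].
  have e : tmul (Res (gto_point X) (free_class R)) (Res (gto_point X) v) = tone R X.
    by rewrite -res_mul uv res_one.
  exists (fun x => tmul x (Res (gto_point X) v)) => x; rewrite free_span_underlying.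
    by rewrite -tmulA e tmul1.
  by rewrite -tmulA [tmul (Res _ v) _]tmulC e tmul1.
exists (h (tone R _)).
rewrite tmulC -{2}(hK (tone R _)) free_span_underlying res_id //; by case.
Qed.

(** Every value embeds into a product of copies of the value at G/e. *)
Definition separated : Prop := forall X (x y : R X),
  (forall a, Res (orbit_map a) x = Res (orbit_map a) y) -> x = y.

Lemma free_inverted_separated : free_inverted U -> separated.
Proof.
move=> Ufree X x y e; apply: (to_fixed_inj Ufree); apply: fp_ext => a.
by rewrite !to_fixedE !mres_underlying.
Qed.

Lemma res_orbit_tr X Y (h : ghom X Y) (x : R X) y :
  Res (orbit_map y) (Tr h x) = \sum_(a | h a == y) Res (orbit_map a) x.
Proof.
rewrite -mres_underlying -mtr_underlying -to_fixedE to_fixed_span fp_spanE.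
by apply: eq_bigr => a _; rewrite to_fixedE mres_underlying.
Qed.

End TambaraRing.

Section TambaraHomCriterion.
Variables (G : finGroupType) (R S : tambara G) (f : forall X, R X -> S X).
Implicit Types X Y Z : gset G.
Hypothesis Ssep : separated S.
Hypothesis f_res : forall X Y (h : ghom X Y) y,
  f (tmap (bres_map h) y) = tmap (bres_map h) (f y).
Hypothesis fD : {morph f (X := gfree G) : x y / x + y}.
Hypothesis fM : {morph f (X := gfree G) : x y / tmul x y}.
Hypothesis f1 : f (tone R (gfree G)) = tone S (gfree G).

(** After restriction to an orbit, a transfer is a sum of restrictions. *)
Lemma tambara_hom_tr X Y (h : ghom X Y) x : f (tmap (btr_map h) x) = tmap (btr_map h) (f x).
Proof.
apply: Ssep => y; rewrite -f_res !res_orbit_tr (big_morph _ fD (morph_zero fD)).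
by apply: eq_bigr => a _; rewrite f_res.
Qed.

(** After restriction to an orbit, a norm is a product of restrictions. *)
Lemma tambara_hom_norm X Y (h : ghom X Y) x : f (tmap (bnorm_map h) x) = tmap (bnorm_map h) (f x).
Proof.
have pb (T : tambara G) y (z : T X) : tmap (bres_map (orbit_map y)) (tmap (bnorm_map h) z) =
    tmap (bnorm_map (gpull1 (orbit_map y) h)) (tmap (bres_map (gpull2 (orbit_map y) h)) z).
  apply: res_norm => [w|[[g a] w] [[g' a'] w'] /= gg' aa'|g a e].
  - exact/eqP/(valP w).
  - by apply: val_inj; rewrite /= gg' aa'.
  - by have /eqP e' := e; exists (exist _ (g, a) e').
apply: Ssep => y; rewrite -f_res !pb !norm_to_free (big_morph _ fM f1).
by apply: eq_bigr => a _; rewrite !f_res.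
Qed.

(** Both sides of each identity can be compared after restriction to orbits, where polynomial maps are sums
    of products of restrictions. *)
Lemma tambara_hom_criterion : is_tambara_hom f.
Proof. by move=> X Y p x; rewrite tmap_decomp tambara_hom_tr tambara_hom_norm f_res -tmap_decomp. Qed.

End TambaraHomCriterion.

Section TambaraHoms.
Variables (G : finGroupType) (R S : tambara G) (f : forall X, R X -> S X).
Hypothesis fhom : is_tambara_hom f.

Lemma tambara_hom_tpair (X Y : gset G) (x : R X) (y : R Y) : f (tpair x y) = tpair (f x) (f y).
Proof.
have [e1 e2] := tpair_res x y; have [e3 e4] := tpair_res (f x) (f y).
by apply: tpair_uniq; rewrite -fhom ?e1 ?e2 ?e3 ?e4.
Qed.

Lemma tambara_homM (X : gset G) : {morph f (X := X) : x y / tmul x y}.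
Proof. by move=> x y; rewrite /tmul fhom tambara_hom_tpair. Qed.

Lemma tambara_homD (X : gset G) : {morph f (X := X) : x y / x + y}.
Proof.
move=> x y; have [e1 e2] := tpair_res x y; have [e3 e4] := tpair_res (f x) (f y).
have -> : x + y = tmap (btr_map (gfold X)) (tpair x y) by rewrite tr_fold e1 e2.
by rewrite fhom tambara_hom_tpair tr_fold e3 e4.
Qed.

Lemma tambara_hom1 (X : gset G) : f (tone R X) = tone S X.
Proof. by rewrite /tone fhom (tmap_empty (f 0)). Qed.

Lemma tambara_hom_free_class : f (free_class R) = free_class S.
Proof. by rewrite /free_class /tclass fhom tambara_hom1. Qed.

End TambaraHoms.

Section FromUnit.
Variables (G : finGroupType) (R S : tambara G).
Implicit Types X Y Z : gset G.
Local Notation n := #|{: G}|.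
Local Notation oneR := (tone R (gfree G)).
Local Notation oneS := (tone S (gfree G)).
Hypothesis Rgen : forall x, has_ratio n oneR x.
Hypothesis Sfree : free_inverted (underlying S).

(** At G/e both maps send x = a / |G|^j to the only element with that ratio to 1. *)
Lemma tambara_hom_unique (f f' : forall X, R X -> S X) :
  is_tambara_hom f -> is_tambara_hom f' -> forall X x, f X x = f' X x.
Proof.
move=> fh fh' X x; apply: (free_inverted_separated Sfree) => a; rewrite -fh -fh'.
move: (tmap _ x) => z; have [j [b zb]] := Rgen z.
apply: (mulrn_expn_inj (card_inj Sfree) (j := j)) => /=.
rewrite -(morph_mulrn _ _ (tambara_homD fh (X := gfree G))).
rewrite -(morph_mulrn _ _ (tambara_homD fh' (X := gfree G))).
rewrite zb (morph_mulrz _ _ (tambara_homD fh (X := gfree G))).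
by rewrite (morph_mulrz _ _ (tambara_homD fh' (X := gfree G))) !tambara_hom1.
Qed.

Hypothesis Rtf : torsion_free oneR.

Lemma unit_ratio_ex (x : R (gfree G)) : exists y, same_ratio n oneR x oneS y.
Proof. exact: same_ratio_ex (Rgen x) (card_surj Sfree). Qed.

(** The ring homomorphism at G/e that is forced by 1 |-> 1. *)
Definition free_hom (x : R (gfree G)) : S (gfree G) := sval (cid (unit_ratio_ex x)).

Lemma free_homP x : same_ratio n oneR x oneS (free_hom x).
Proof. exact: svalP (cid (unit_ratio_ex x)). Qed.

Lemma free_hom_uniq x y : same_ratio n oneR x oneS y -> free_hom x = y.
Proof. exact: same_ratio_uniq Rtf (card_inj Sfree) (free_homP x). Qed.

Lemma free_homD : {morph free_hom : x y / x + y}.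
Proof. by move=> x y; apply: free_hom_uniq; apply: same_ratioD; exact: free_homP. Qed.

Lemma free_hom1 : free_hom oneR = oneS.
Proof. by apply: free_hom_uniq; exact: same_ratio_refl. Qed.

Lemma free_homM : {morph free_hom : x y / tmul x y}.
Proof.
move=> x y; apply: free_hom_uniq; apply: same_ratio_trans (free_homP x) _.
rewrite -{1}(tmul1 x) -{1}(tmul1 (free_hom x)).
exact: same_ratio_morph (tmulDr x) (tmulDr (free_hom x)) (free_homP y).
Qed.

Lemma free_hom_res (h : ghom (gfree G) (gfree G)) x :
  free_hom (tmap (bres_map h) x) = tmap (bres_map h) (free_hom x).
Proof.
apply: free_hom_uniq; rewrite -(res_one R h) -(res_one S h).
exact: same_ratio_morph (@resD _ _ _ _ h) (@resD _ _ _ _ h) (free_homP x).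
Qed.

(** The equivariant family of the images of the restrictions of x comes from an element over X because
    [to_fixed] is surjective. *)
Lemma free_hom_values X (x : R X) : exists y : S X,
  forall a, tmap (bres_map (orbit_map a)) y = free_hom (tmap (bres_map (orbit_map a)) x).
Proof.
pose v : {ffun X -> weyl (underlying S)} :=
  [ffun a => free_hom (tmap (bres_map (orbit_map a)) x)].
have vE : v \in @equivariant G (weyl (underlying S)) X.
  apply/equivariantP => g a; rewrite !ffunE.
  rewrite -[RHS]/(mres (M := underlying S) (gfree_rmul g) _) mres_underlying -free_hom_res.
  congr free_hom; rewrite res_comp; apply: res_ext => h /=.
  by rewrite -gactM.
have [y yv] := to_fixed_surj Sfree (FPType vE); exists y => a.
by rewrite -mres_underlying -to_fixedE yv /= ffunE.
Qed.

(** Applying [free_hom] to the restrictions of x along the orbit maps gives a family that comes from S(X), and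
    the resulting map satisfies the criterion. This is used from the Burnside functor to Z[1/|G|], and from
    there to the localization. *)
Lemma tambara_hom_exists : exists f : forall X, R X -> S X, is_tambara_hom f.
Proof.
pose f X (x : R X) : S X := sval (cid (free_hom_values x)).
have fE X (x : R X) a : tmap (bres_map (orbit_map a)) (f X x) =
    free_hom (tmap (bres_map (orbit_map a)) x).
  exact: svalP (cid (free_hom_values x)) a.
have Ssep := free_inverted_separated Sfree.
(* The orbit map of 1 is the identity. *)
have ff x : f (gfree G) x = free_hom x.
  by have := fE _ x (1%g : gfree G); rewrite !(res_id _ (@orbit_map1 G)).
exists f; apply: tambara_hom_criterion => //.
- move=> X Y h y; apply: Ssep => a; rewrite fE !res_comp.
  transitivity (free_hom (tmap (bres_map (orbit_map (h a))) y)).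
    by congr free_hom; apply: res_ext => g; rewrite /= gfunE.
  by rewrite -fE; apply: res_ext => g; rewrite /= gfunE.
- by move=> x y; rewrite !ff free_homD.
- by move=> x y; rewrite !ff free_homM.
- by rewrite ff free_hom1.
Qed.

End FromUnit.

(** * The constant Tambara functor of inverted integers *)

Section InvertedIntegers.
Variable n : nat.
Hypothesis n_gt0 : (0 < n)%N.

Lemma zinv_valD : {morph @zinv_val n : p q / p + q}.
Proof. by []. Qed.

Lemma zinv_val_inj : injective (@zinv_val n).
Proof. exact: val_inj. Qed.

Lemma zinv_ratio (q : zinv n) : has_ratio n 1 q.
Proof.
have /zinvP[k /intrP[a ka]] := zinv_valP q; exists k, a; apply: zinv_val_inj.
rewrite (morph_mulrn _ _ zinv_valD) (morph_mulrz _ _ zinv_valD) -[RHS]/(1 *~ a) -ka.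
by rewrite -[LHS]mulr_natl natrX.
Qed.

Lemma zinv_torsion_free : torsion_free (1 : zinv n).
Proof.
move=> a /(congr1 (@zinv_val n)); rewrite (morph_mulrz _ _ zinv_valD) => /eqP.
by rewrite intr_eq0 => /eqP.
Qed.

Lemma zinv_card_inj : injective (fun q : zinv n => q *+ n).
Proof.
move=> q q' /= /(congr1 (@zinv_val n)); rewrite !(morph_mulrn _ _ zinv_valD) => /eqP.
rewrite -subr_eq0 -mulrnBl mulrn_eq0 eqn0Ngt n_gt0 subr_eq0 => /eqP.
exact: zinv_val_inj.
Qed.

Lemma zinv_card_surj (q : zinv n) : exists q', q' *+ n = q.
Proof.
have n0 : n%:R != 0 :> rat by rewrite pnatr_eq0 -lt0n.
have H : zinv_val q / n%:R \in zinv_pred n.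
  apply/zinvP; have /zinvP[k qk] := zinv_valP q; exists k.+1.
  by rewrite exprSr -mulrA [n%:R * (_ / _)]mulrC divfK.
exists (Zinv H); apply: zinv_val_inj; rewrite (morph_mulrn _ _ zinv_valD) /= -[LHS]mulr_natl.
by rewrite mulrC divfK.
Qed.

End InvertedIntegers.

Section FixedZinv.
Variable G : finGroupType.
Implicit Types X Y Z : gset G.
Local Notation n := #|{: G}|.
Local Notation zn := (zinv #|{: G}|).
Local Notation F := (fp_tambara (gring_trivial G (zinv #|{: G}|))).

Lemma card_G_gt0 : (0 < n)%N.
Proof. by apply/card_gt0P; exists 1%g. Qed.

Lemma fpt_ext X (x y : F X) : (forall a, (x a : zn) = y a) -> x = y.
Proof. by move=> e; apply: val_inj; apply/ffunP. Qed.

(** G acts transitively on G/e. *)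
Lemma fpt_free_ext (x y : F (gfree G)) : (x 1%g : zn) = y 1%g -> x = y.
Proof.
move=> e; apply: fpt_ext => a.
have xE := fpE x a (1%g : gfree G); have yE := fpE y a (1%g : gfree G).
by move: xE yE; rewrite /= mulg1 => -> ->.
Qed.

Lemma fpt_addE X (x y : F X) a : ((x + y) a : zn) = x a + y a.
Proof. by rewrite ffunE. Qed.

Lemma fpt_oneE X a : (tone F X a : zn) = 1.
Proof. by rewrite ffunE /fpt_fun big_pred1_eq big_pred0 // => -[]. Qed.

Lemma fpt_mulE X (x y : F X) a : (tmul x y a : zn) = (x a : zn) * y a.
Proof.
have [e1 e2] := tpair_res x y.
have xa : x a = tpair x y (inl a) by rewrite -{1}e1; exact: fpt_res.
have ya : y a = tpair x y (inr a) by rewrite -{1}e2; exact: fpt_res.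
by rewrite ffunE /fpt_fun big_pred1_eq big_sumType /= !big_pred1_eq xa ya.
Qed.

Definition fpt_at X (a : X) (x : F X) : zn := x a.

Lemma fpt_atD X (a : X) : {morph fpt_at a : x y / x + y}.
Proof. by move=> x y; exact: fpt_addE. Qed.

Lemma fpt_mulrnE X (x : F X) a j : ((x *+ j) a : zn) = (x a : zn) *+ j.
Proof. exact: (morph_mulrn x j (fpt_atD a)). Qed.

Lemma fpt_mulrzE X (x : F X) a (b : int) : ((x *~ b) a : zn) = (x a : zn) *~ b.
Proof. exact: (morph_mulrz x b (fpt_atD a)). Qed.

Lemma fpt_free_has_ratio (x : F (gfree G)) : has_ratio n (tone F (gfree G)) x.
Proof.
have [j [a xa]] := zinv_ratio (x 1%g : zn); exists j, a; apply: fpt_free_ext.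
by rewrite fpt_mulrnE fpt_mulrzE fpt_oneE.
Qed.

Lemma fpt_free_torsion_free : torsion_free (tone F (gfree G)).
Proof.
move=> a /(congr1 (fpt_at (1%g : gfree G))).
rewrite (morph_zero (fpt_atD _)) /fpt_at fpt_mulrzE fpt_oneE.
exact: zinv_torsion_free.
Qed.

(** The fibres of G/e x X -> X have |G| points. *)
Lemma fpt_free_span X (x : F X) :
  mmap (m := underlying F) (vof (free_span X)) x = x *+ n.
Proof.
rewrite [LHS]mackey_of_spansE; apply: fpt_ext => a.
rewrite fpt_mulrnE ffunE /fpt_fun /= -sumr_const.
transitivity (\sum_(g : G) \sum_(b : X | b == a) (x b : zn)).
  rewrite (pair_big_dep predT (fun _ b => b == a)) /=.
  by apply: eq_big => [[g b] //|[g b] _]; rewrite big_pred1_eq.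
by apply: eq_bigr => g _; rewrite big_pred1_eq.
Qed.

Lemma fpt_free_inverted : free_inverted (underlying F).
Proof.
move=> X; apply: inj_surj_bij => [x y|y].
  rewrite !fpt_free_span => e; apply: fpt_ext => a.
  by apply: (zinv_card_inj card_G_gt0); rewrite /= -!fpt_mulrnE e.
pose z : {ffun X -> gring_module (gring_trivial G zn)} :=
  [ffun a => sval (cid (zinv_card_surj card_G_gt0 (y a)))].
have zy a : (z a : zn) *+ n = y a by rewrite ffunE; case: cid.
have zE : z \in @equivariant G (gring_module (gring_trivial G zn)) X.
  by apply/equivariantP => g a; apply: (zinv_card_inj card_G_gt0); rewrite !zy (fpE y).
exists (FPType zE); rewrite fpt_free_span; apply: fpt_ext => a.
by rewrite fpt_mulrnE zy.
Qed.

End FixedZinv.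

(** * The Burnside functor and its localization *)

Section BurnsideFree.
Variables (G : finGroupType) (A : tambara G).
Hypothesis hA : is_burnside A.
Implicit Types X Y Z : gset G.
Local Notation n := #|{: G}|.
Local Notation oneA := (tone A (gfree G)).

(** A G-set over G/e is free, so its class is an integer: the cardinal of the fibre over 1. *)
Lemma tclass_free (S : over (gfree G)) :
  tclass A S = oneA *+ #|[pred a | omap S a == 1%g]|.
Proof.
rewrite -[LHS](res_id _ (@orbit_map1 G)) res_orbit_tr -sumr_const; apply: eq_bigr => a _.
exact: res_one.
Qed.

Lemma burnside_has_ratio (x : A (gfree G)) : has_ratio n oneA x.
Proof.
have [v ->] := hA.1 _ x; rewrite !tclass_free; set k := #|_|; set l := #|_|.
by exists 0%N, (k%:Z - l%:Z); rewrite expn0 mulr1n mulrzBr -!pmulrn.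
Qed.

Definition ordinal_gset k : gset G :=
  @GSet G 'I_k (fun _ i => i) (fun _ => erefl) (fun _ _ _ => erefl).

(** k is the class of k copies of G/e. If it vanishes, k copies of G/e and the empty set become isomorphic
    after adding a common G-set, and cardinals are compared. *)
Lemma burnside_torsion_free_nat k : oneA *+ k = 0 -> k = 0%N.
Proof.
pose S := Over (gfst (gfree G) (ordinal_gset k)).
pose O := Over (gof_empty (gfree G)).
have <- : tclass A S = oneA *+ k.
  rewrite tclass_free; congr (_ *+ _).
  have -> : #|[pred a | omap S a == 1%g]| = #|setX [set 1%g : G] [set: 'I_k]|.
    by apply: eq_card => -[g i]; rewrite !inE andbT.
  by rewrite cardsX cards1 cardsT card_ord mul1n.
have O0 : tclass A O = 0.
  by rewrite tclass_free eq_card0 // => -[].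
have [/= h _] := hA.2 _ (S, O) (O, O).
move=> S0; have /h [U [f bf _]] :
  tclass A S - tclass A O = tclass A O - tclass A O by rewrite S0 O0.
have card_gsum X Y : #|gsum X Y| = (#|X| + #|Y|)%N := card_sum X Y.
have /eqP : #|gsum (gsum S O) U| = #|gsum (gsum O O) U| := bij_eq_card bf.
rewrite !card_gsum eqn_add2r eqn_add2r.
have -> : #|O| = 0%N by exact: card_void.
have -> : #|S| = (n * k)%N by rewrite -[in RHS](card_ord k); exact: card_prod.
by rewrite muln_eq0 eqn0Ngt card_G_gt0 => /eqP.
Qed.

Lemma burnside_torsion_free : torsion_free oneA.
Proof.
case=> k; first by rewrite -pmulrn => /burnside_torsion_free_nat ->.
by rewrite NegzE mulrNz -pmulrn => /eqP; rewrite oppr_eq0 => /eqP /burnside_torsion_free_nat.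
Qed.

End BurnsideFree.

Section Localization.
Variables (G : finGroupType) (A L : tambara G) (l : forall X : gset G, A X -> L X).
Hypothesis hA : is_burnside A.
Hypothesis hl : is_localization (free_class A) l.
Local Notation n := #|{: G}|.
Local Notation F := (fp_tambara (gring_trivial G (zinv #|{: G}|))).

Lemma localization_tunit : tunit (free_class L).
Proof. by case: hl => lh lu _; rewrite -(tambara_hom_free_class lh). Qed.

(** The map L -> Z[1/|G|] is given by the universal property, the one back by [tambara_hom_exists]. One
    composite is the identity by the universal property of L, the other because Z[1/|G|] has no other
    endomorphism. *)
Lemma localization_iso : tambara_iso L F.
Proof.
have [lh lu lP] := hl.
have Aratio := burnside_has_ratio hA.
have Lfree : free_inverted (underlying L) by apply/tunit_free_inverted/localization_tunit.
have Ffree := @fpt_free_inverted G.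
have [r rh] := tambara_hom_exists Aratio Ffree (burnside_torsion_free hA).
have [h hh] := tambara_hom_exists (@fpt_free_has_ratio G) Lfree (@fpt_free_torsion_free G).
have ru : tunit (r _ (free_class A)).
  by rewrite (tambara_hom_free_class rh); apply/tunit_free_inverted.
have [[k kh kl] _] := lP F r rh ru.
have [_ uniq] := lP L l lh lu.
have comp_hom (P Q T : tambara G) (f : forall X, P X -> Q X) (f' : forall X, Q X -> T X) :
    is_tambara_hom f -> is_tambara_hom f' -> is_tambara_hom (fun X x => f' X (f X x)).
  by move=> fh fh' X Y p x; rewrite fh fh'.
exists k, h; split=> // X x.
  apply: (uniq (fun X x => h X (k X x)) (fun X x => x)) => //; first exact: comp_hom.
  move=> Y y; rewrite kl.
  exact: (tambara_hom_unique Aratio Lfree (comp_hom _ _ _ _ _ rh hh) lh).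
exact: (tambara_hom_unique (@fpt_free_has_ratio G) Ffree (comp_hom _ _ _ _ _ hh kh)
  (f' := fun X x => x)).
Qed.

End Localization.

(** * The box product and the action on a module *)

Section ProductSpans.
Variable G : finGroupType.
Implicit Types X Y Z : gset G.

Lemma sprod_comp X X' X'' Y Y' Y'' (u : span X X') (u' : span X' X'')
    (v : span Y Y') (v' : span Y' Y'') :
  span_iso (scomp (sprod u' v') (sprod u v)) (sprod (scomp u' u) (scomp v' v)).
Proof.
pose A := sapex (scomp (sprod u' v') (sprod u v)).
pose B := sapex (sprod (scomp u' u) (scomp v' v)).
have H (z : A) : (sright u (val z).1.1 == sleft u' (val z).2.1) &&
                 (sright v (val z).1.2 == sleft v' (val z).2.2).
  by case: z => [[[a b] [a' b']] /=].
pose f (z : A) : B := (exist _ ((val z).1.1, (val z).2.1) (proj1 (andP (H z))),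
                       exist _ ((val z).1.2, (val z).2.2) (proj2 (andP (H z)))).
have fE g z : f (gact g z) = gact g (f z) by congr pair; apply: val_inj.
exists (GHom fE) => //.
apply: inj_surj_bij => [[[[a b] [a' b']] h] [[[c d] [c' d']] h'] [] /= e1 e2 e3 e4|].
  by apply: val_inj; rewrite /= e1 e2 e3 e4.
move=> [[[a a'] ha] [[b b'] hb]].
have h : sright (sprod u v) (a, b) == sleft (sprod u' v') (a', b').
  by move: ha hb => /= /eqP -> /eqP ->.
by exists (exist _ ((a, b), (a', b')) h); congr pair; apply: val_inj.
Qed.

Lemma sprod_iso X X' Y Y' (u u' : span X X') (v v' : span Y Y') :
  span_iso u u' -> span_iso v v' -> span_iso (sprod u v) (sprod u' v').
Proof.
case=> f [f' fK fK'] [l r] [h [h' hK hK'] [l' r']].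
exists (gprodmap f h); last by split=> -[a b]; rewrite /= ?l ?r ?l' ?r'.
by exists (fun z => (f' z.1, h' z.2)) => -[a b] /=; rewrite ?fK ?hK ?fK' ?hK'.
Qed.

Lemma sprod_tr X X' Y Y' (f : ghom X X') (h : ghom Y Y') :
  span_iso (tr_span (gprodmap f h)) (sprod (tr_span f) (tr_span h)).
Proof. by apply: span_ext => -[]. Qed.

Lemma sprod_res X X' Y Y' (f : ghom X X') (h : ghom Y Y') :
  span_iso (res_span (gprodmap f h)) (sprod (res_span f) (res_span h)).
Proof. by apply: span_ext => -[]. Qed.

Lemma tr_res_bij X Y (f : ghom X Y) :
  bijective f -> span_iso (scomp (tr_span f) (res_span f)) (sid Y).
Proof.
move=> bf; apply: span_iso_trans (scomp_tr _ _) _.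
by exists f.
Qed.

End ProductSpans.

Section Pairing.
Variables (G : finGroupType) (M N : mackey G).
Implicit Types X Y Z : gset G.

(** Dinaturality of the coend is imposed for G-sets carried by ordinals; conjugating a span by the
    enumerations of its ends, which are bijective, extends it to all G-sets. *)
Lemma box_pair_map X X' Y Y' (s : span X X') (t : span Y Y') (m : M X) (n : N Y) :
  box_pair (mmap (vof s) m) (mmap (vof t) n) = mmap (vof (sprod s t)) (box_pair m n).
Proof.
rewrite mackey_of_spansE box_map_gen.
have shrunk (P : mackey G) Z Z' (w : span Z Z') (x : P Z) :
    mres (unshrink Z') (mmap (vof w) x) =
    mmap (vof (scomp (res_span (unshrink Z')) (scomp w (tr_span (unshrink Z)))))
      (mres (unshrink Z) x).
  rewrite /mres -!mmap_scomp; apply: mmap_iso.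
  apply: span_iso_trans (scompA _ _ _); apply: scomp_iso (span_iso_refl _) _.
  apply: span_iso_trans (scompA _ _ _).
  apply: span_iso_trans (span_iso_sym (scomp_id_r _)) _.
  apply: scomp_iso (span_iso_refl _) _; apply: span_iso_sym.
  exact: tr_res_bij (unshrink_bij _).
rewrite /box_pair !shrunk; apply/esym/bgen_coend.
(* The enumerations introduced on the target cancel. *)
have untr (X1 X1' : gset G) (w : span X1 X1') :
    span_iso (scomp (tr_span (unshrink X1'))
      (scomp (res_span (unshrink X1')) (scomp w (tr_span (unshrink X1)))))
    (scomp w (tr_span (unshrink X1))).
  apply: span_iso_trans (scompA _ _ _) _.
  apply: span_iso_trans (scomp_id_l _); apply: scomp_iso (span_iso_refl _).
  exact: tr_res_bij (unshrink_bij _).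
apply: span_iso_trans (shrink_span_iso _) _.
apply: span_iso_trans (scomp_iso (span_iso_refl _) (shrink_span_iso _)) _.
apply: span_iso_trans (scomp_iso (span_iso_refl _) (sprod_tr _ _)) _.
apply: span_iso_trans (sprod_comp _ _ _ _) _.
apply: span_iso_trans (sprod_iso (span_iso_sym (untr _ _ _)) (span_iso_sym (untr _ _ _))) _.
apply: span_iso_trans (span_iso_sym (sprod_comp _ _ _ _)) _.
apply: scomp_iso (span_iso_refl _).
apply: span_iso_sym; apply: span_iso_trans (shrink_span_iso _) _; exact: sprod_tr.
Qed.

Lemma box_pairDl X Y (n : N Y) : {morph (fun m : M X => box_pair m n) : x y / x + y}.
Proof. by move=> x y; rewrite /box_pair [mres _ (x + y)]mmapD bgen_addm. Qed.

End Pairing.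

Section ModuleAction.
Variables (G : finGroupType) (R : tambara G) (M : tmodule R).
Implicit Types X Y Z : gset G.

Definition box_act X Y (r : R X) (m : M Y) : M (gprod X Y) :=
  tmod_act (box_pair (M := underlying R) r m).

Lemma box_act_map X X' Y Y' (s : span X X') (t : span Y Y') (r : R X) (m : M Y) :
  box_act (smap s r) (mmap (vof t) m) = mmap (vof (sprod s t)) (box_act r m).
Proof.
have -> : smap s r = mmap (m := underlying R) (vof s) r by rewrite mackey_of_spansE.
by rewrite /box_act box_pair_map (tmod_act_hom M).2.
Qed.

Lemma box_actDl X Y (m : M Y) : {morph (fun r : R X => box_act r m) : x y / x + y}.
Proof. by move=> x y; rewrite /box_act -(tmod_act_hom M).1 -box_pairDl. Qed.

Lemma box_act_res X X' Y Y' (f : ghom X' X) (h : ghom Y' Y) (r : R X) (m : M Y) :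
  box_act (tmap (bres_map f) r) (mres h m) = mres (gprodmap f h) (box_act r m).
Proof.
by rewrite (box_act_map (res_span f) (res_span h)); apply: mmap_iso; apply/span_iso_sym/sprod_res.
Qed.

Lemma box_act_resl X X' Y (f : ghom X' X) (r : R X) (m : M Y) :
  box_act (tmap (bres_map f) r) m = mres (gprodmap f (gid Y)) (box_act r m).
Proof. by rewrite -box_act_res mres_id. Qed.

Lemma box_act_resr X Y Y' (h : ghom Y' Y) (r : R X) (m : M Y) :
  box_act r (mres h m) = mres (gprodmap (gid X) h) (box_act r m).
Proof. by rewrite -box_act_res res_id. Qed.

Lemma box_act_trl X X' Y (f : ghom X X') (r : R X) (m : M Y) :
  box_act (tmap (btr_map f) r) m = mtr (gprodmap f (gid Y)) (box_act r m).
Proof.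
rewrite -{1}[m]mmap_sid (box_act_map (tr_span f)); apply: mmap_iso.
by apply: span_iso_sym; exact: (sprod_tr f (gid Y)).
Qed.

(** The unit axiom concerns 1 over the point; 1 over X is its restriction. *)
Lemma box_act_one X Y (m : M Y) : box_act (tone R X) m = mres (gsnd X Y) m.
Proof.
rewrite -(res_one R (gto_point X)) box_act_resl [box_act _ m]tmod_unit mres_comp.
by apply: mres_ext.
Qed.

Definition gpoint_pair X : ghom X (gprod (gpoint G) X) :=
  @GHom G X (gprod (gpoint G) X) (fun x => (tt, x)) (fun _ _ => erefl).

(** The action of R(G/G) on M(X), through the isomorphism of pt x X with X. *)
Definition point_scale X (v : R (gpoint G)) (m : M X) : M X := mres (gpoint_pair X) (box_act v m).

(** Associativity of the action and u v = 1. *)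
Lemma point_scale_inv X (u v : R (gpoint G)) (m : M X) :
  tmul u v = tone R (gpoint G) -> point_scale u (point_scale v m) = m.
Proof.
move=> uv; rewrite /point_scale box_act_resr mres_comp.
pose s : ghom X (gprod (gprod (gpoint G) (gpoint G)) X) :=
  @GHom G X (gprod (gprod (gpoint G) (gpoint G)) X) (fun x => ((tt, tt), x)) (fun _ _ => erefl).
have e := tmod_assoc u v m.
transitivity (mres s (mres (gassoc _ _ _) (box_act u (box_act v m)))).
  by rewrite mres_comp; apply: mres_ext.
rewrite /box_act -e -/(box_act _ _).
have -> : text u v = tone R (gprod (gpoint G) (gpoint G)).
  rewrite -(res_one R (gto_point _)) -uv res_mul /text.
  by congr tmul; apply: res_ext => -[[] []].
by rewrite box_act_one mres_comp mres_id.
Qed.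

Lemma mres_bij X Y (f : ghom X Y) (k : ghom Y X) (m : M X) :
  cancel f k -> cancel k f -> mres k m = mtr f m.
Proof.
move=> fK kK; apply: mmap_iso; exists k; first by exists f.
by split=> //= x; rewrite kK.
Qed.

(** [G/e] is the transfer of 1, and the action of a transfer is the transfer of the action. *)
Lemma point_scale_free_class X (m : M X) :
  point_scale (free_class R) m = mmap (vof (free_span X)) m.
Proof.
rewrite /point_scale /free_class /tclass /= box_act_trl box_act_one.
rewrite (mres_bij (f := gsnd (gpoint G) X)) => [|[[] x]|x] //.
rewrite mtr_comp [RHS]mmap_span; exact: mtr_ext.
Qed.

(** A unit acts bijectively, its inverse acting by the inverse. *)
Lemma module_free_inverted : tunit (free_class R) -> free_inverted M.
Proof.
move=> [v uv] X; exists (point_scale v) => m; rewrite -point_scale_free_class; apply: point_scale_inv => //.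
by rewrite tmulC.
Qed.

End ModuleAction.

(** * The group ring acting on the value at the free orbit *)

Section InvertedScalars.
Variable n : nat.
Variable B : zmodType.
Hypothesis Binj : injective (fun b : B => b *+ n).
Hypothesis Bsurj : forall b : B, exists b', b' *+ n = b.
Implicit Types (q : zinv n) (b : B).

(** If B is uniquely divisible by n it is a Z[1/n]-module in a unique way: the fraction a / n^j acts on b as
    the solution y of n^j y = a b. *)
Definition zscal q b : B := sval (cid (same_ratio_ex b (zinv_ratio q) Bsurj)).

Lemma zscalP q b : same_ratio n 1 q b (zscal q b).
Proof. exact: svalP (cid (same_ratio_ex b (zinv_ratio q) Bsurj)). Qed.

Lemma zscal_uniq q b y : same_ratio n 1 q b y -> zscal q b = y.
Proof. exact: same_ratio_uniq (@zinv_torsion_free n) Binj (zscalP q b). Qed.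

(** Any fraction that represents q computes its action; a single one for b, c and b + c gives additivity. *)
Lemma zscalE q b j (a : int) : q *+ n ^ j = 1 *~ a -> zscal q b *+ n ^ j = b *~ a.
Proof.
move=> qa; have [y ya] := mulrn_expn_surj j (b *~ a) Bsurj.
by rewrite (zscal_uniq (y := y)) //; exists j, a.
Qed.

Lemma zscalDr q : {morph zscal q : b c / b + c}.
Proof.
move=> b c; have [j [a qa]] := zinv_ratio q.
apply: (mulrn_expn_inj (j := j) Binj) => /=.
by rewrite mulrnDl !(zscalE _ qa) mulrzDl.
Qed.

Lemma zscalDl b : {morph (fun q => zscal q b) : p q / p + q}.
Proof. by move=> p q; apply: zscal_uniq; apply: same_ratioD; exact: zscalP. Qed.

Lemma zscal1 b : zscal 1 b = b.
Proof. by apply: zscal_uniq; exact: same_ratio_refl. Qed.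

Lemma zscalM p q b : zscal (p * q) b = zscal p (zscal q b).
Proof.
apply: zscal_uniq; apply: same_ratio_trans (zscalP q b) _.
rewrite -[X in same_ratio _ X _ _ _]mul1r.
exact: (same_ratio_morph (g := fun r => r * q) (h := id) (fun x y => mulrDl x y q)
  (fun _ _ => erefl) (zscalP p (zscal q b))).
Qed.

End InvertedScalars.

(** Additive maps are linear because the scalar multiples are characterized additively. *)
Lemma zscal_morph n (B C : zmodType) (Bs : forall b : B, exists b', b' *+ n = b)
    (Ci : injective (fun c : C => c *+ n)) (Cs : forall c : C, exists c', c' *+ n = c)
    (g : B -> C) (q : zinv n) b :
  {morph g : x y / x + y} -> g (zscal Bs q b) = zscal Cs q (g b).
Proof.
move=> gD; apply/esym; apply: zscal_uniq => //.
exact: (same_ratio_morph (g := id) (h := g) (fun _ _ => erefl) gD (zscalP Bs q b)).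
Qed.

Section GroupRingElements.
Variable G : finGroupType.
Local Notation n := #|{: G}|.
Local Notation zn := (zinv #|{: G}|).
Local Notation AG := (group_ring (zinv #|{: G}|) G).

Definition monomial (q : zn) (g : G) : AG := [ffun h => if h == g then q else 0].

Lemma monomial1 : monomial 1 1%g = 1.
Proof. by apply/ffunP => g; rewrite !ffunE; case: eqP. Qed.

Lemma monomialD g : {morph monomial^~ g : p q / p + q}.
Proof. by move=> p q; apply/ffunP => h; rewrite !ffunE; case: eqP; rewrite ?addr0. Qed.

Lemma monomialM p q g h : monomial p g * monomial q h = monomial (p * q) (g * h)%g.
Proof.
apply/ffunP => k; rewrite !ffunE (bigD1 g) //= big1 => [|i /negPf ig].
  by rewrite !ffunE eqxx addr0 -(inj_eq (mulgI g)) mulKVg; case: eqP; rewrite ?mulr0.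
by rewrite ffunE ig mul0r.
Qed.

(** The monomials span the group ring, so they suffice to check linearity and associativity. *)
Lemma sum_monomial (a : AG) : a = \sum_g monomial (a g) g.
Proof.
pose ev h (b : AG) : zn := b h.
have evD h : {morph ev h : x y / x + y} by move=> x y; rewrite /ev ffunE.
apply/ffunP => h; rewrite -[RHS]/(ev h _) (big_morph _ (evD h) (morph_zero (evD h))).
rewrite (bigD1 h) //= big1 => [|g /negPf gh]; rewrite /ev ffunE ?eqxx ?addr0 //.
by rewrite eq_sym gh.
Qed.

End GroupRingElements.

Section EvaluationModule.
Variables (G : finGroupType) (M : mackey G) (Mfree : free_inverted M).
Local Notation n := #|{: G}|.
Local Notation zn := (zinv #|{: G}|).
Local Notation AG := (group_ring (zinv #|{: G}|) G).
Local Notation sc := (zscal (card_surj Mfree)).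
Local Notation B := (M (gfree G)).
Local Notation w := (@weyl_act G M).

Definition ev_scale (a : AG) (m : B) : B := \sum_g sc (a g) (w g m).

Lemma sc_weyl q g m : w g (sc q m) = sc q (w g m).
Proof. exact: (zscal_morph (card_surj Mfree) (card_inj Mfree) (card_surj Mfree) _ _ (@weyl_actD G M g)). Qed.

Lemma sc0 m : sc 0 m = 0.
Proof. exact: morph_zero (zscalDl (card_inj Mfree) (card_surj Mfree) m). Qed.

Lemma ev_scale_monomial q g m : ev_scale (monomial q g) m = sc q (w g m).
Proof.
rewrite /ev_scale (bigD1 g) //= big1 => [|h /negPf hg]; rewrite ffunE ?eqxx ?addr0 //.
by rewrite hg sc0.
Qed.

Lemma ev_scaleDr a : {morph ev_scale a : x y / x + y}.
Proof.
move=> x y; rewrite /ev_scale -big_split; apply: eq_bigr => g _.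
by rewrite weyl_actD (zscalDr (card_inj Mfree)).
Qed.

Lemma ev_scaleDl m : {morph ev_scale^~ m : a b / a + b}.
Proof.
move=> a b; rewrite /ev_scale -big_split; apply: eq_bigr => g _.
by rewrite ffunE (zscalDl (card_inj Mfree)).
Qed.

Lemma ev_scale1 : left_id 1 ev_scale.
Proof. by move=> m; rewrite -monomial1 ev_scale_monomial (zscal1 (card_inj Mfree)) weyl_act1. Qed.

(** By additivity the claim reduces to monomials, where it says that the Weyl action commutes with fractions. *)
Lemma ev_scaleA a b m : ev_scale a (ev_scale b m) = ev_scale (a * b) m.
Proof.
have sums c : ev_scale c m = \sum_g ev_scale (monomial (c g) g) m.
  rewrite {1}(sum_monomial c).
  exact: (big_morph (ev_scale^~ m) (ev_scaleDl m) (morph_zero (ev_scaleDl m))).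
rewrite (sums b) (big_morph _ (ev_scaleDr a) (morph_zero (ev_scaleDr a))).
rewrite {1}(sum_monomial a).
under eq_bigr => g _.
  rewrite (big_morph (ev_scale^~ _) (ev_scaleDl _) (morph_zero (ev_scaleDl _))).
  under eq_bigr => h _ do rewrite !ev_scale_monomial sc_weyl -weyl_actM
    -(zscalM (card_inj Mfree)) -ev_scale_monomial -monomialM.
  over.
rewrite [in RHS](sum_monomial a) [in RHS](sum_monomial b) big_distrlr /=.
rewrite (big_morph (ev_scale^~ m) (ev_scaleDl m) (morph_zero (ev_scaleDl m))).
rewrite exchange_big; apply: eq_bigr => h _.
by rewrite (big_morph (ev_scale^~ m) (ev_scaleDl m) (morph_zero (ev_scaleDl m))).
Qed.

(** A copy of M(G/e) that remembers why |G| is invertible on it, to carry the module structure. *)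
Definition ev_type of free_inverted M : Type := B.
HB.instance Definition _ (Mf : free_inverted M) := GRing.Zmodule.on (ev_type Mf).
HB.instance Definition _ :=
  GRing.Zmodule_isLmodule.Build AG (ev_type Mfree) ev_scaleA ev_scale1 ev_scaleDr (fun m => ev_scaleDl m).
Definition ev_lmod : lmodType AG := ev_type Mfree.

End EvaluationModule.

(** * Fixed point functors as modules *)

Section BoxUniversal.
Variables (G : finGroupType) (M N P : mackey G).
Implicit Types X Y Z : gset G.
Variable pr : forall X Y, M X -> N Y -> P (gprod X Y).
Hypothesis prDl : forall X Y (n : N Y), {morph (fun m : M X => pr m n) : x y / x + y}.
Hypothesis prDr : forall X Y (m : M X), {morph (fun n : N Y => pr m n) : x y / x + y}.
Hypothesis pr_map : forall X X' Y Y' (s : span X X') (t : span Y Y') (m : M X) (n : N Y),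
  pr (mmap (vof s) m) (mmap (vof t) n) = mmap (vof (sprod s t)) (pr m n).

Definition box_lift_gen Z (b : box_gen M N Z) : P Z :=
  mmap (vof (bgw b)) (pr (bgm b) (bgn b)).

Lemma box_lift_rel Z s t : box_rel s t -> aeval (@box_lift_gen Z) s = aeval (@box_lift_gen Z) t.
Proof.
case=> {s t} /= [X Y w w' m v h|X Y w w1 w2 m v h|X Y w m m' v|X Y w m v v'
  |X X' Y Y' s t w w' m v h]; rewrite /box_lift_gen /=.
- exact: mmap_iso.
- by rewrite -mmap_sadd; apply: mmap_iso.
- by rewrite prDl mmapD.
- by rewrite prDr mmapD.
- by rewrite pr_map -mmap_scomp; apply: mmap_iso.
Qed.

(** The universal property of the box product: a biadditive pairing that is natural for spans extends to a
    map of Mackey functors. *)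
Definition box_lift Z : box M N Z -> P Z := plift (rel := @box_rel _ _ _ Z) (@box_lift_gen Z).

Lemma box_liftD Z : {morph @box_lift Z : x y / x + y}.
Proof. exact: pliftD (@box_lift_rel Z). Qed.

Lemma box_lift_bgen Z (X Y : sgset G) (w : sspan (gprod X Y) Z) (m : M X) (n : N Y) :
  box_lift (bgen w m n) = mmap (vof w) (pr m n).
Proof. exact: plift_gen (@box_lift_rel Z) _. Qed.

Lemma box_lift_hom : is_mackey_hom box_lift.
Proof.
apply: mackey_hom_spans => [X|X Y s]; first exact: box_liftD.
apply: (box_ext (v := fun x => mmap (vof s) (box_lift x))) => [x y|x y|X' Y' w m v].
- by rewrite mmapD box_liftD.
- by rewrite box_liftD mmapD.
rewrite mackey_of_spansE box_map_gen !box_lift_bgen -mmap_scomp; apply: mmap_iso.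
exact: shrink_span_iso.
Qed.

(** A universal element has the enumerations as its span; transferring along them undoes the restrictions. *)
Lemma box_lift_pair X Y (m : M X) (n : N Y) : box_lift (box_pair m n) = pr m n.
Proof.
rewrite box_lift_bgen pr_map -mmap_scomp -[RHS]mmap_sid; apply: mmap_iso.
apply: span_iso_trans (scomp_iso (shrink_span_iso _) (span_iso_refl _)) _.
apply: span_iso_trans (scomp_iso (span_iso_refl _) (span_iso_sym (sprod_res _ _))) _.
apply: tr_res_bij.
have [f fK fK'] := unshrink_bij X; have [h hK hK'] := unshrink_bij Y.
exists (fun z => (f z.1, h z.2)) => -[x y]; congr pair.
- exact: fK.
- exact: hK.
- exact: fK'.
- exact: hK'.
Qed.

End BoxUniversal.

Section ModuleScalars.
Variable G : finGroupType.
Local Notation n := #|{: G}|.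
Local Notation zn := (zinv #|{: G}|).
Local Notation AG := (group_ring (zinv #|{: G}|) G).
Variable V : lmodType AG.

Definition mono_act (g : G) (v : V) : V := monomial (1 : zn) g *: v.

Lemma mono_actD g : {morph mono_act g : x y / x + y}.
Proof. by move=> x y; rewrite /mono_act scalerDr. Qed.

Lemma mono_act1 v : mono_act 1%g v = v.
Proof. by rewrite /mono_act monomial1 scale1r. Qed.

Lemma mono_actM g h v : mono_act (g * h)%g v = mono_act g (mono_act h v).
Proof. by rewrite /mono_act scalerA monomialM mulr1. Qed.

Definition lmod_gmodule : gmodule G := GModule mono_actD mono_act1 mono_actM.

Definition const_scale (q : zn) (v : V) : V := monomial q 1%g *: v.

Lemma const_scaleDl v : {morph const_scale^~ v : p q / p + q}.
Proof. by move=> p q; rewrite /const_scale monomialD scalerDl. Qed.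

Lemma const_scaleDr q : {morph const_scale q : x y / x + y}.
Proof. by move=> x y; rewrite /const_scale scalerDr. Qed.

Lemma const_scale1 v : const_scale 1 v = v.
Proof. exact: mono_act1. Qed.

Lemma const_scaleM p q v : const_scale (p * q) v = const_scale p (const_scale q v).
Proof. by rewrite /const_scale scalerA monomialM mulg1. Qed.

Lemma const_scale_act q g v : const_scale q (mono_act g v) = mono_act g (const_scale q v).
Proof. by rewrite /const_scale /mono_act !scalerA !monomialM mul1g mulg1 mulr1 mul1r. Qed.

Lemma linear_of_additive (V' : lmodType AG) (f : V' -> V) :
  {morph f : x y / x + y} ->
  (forall q g v, f (monomial q g *: v) = monomial q g *: f v) -> linear f.
Proof.
move=> fD fm a x y; rewrite fD; congr (_ + _).
rewrite {1}(sum_monomial a) scaler_suml (big_morph f fD (morph_zero fD)).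
by rewrite [in RHS](sum_monomial a) scaler_suml; apply: eq_bigr => g _; rewrite fm.
Qed.

Lemma const_scale_ratio q v : same_ratio n 1 q v (const_scale q v).
Proof.
have h := same_ratio_morph (g := id) (h := const_scale^~ v) (fun _ _ => erefl) (const_scaleDl v).
have [j [a qa]] := zinv_ratio q.
rewrite -{1}(const_scale1 v); apply: h.
by exists j, a.
Qed.

Lemma lmod_card_inj : injective (fun v : V => v *+ n).
Proof.
have [q qn] := zinv_card_surj (card_G_gt0 G) 1.
have qK v : const_scale q (v *+ n) = v.
  rewrite (morph_mulrn _ _ (const_scaleDr q)) -(morph_mulrn _ _ (const_scaleDl v)) qn.
  exact: const_scale1.
by move=> v v' /= e; rewrite -(qK v) e qK.
Qed.

End ModuleScalars.

Section FixedPointMaps.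
Variables (G : finGroupType) (V W : gmodule G) (p : V -> W).
Hypothesis pD : {morph p : x y / x + y}.
Hypothesis pE : forall g v, p (vact g v) = vact g (p v).

Lemma fp_map_subproof (X : gset G) (f : fp_mackey V X) :
  [ffun x => p (f x)] \in @equivariant G W X.
Proof. by apply/equivariantP => g x; rewrite !ffunE fpE pE. Qed.
Definition fp_map (X : gset G) (f : fp_mackey V X) : fp_mackey W X :=
  FPType (fp_map_subproof f).

Lemma fp_mapE (X : gset G) (f : fp_mackey V X) x : fp_map f x = p (f x).
Proof. by rewrite ffunE. Qed.

Lemma fp_map_hom : is_mackey_hom fp_map.
Proof.
apply: mackey_hom_spans => [X f h|X Y s f]; apply: fp_ext => x; rewrite ?fp_spanE fp_mapE.
  by rewrite ffunE pD [RHS]ffunE !fp_mapE.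
rewrite fp_spanE (big_morph p pD (morph_zero pD)).
by apply: eq_bigr => a _; rewrite fp_mapE.
Qed.

End FixedPointMaps.

Section FixedPointModule.
Variables (G : finGroupType) (L : tambara G).
Local Notation n := #|{: G}|.
Local Notation zn := (zinv #|{: G}|).
Local Notation AG := (group_ring (zinv #|{: G}|) G).
Local Notation F := (fp_tambara (gring_trivial G (zinv #|{: G}|))).
Variables (k : forall X, L X -> F X) (V : lmodType AG).
Hypothesis kh : is_tambara_hom k.
Implicit Types X Y Z : gset G.
Local Notation FP := (fp_mackey (lmod_gmodule V)).
Local Notation U := (underlying L).

Definition ring_value X (r : L X) (x : X) : zn := k r x.

Lemma ring_valueD X (r s : L X) x : ring_value (r + s) x = ring_value r x + ring_value s x.
Proof. by rewrite /ring_value (tambara_homD kh) fpt_addE. Qed.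

Lemma ring_valueM X (r s : L X) x : ring_value (tmul r s) x = ring_value r x * ring_value s x.
Proof. by rewrite /ring_value (tambara_homM kh) fpt_mulE. Qed.

Lemma ring_value1 X x : ring_value (tone L X) x = 1.
Proof. by rewrite /ring_value (tambara_hom1 kh) fpt_oneE. Qed.

Lemma ring_value_span X Y (s : span X Y) (r : L X) y :
  ring_value (smap s r) y = \sum_(a | sright s a == y) ring_value r (sleft s a).
Proof.
rewrite /ring_value /smap kh ffunE /fpt_fun /=; apply: eq_bigr => a _.
by rewrite big_pred1_eq.
Qed.

Lemma ring_value_res X Y (f : ghom X Y) (r : L Y) x : ring_value (tmap (bres_map f) r) x = ring_value r (f x).
Proof. by rewrite /ring_value kh ffunE /fpt_fun !big_pred1_eq. Qed.

Lemma fp_pair_subproof X Y (r : L X) (v : FP Y) :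
  [ffun z => const_scale (ring_value r z.1) (v z.2)] \in @equivariant G (lmod_gmodule V) (gprod X Y).
Proof.
apply/equivariantP => g [x y]; rewrite !ffunE /= (fpE v) -const_scale_act.
by congr const_scale; exact: (fpE (k r) g x).
Qed.
(** An element of L(X) acts on FP(V) through its image in Z[1/|G|], pointwise. *)
Definition fp_pair X Y (r : L X) (v : FP Y) : FP (gprod X Y) := FPType (fp_pair_subproof r v).

Lemma fp_pairE X Y (r : L X) (v : FP Y) x y :
  fp_pair r v (x, y) = const_scale (ring_value r x) (v y).
Proof. by rewrite ffunE. Qed.

Lemma fp_pairDl X Y (v : FP Y) : {morph (fun r : L X => fp_pair r v) : x y / x + y}.
Proof.
move=> r s; apply: fp_ext => -[x y]; rewrite [RHS]ffunE !fp_pairE ring_valueD.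
exact: const_scaleDl.
Qed.

Lemma fp_pairDr X Y (r : L X) : {morph (fun v : FP Y => fp_pair r v) : x y / x + y}.
Proof.
move=> v v'; apply: fp_ext => -[x y]; rewrite [RHS]ffunE !fp_pairE ffunE.
exact: const_scaleDr.
Qed.

Lemma fp_pair_map X X' Y Y' (s : span X X') (t : span Y Y') (r : U X) (v : FP Y) :
  fp_pair (mmap (vof s) r : U X') (mmap (vof t) v) = mmap (vof (sprod s t)) (fp_pair r v).
Proof.
apply: fp_ext => -[x y]; rewrite fp_spanE fp_pairE mackey_of_spansE ring_value_span fp_spanE.
rewrite (big_morph _ (const_scaleDl _) (morph_zero (const_scaleDl _))).
under eq_bigr => a _ do rewrite (big_morph _ (const_scaleDr _) (morph_zero (const_scaleDr _))).
rewrite pair_big /=.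
by apply: eq_big => [[a b] //|[a b] _]; rewrite fp_pairE.
Qed.

Definition fp_act : forall Z, box U FP Z -> FP Z :=
  @box_lift G U FP FP fp_pair.

Lemma fp_act_hom : is_mackey_hom fp_act.
Proof. exact: (@box_lift_hom G U FP FP fp_pair fp_pairDl fp_pairDr fp_pair_map). Qed.

Lemma fp_act_pair X Y (r : U X) (v : FP Y) : fp_act (box_pair r v) = fp_pair r v.
Proof. exact: (@box_lift_pair G U FP FP fp_pair fp_pairDl fp_pairDr fp_pair_map). Qed.

Lemma fp_act_unit Y (m : FP Y) :
  fp_act (box_pair (M := U) (tone L (gpoint G)) m) = mres (gsnd (gpoint G) Y) m.
Proof.
rewrite fp_act_pair; apply: fp_ext => -[x y]; rewrite fp_pairE ring_value1 const_scale1.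
by rewrite fp_resE.
Qed.

Lemma fp_act_assoc X Y Z (r : L X) (s : L Y) (m : FP Z) :
  fp_act (box_pair (M := U) (text r s) m) =
  mres (gassoc X Y Z) (fp_act (box_pair (M := U) r (fp_act (box_pair (M := U) s m)))).
Proof.
rewrite !fp_act_pair; apply: fp_ext => -[[x y] z]; rewrite fp_pairE ring_valueM !ring_value_res.
by rewrite fp_resE !fp_pairE const_scaleM.
Qed.

Definition fp_tmodule : tmodule L := TModule fp_act_hom fp_act_unit fp_act_assoc.

End FixedPointModule.

(** * The equivalence of categories *)

Section FunctorIsos.
Variables (C D : category).

Lemma functor_iso_of (F K : cfunctor C D) (a : forall x, chom (F x) (K x)) :
  (forall x y (f : chom x y), ccomp (a y) (fhom F f) = ccomp (fhom K f) (a x)) ->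
  (forall x, exists b, ccomp b (a x) = cid_ (F x) /\ ccomp (a x) b = cid_ (K x)) ->
  functor_iso F K.
Proof.
move=> nat inv; exists a, (fun x => sval (cid (inv x))).
by split=> // x; case: (svalP (cid (inv x))).
Qed.

Lemma functor_iso_sym (F K : cfunctor C D) : functor_iso F K -> functor_iso K F.
Proof.
case=> a [b [nat ba ab]]; exists b, a; split=> // x y f.
by rewrite -[LHS]ccomp1r -(ab x) ccompA -(ccompA (b y)) -nat !ccompA ba ccomp1l.
Qed.

End FunctorIsos.

Lemma tmodule_hom_inv (G : finGroupType) (R : tambara G) (M N : tmodule R)
    (f : tmodule_hom M N) :
  (forall X, injective (sval f X)) -> (forall X y, exists x, sval f X x = y) ->
  exists h : tmodule_hom N M, tmodule_comp h f = tmodule_id M /\ tmodule_comp f h = tmodule_id N.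
Proof.
case: f => f [[fD fM] fA] /= fi fs; pose h X y := sval (cid (fs X y)).
have hK X y : f X (h X y) = y by rewrite /h; case: cid.
have hh : is_tmodule_hom h.
  split; last by move=> X Y r m; apply: fi; rewrite hK fA hK.
  by split=> [X y y'|X Y v y]; apply: fi; rewrite ?fD ?fM !hK.
exists (exist _ h hh); split; apply: eq_exist;
  apply: functional_extensionality_dep => X; apply: funext => x /=; last exact: hK.
by apply: fi; rewrite hK.
Qed.

Section Equivalence.
Variables (G : finGroupType) (L : tambara G).
Local Notation n := #|{: G}|.
Local Notation zn := (zinv #|{: G}|).
Local Notation AG := (group_ring (zinv #|{: G}|) G).
Local Notation F := (fp_tambara (gring_trivial G (zinv #|{: G}|))).
Variables (k : forall X, L X -> F X).
Hypothesis kh : is_tambara_hom k.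
Hypothesis Lunit : tunit (free_class L).
Hypothesis Lratio : forall r, has_ratio n (tone L (gfree G)) r.
Implicit Types (X Y Z : gset G) (M N : tmodule L) (V W : lmodType AG).

Definition tmodule_free M : free_inverted M := @module_free_inverted G L M Lunit.
Local Notation ev M := (ev_lmod (tmodule_free M)).
Local Notation FPmod V := (fp_tmodule V kh).

Lemma ev_monomial M q g (m : ev M) :
  monomial q g *: m = zscal (card_surj (tmodule_free M)) q (weyl_act g m).
Proof. exact: ev_scale_monomial. Qed.

Lemma ev_linear M N (f : tmodule_hom M N) : linear (sval f (gfree G) : ev M -> ev N).
Proof.
case: f => f [[fD fM] _] /=.
apply: (linear_of_additive (V := ev N) (V' := ev M) (fD (gfree G))) => q g v.
rewrite !ev_monomial.
rewrite (zscal_morph _ (card_inj (tmodule_free N)) (card_surj (tmodule_free N)) _ _ (fD (gfree G))).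
exact: (congr1 (zscal (card_surj (tmodule_free N)) q) (fM _ _ _ _)).
Qed.

Definition ev_hom M N (f : tmodule_hom M N) : lmod_hom (ev M) (ev N) :=
  exist _ _ (ev_linear f).

Lemma ev_hom_id M : ev_hom (tmodule_id M) = lmod_id (ev M).
Proof. exact: eq_exist. Qed.

Lemma ev_hom_comp M N P (g : tmodule_hom N P) (f : tmodule_hom M N) :
  ev_hom (tmodule_comp g f) = lmod_comp (ev_hom g) (ev_hom f).
Proof. exact: eq_exist. Qed.

Definition ev_functor : cfunctor (tmodule_category L) (lmod_category AG) :=
  @CFunctor (tmodule_category L) (lmod_category AG) (fun M => ev M) ev_hom ev_hom_id ev_hom_comp.

Lemma lmod_homD V W (f : lmod_hom V W) : {morph sval f : x y / x + y}.
Proof. by case: f => f fl x y /=; rewrite -{1}(scale1r x) fl scale1r. Qed.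

Lemma lmod_homZ V W (f : lmod_hom V W) a v : sval f (a *: v) = a *: sval f v.
Proof.
have f0 := morph_zero (lmod_homD f); case: f f0 => f fl /= f0.
by rewrite -[a *: v]addr0 fl f0 addr0.
Qed.

Lemma lmod_homE V W (f : lmod_hom V W) g (v : lmod_gmodule V) :
  sval f (vact g v) = @vact G (lmod_gmodule W) g (sval f v).
Proof. exact: lmod_homZ. Qed.

Lemma fp_tmod_act V X Y (r : L X) (v : FPmod V Y) :
  tmod_act (t := FPmod V) (box_pair (M := underlying L) r v) = fp_pair k r v.
Proof. exact: fp_act_pair. Qed.

Lemma fp_hom_subproof V W (f : lmod_hom V W) :
  @is_tmodule_hom G L (FPmod V) (FPmod W)
    (@fp_map G (lmod_gmodule V) (lmod_gmodule W) (sval f) (lmod_homE f)).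
Proof.
split; first exact: (@fp_map_hom G (lmod_gmodule V) (lmod_gmodule W) (sval f) (lmod_homD f)).
move=> X Y r m; rewrite !fp_tmod_act.
by apply: fp_ext => -[x y]; rewrite fp_mapE !fp_pairE fp_mapE lmod_homZ.
Qed.

Definition fp_hom V W (f : lmod_hom V W) : tmodule_hom (FPmod V) (FPmod W) :=
  exist _ _ (fp_hom_subproof f).

Lemma tmodule_hom_ext M N (f h : tmodule_hom M N) :
  (forall X x, sval f X x = sval h X x) -> f = h.
Proof.
case: f h => f fP [h hP] /= fh; apply: eq_exist.
by apply: functional_extensionality_dep => X; apply: funext.
Qed.

Lemma fp_hom_id V : fp_hom (lmod_id V) = tmodule_id (FPmod V).
Proof. by apply: tmodule_hom_ext => X f; apply: fp_ext => x; rewrite fp_mapE. Qed.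

Lemma fp_hom_comp U V W (g : lmod_hom V W) (f : lmod_hom U V) :
  fp_hom (lmod_comp g f) = tmodule_comp (fp_hom g) (fp_hom f).
Proof. by apply: tmodule_hom_ext => X h; apply: fp_ext => x; rewrite !fp_mapE. Qed.

Definition fp_functor : cfunctor (lmod_category AG) (tmodule_category L) :=
  @CFunctor (lmod_category AG) (tmodule_category L) (fun V => FPmod V) fp_hom fp_hom_id fp_hom_comp.

Lemma weyl_ev M g (m : weyl M) :
  (vact g m : lmod_gmodule (ev M)) = @vact G (lmod_gmodule (ev M)) g m.
Proof.
rewrite [RHS](ev_monomial (M := M) 1 g m).
by rewrite (zscal1 (card_inj (tmodule_free M))).
Qed.

(** The map of part (b), with the Weyl action read as the action of group elements in the group ring. *)
Definition unit_map M X (m : M X) : FPmod (ev M) X :=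
  fp_map (p := fun m : weyl M => m : lmod_gmodule (ev M)) (@weyl_ev M) (to_fixed m).

Lemma unit_mapE M X (m : M X) x : unit_map m x = mres (orbit_map x) m.
Proof. by rewrite fp_mapE to_fixedE. Qed.

Definition free_diag : ghom (gfree G) (gprod (gfree G) (gfree G)) :=
  @GHom G (gfree G) (gprod (gfree G) (gfree G)) (fun g => (g, g)) (fun _ _ => erefl).

(** The action of L(G/e) on M(G/e) is forced: r is a fraction a / |G|^j, the element 1 acts as the identity,
    and M(G/e) is uniquely divisible by |G|. *)
Lemma box_act_diag M (r : L (gfree G)) (m : M (gfree G)) :
  mres free_diag (box_act r m) =
  zscal (card_surj (tmodule_free M)) (ring_value k r 1%g) m.
Proof.
(* a is additive and sends 1 to m, so it preserves ratios. *)
pose a (s : L (gfree G)) := mres free_diag (box_act s m).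
have aD : {morph a : x y / x + y} by move=> s t; rewrite /a box_actDl [LHS]mmapD.
have a1 : a (tone L (gfree G)) = m by rewrite /a box_act_one mres_comp mres_id.
apply/esym; apply: (zscal_uniq (card_inj (tmodule_free M))).
rewrite -{1}(ring_value1 kh (1%g : gfree G)) -{1}a1 -/(a r).
apply: (same_ratio_morph (g := fun s => ring_value k s (1%g : gfree G))) => //.
  by move=> s t; exact: ring_valueD.
by have [j [b rb]] := Lratio r; exists j, b.
Qed.

(** Linearity is checked on the points (x, y) of X x Y. The orbit map of (x, y) factors through the diagonal
    of G/e, which reduces the claim to the action of L(G/e) on M(G/e). *)
Lemma unit_map_hom M : @is_tmodule_hom G L M (FPmod (ev M)) (@unit_map M).
Proof.
split.
  have [tD tM] := to_fixed_hom M.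
  have [pD pM] := fp_map_hom (p := fun m : weyl M => m : lmod_gmodule (ev M))
    (fun _ _ => erefl) (@weyl_ev M).
  by split=> [X x y|X Y v x]; rewrite /unit_map ?tD ?pD ?tM ?pM.
move=> X Y r m; rewrite fp_tmod_act; apply: fp_ext => -[x y].
rewrite fp_pairE !unit_mapE.
transitivity (mres free_diag (mres (gprodmap (orbit_map x) (orbit_map y)) (box_act r m))).
  by rewrite mres_comp; apply: mres_ext.
rewrite -box_act_res box_act_diag ring_value_res //= gact1.
rewrite /const_scale (ev_monomial (M := M)).
by rewrite weyl_act1.
Qed.

Definition unit_hom M : tmodule_hom M (FPmod (ev M)) := exist _ _ (@unit_map_hom M).

(** Naturality holds because maps of Mackey functors commute with the restrictions along orbit maps. *)
Lemma unit_iso : functor_iso (functor_id _) (functor_comp fp_functor ev_functor).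
Proof.
apply: (functor_iso_of (F := functor_id (tmodule_category L))
  (K := functor_comp fp_functor ev_functor) (a := unit_hom)) => [M N f|M].
  apply: tmodule_hom_ext => X m; apply: fp_ext => x.
  rewrite [RHS]fp_mapE [LHS](unit_mapE (M := N)).
  case: f => f [[fD fM] fA] /=; rewrite -[RHS]/(f _ (unit_map m x)) unit_mapE.
  by rewrite [RHS]fM.
apply: tmodule_hom_inv => X => [m m' e|f].
  apply: (to_fixed_inj (tmodule_free M)); apply: fp_ext => x.
  have := congr1 (fun h : FPmod (ev M) X => h x) e.
  by rewrite /= !unit_mapE !to_fixedE.
pose f' : {ffun X -> weyl M} := [ffun x => f x : weyl M].
have f'E : f' \in @equivariant G (weyl M) X.
  by apply/equivariantP => g x; rewrite !ffunE weyl_ev (fpE f).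
have [m mf] := to_fixed_surj (tmodule_free M) (FPType f'E).
by exists m; apply: fp_ext => x; rewrite [LHS]unit_mapE -to_fixedE mf /= ffunE.
Qed.

(** Equivariant functions on G/e are identified with their values at 1. *)
Definition counit_map V (f : ev (FPmod V)) : V := (f : FPmod V (gfree G)) 1%g.

Lemma counit_map_linear V : linear (@counit_map V).
Proof.
have cD : {morph @counit_map V : x y / x + y} by move=> x y; rewrite /counit_map ffunE.
apply: linear_of_additive => // q g f; rewrite ev_monomial.
have cZ (h : ev (FPmod V)) :
    counit_map (zscal (card_surj (tmodule_free (FPmod V))) q h) = const_scale q (counit_map h).
  apply: (same_ratio_uniq (@zinv_torsion_free n) (@lmod_card_inj G V) _ (@const_scale_ratio G V q _)).
  exact: (same_ratio_morph (g := id) (h := @counit_map V) (fun _ _ => erefl) cD (zscalP _ q h)).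
rewrite cZ /counit_map [weyl_act g f]/(mres _ _) fp_resE /= mul1g.
have := fpE (f : FPmod V (gfree G)) g (1%g : gfree G); rewrite /= mulg1 => ->.
by rewrite /const_scale /= /mono_act scalerA monomialM mul1g mulr1.
Qed.

Definition counit_hom V : lmod_hom (ev (FPmod V)) V := exist _ _ (@counit_map_linear V).

(** The inverse of the evaluation at 1 sends v to the function g |-> g v. *)
Lemma counit_iso : functor_iso (functor_comp ev_functor fp_functor) (functor_id _).
Proof.
apply: (functor_iso_of (F := functor_comp ev_functor fp_functor)
  (K := functor_id (lmod_category AG)) (a := counit_hom)) => [V W f|V].
  by apply: eq_exist; apply: funext => h; rewrite /= /counit_map fp_mapE.
have vE (v : V) : [ffun g : gfree G => mono_act g v] \in @equivariant G (lmod_gmodule V) (gfree G).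
  by apply/equivariantP => g h; rewrite !ffunE /= mono_actM.
pose b (v : V) : ev (FPmod V) := FPType (vE v) : FPmod V (gfree G).
have cb v : counit_map (b v) = v by rewrite /counit_map ffunE mono_act1.
have bc f : b (counit_map f) = f.
  apply: fp_ext => g; rewrite ffunE /counit_map.
  by have := fpE (f : FPmod V (gfree G)) g (1%g : gfree G); rewrite /= mulg1 => ->.
have bl : linear b.
  move=> a u v; rewrite -[LHS]bc -[RHS]bc.
  by congr b; rewrite counit_map_linear !cb.
exists (exist _ b bl); split; apply: eq_exist; apply: funext => x /=; [exact: bc|exact: cb].
Qed.

Lemma modules_equivalent : equivalent_categories (tmodule_category L) (lmod_category AG).
Proof.
exists ev_functor, fp_functor; split; last exact: counit_iso.
exact: functor_iso_sym unit_iso.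
Qed.

End Equivalence.

Theorem theorem6 (G : finGroupType) (A L : tambara G) (l : forall X : gset G, A X -> L X)
    (hA : is_burnside A) (hl : is_localization (free_class A) l) :
  tambara_iso L (fp_tambara (gring_trivial G (zinv #|{: G}|))) /\
  (forall M : tmodule L, mackey_iso M (fp_mackey (weyl M))) /\
  equivalent_categories (tmodule_category L)
    (lmod_category (group_ring (zinv #|{: G}|) G)).
Proof.
have Lunit : tunit (free_class L) := localization_tunit hl.
have iso := localization_iso hA hl; split=> //; split=> [M|].
  by apply: to_fixed_iso; exact: module_free_inverted.
have [k [h [kh hh kK _]]] := iso.
apply: (modules_equivalent kh Lunit) => r.
have [j [a ka]] := fpt_free_has_ratio (k _ r); exists j, a.
have hD := tambara_homD hh (X := gfree G).
by rewrite -{1}(kK _ r) -(morph_mulrn _ _ hD) ka (morph_mulrz _ _ hD) (tambara_hom1 hh).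
Qed.
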